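(* Let $T\in(0,\infty]$ be given. (a) Let $\sigma=0$. The following are equivalent for $f\in C^1([0,T),L_2(\mathbb{R}))$ and $\overline{\omega}=\overline\omega(t,x)$: (i) There exist $v_\pm,p_\pm$ such that $(f,v_\pm,p_\pm)$ solves the classical Muskat problem (M) on $[0,T)$ and, for all $t\in[0,T)$: $f(t)\in H^2(\mathbb{R})$; $\overline{\omega}(t)=\big\langle(v_-(t)-v_+(t))|_{[y=f(t,x)+Vt]}\,\big|\,(1,f'(t))\big\rangle\in H^1(\mathbb{R})$; $v_\pm(t)\in C(\overline{\Omega_\pm(t)})\cap C^1(\Omega_\pm(t))$; and $p_\pm(t)\in C^1(\overline{\Omega_\pm(t)})\cap C^2(\Omega_\pm(t))$. (ii) $(f,\overline{\omega})$ solves the evolution problem (P) on $[0,T)$, with $f(t)\in H^2(\mathbb{R})$ and $\overline{\omega}(t)\in H^1(\mathbb{R})$ for all $t\in[0,T)$. (b) Let $\sigma>0$. The following are equivalent for $f\in C^1((0,T),L_2(\mathbb{R}))\cap C([0,T),L_2(\mathbb{R}))$ and $\overline{\omega}=\overline\omega(t,x)$: (i) There exist $v_\pm,p_\pm$ such that $(f,v_\pm,p_\pm)$ solves the classical Muskat problem (M) on $[0,T)$ and, for all $t\in(0,T)$: $f(t)\in H^4(\mathbb{R})$; $\overline{\omega}(t)=\big\langle(v_-(t)-v_+(t))|_{[y=f(t,x)+Vt]}\,\big|\,(1,f'(t))\big\rangle\in H^1(\mathbb{R})$; $v_\pm(t)\in C(\overline{\Omega_\pm(t)})\cap C^1(\Omega_\pm(t))$;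 and $p_\pm(t)\in C^1(\overline{\Omega_\pm(t)})\cap C^2(\Omega_\pm(t))$. (ii) $(f,\overline{\omega})$ solves the evolution problem (P) on $[0,T)$, with $f(t)\in H^4(\mathbb{R})$ and $\overline{\omega}(t)\in H^1(\mathbb{R})$ for all $t\in(0,T)$.
   Context: Constants: permeability $k>0$, viscosities $\mu_\pm>0$, densities $\rho_\pm>0$, gravity $g\ge0$, velocity $V\in\mathbb{R}$, surface tension coefficient $\sigma\ge0$. The prime denotes $\partial_x$, $\kappa(f)=f''/(1+f'^2)^{3/2}$ is the curvature of the graph of $f$, $\langle\cdot|\cdot\rangle$ is the Euclidean inner product on $\mathbb{R}^2$, $\mathrm{PV}$ is the principal value (at zero and/or infinity). Set $\Omega_-(t):=[y<f(t,x)+Vt]$, $\Omega_+(t):=[y>f(t,x)+Vt]$, and let $\nu(t)$ be the unit normal at $[y=f(t,x)+Vt]$ pointing into $\Omega_+(t)$. Classical Muskat problem (M), with given initial datum $f_0$: - $\mathrm{div}\,v_\pm(t)=0$ and $v_\pm(t)=-\frac{k}{\mu_\pm}\big(\nabla p_\pm(t)+(0,\rho_\pm g)\big)$ in $\Omega_\pm(t)$; - $\langle v_+(t)|\nu(t)\rangle=\langle v_-(t)|\nu(t)\rangle$ and $p_+(t)-p_-(t)=\sigma\kappa(f(t))$ on $[y=f(t,x)+Vt]$; - $f(t,x)\to0$ for $|x|\to\infty$ and $v_\pm(t,x,y)\to(0,V)$ for $|(x,y)|\to\infty$; - $\partial_tf(t)=\langle v_\pm(t)|(-f'(t),1)\rangle-V$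 on $[y=f(t,x)+Vt]$; - $f(0)=f_0$. Evolution problem (P): $f(0)=f_0$ and, for $x\in\mathbb{R}$, $$\partial_tf(t,x)=\frac{1}{2\pi}\,\mathrm{PV}\!\int_{\mathbb{R}}\frac{y+f'(t,x)(f(t,x)-f(t,x-y))}{y^2+(f(t,x)-f(t,x-y))^2}\,\overline{\omega}(t,x-y)\,dy,$$ $$\Big[\sigma\kappa(f)-\Big(g(\rho_--\rho_+)+\frac{\mu_--\mu_+}{k}V\Big)f\Big]'(t,x)=\frac{\mu_-+\mu_+}{2k}\overline{\omega}(t,x)+\frac{\mu_--\mu_+}{2\pi k}\,\mathrm{PV}\!\int_{\mathbb{R}}\frac{yf'(t,x)-(f(t,x)-f(t,x-y))}{y^2+(f(t,x)-f(t,x-y))^2}\,\overline{\omega}(t,x-y)\,dy.$$ In both problems the equations other than the initial condition are required for all $t\in(0,T)$ if $\sigma>0$, and for all $t\in[0,T)$ (including $t=0$) if $\sigma=0$. *)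

(* Defs.v *)
From HB Require Import structures.
From mathcomp Require Import all_boot all_order all_algebra.
From mathcomp Require Import all_classical all_reals all_analysis.

Set Implicit Arguments.
Unset Strict Implicit.
Unset Printing Implicit Defensive.
Import Order.TTheory GRing.Theory Num.Theory.
Import numFieldNormedType.Exports.

Local Open Scope ring_scope.
Local Open Scope classical_set_scope.

Section L2_and_Sobolev.
Context {R : realType}.
Notation mu := (@lebesgue_measure R).

(** Elements of L_2 and H^k are represented by functions: an L_2-valued curve
    is a map [u : R -> R -> R] (time first), and the notions below that only
    concern L_2 see [u t] up to a.e. equality of measurable functions. *)
Definition L2 (h : R -> R) : Prop := h \in Lfun mu 2%:E.

Definition test_function (phi : R -> R) : Prop :=
  (forall n x, derivable (derive1n n phi) x 1) /\
  (exists M : R, forall x, M < `|x| -> phi x = 0).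

Definition weak_derivative (n : nat) (h h' : R -> R) : Prop :=
  forall phi, test_function phi ->
    \int[mu]_x (h x * derive1n n phi x) = (-1) ^+ n * \int[mu]_x (h' x * phi x).

(** [sobolev k h]: [h] is the continuous representative of an element of
    [H^k(R)], [k >= 1]; for it, classical derivatives up to order [k - 1]
    exist and are continuous, so that they may be evaluated pointwise. *)
Definition sobolev (k : nat) (h : R -> R) : Prop :=
  [/\ continuous h, L2 h &
      forall n, (n <= k)%N -> exists2 h', L2 h' & weak_derivative n h h'].

Definition L2_continuous (J : set R) (u : R -> R -> R) : Prop :=
  (forall t, J t -> L2 (u t)) /\
  (forall t, J t ->
    Lnorm mu 2%:E (fun x => (u s x - u t x)%:E) @[s --> within J (nbhs t)]
      --> 0%E).

(** [h] represents the derivative at [t] of the L_2-valued curve [u] on [J]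
    (one-sided when [t] is an end point of [J]). *)
Definition L2_is_derive (J : set R) (u : R -> R -> R) (t : R) (h : R -> R)
    : Prop :=
  L2 h /\
  Lnorm mu 2%:E (fun x => ((u s x - u t x) / (s - t) - h x)%:E)
    @[s --> within J t^'] --> 0%E.

Definition L2_C1 (J : set R) (u : R -> R -> R) : Prop :=
  L2_continuous J u /\
  exists2 u' : R -> R -> R,
    (forall t, J t -> L2_is_derive J u t (u' t)) & L2_continuous J u'.

(** Principal value at zero and at infinity. *)
Definition PV_domain (d : R) : set R := [set y | d < `|y| < d^-1].

Definition PV_integral (h : R -> R) : R :=
  lim ((\int[mu]_(y in PV_domain d) h y) @[d --> 0^'+]).

Definition PV_exists (h : R -> R) : Prop :=
  (forall d, 0 < d -> mu.-integrable (PV_domain d) (EFin \o h)) /\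
  cvg ((\int[mu]_(y in PV_domain d) h y) @[d --> 0^'+]).

End L2_and_Sobolev.

Section plane.
Context {R : realType}.

Definition dotp (a b : R * R) : R := a.1 * b.1 + a.2 * b.2.

Definition e1 : R * R := (1, 0).
Definition e2 : R * R := (0, 1).

Definition gradient (p : R * R -> R) (z : R * R) : R * R :=
  ('D_e1 p z, 'D_e2 p z).

Definition divergence (v : R * R -> R * R) (z : R * R) : R :=
  'D_e1 (fun w => (v w).1) z + 'D_e2 (fun w => (v w).2) z.

(** [C^n] on an open set [O]. *)
Fixpoint Cn_open (n : nat) (O : set (R * R)) (h : R * R -> R) : Prop :=
  {within O, continuous h} /\
  if n is m.+1 then
    forall e, e = e1 \/ e = e2 ->
      (forall z, O z -> derivable h z e) /\ Cn_open m O (fun z => 'D_e h z)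
  else True.

(** [C^1] on the closure of an open set [O]: the first derivatives in [O]
    extend continuously to the closure. *)
Definition C1_closure (O : set (R * R)) (h : R * R -> R) : Prop :=
  {within closure O, continuous h} /\
  forall e, e = e1 \/ e = e2 ->
    (forall z, O z -> derivable h z e) /\
    (exists2 h' : R * R -> R, {within closure O, continuous h'} &
       forall z, O z -> h' z = 'D_e h z).

(** [v z --> l] as [|z| --> oo] inside [A]; the norms are those of the product
    [R * R], which are equivalent to the Euclidean one. *)
Definition cvg_at_infinity (A : set (R * R)) (v : R * R -> R * R) (l : R * R)
    : Prop :=
  forall e : R, 0 < e ->
    exists M : R, forall z, A z -> M < `|z| -> `|v z - l| < e.

End plane.

Section Muskat.
Context {R : realType}.

(** [minus] is the fluid below the interface, [plus] the one above. *)
Variant phase := minus | plus.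

Record constants := Constants {
  permeability : R;
  viscosity : phase -> R;
  density : phase -> R;
  gravity : R;
  speed : R;
  surface_tension : R }.

Variable c : constants.
Let k := permeability c.
Let mu := viscosity c.
Let rho := density c.
Let g := gravity c.
Let V := speed c.
Let sigma := surface_tension c.

(** [[0,T)] and [(0,T)] for [T] in [(0,+oo]]. *)
Definition times0 (T : \bar R) : set R := [set t | 0 <= t /\ (t%:E < T)%E].
Definition times (T : \bar R) : set R := [set t | 0 < t /\ (t%:E < T)%E].

(** Times at which the equations other than the initial condition are
    required. *)
Definition equation_times (T : \bar R) : set R :=
  if 0 < sigma then times T else times0 T.

(** For [sigma = 0] the second derivative need not exist pointwise; curvature
    then only occurs multiplied by [sigma]. *)
Definition curvature (h : R -> R) (x : R) : R :=
  derive1n 2 h x / (1 + (derive1 h x) ^+ 2) `^ (3 / 2).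

Definition initial_condition (f : R -> R -> R) (f0 : R -> R) : Prop :=
  {ae @lebesgue_measure R, forall x, f 0 x = f0 x}.

Definition fluid_domain (h : R -> R) (t : R) (s : phase) : set (R * R) :=
  match s with
  | minus => [set z | z.2 < h z.1 + V * t]
  | plus => [set z | h z.1 + V * t < z.2]
  end.

Definition interface_point (h : R -> R) (t x : R) : R * R := (x, h x + V * t).

(** Unit normal at [interface_point h t x], pointing upwards into [plus]. *)
Definition unit_normal (h : R -> R) (x : R) : R * R :=
  (Num.sqrt (1 + (derive1 h x) ^+ 2))^-1 *: (- derive1 h x, 1).

Definition solves_Muskat (T : \bar R) (f0 : R -> R) (f : R -> R -> R)
    (v : phase -> R -> R * R -> R * R) (p : phase -> R -> R * R -> R) : Prop :=
  initial_condition f f0 /\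
  forall t, equation_times T t ->
    let Omega := fluid_domain (f t) t in
    let Gamma := interface_point (f t) t in
    let nu := unit_normal (f t) in
    [/\ forall s z, Omega s z ->
          divergence (v s t) z = 0 /\
          v s t z = - (k / mu s) *: (gradient (p s t) z + (0, rho s * g)),
        forall x,
          dotp (v plus t (Gamma x)) (nu x) =
            dotp (v minus t (Gamma x)) (nu x) /\
          p plus t (Gamma x) - p minus t (Gamma x) = sigma * curvature (f t) x,
        f t x @[x --> +oo] --> 0 /\ f t x @[x --> -oo] --> 0,
        forall s, cvg_at_infinity (closure (Omega s)) (v s t) (0, V) &
        forall s, L2_is_derive (equation_times T) f t
          (fun x => dotp (v s t (Gamma x)) (- derive1 (f t) x, 1) - V)].

(** Regularity of the velocities and pressures at time [t], [h] being the
    interface at that time. *)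
Definition fluid_regularity (h : R -> R) (t : R)
    (v : phase -> R -> R * R -> R * R) (p : phase -> R -> R * R -> R) : Prop :=
  forall s, let O := fluid_domain h t s in
    [/\ {within closure O, continuous (v s t)},
        Cn_open 1 O (fun z => (v s t z).1) /\
          Cn_open 1 O (fun z => (v s t z).2),
        C1_closure O (p s t) & Cn_open 2 O (p s t)].

Definition velocity_jump (h : R -> R) (v : phase -> R -> R * R -> R * R)
    (t x : R) : R :=
  let z := interface_point h t x in
  dotp (v minus t z - v plus t z) (1, derive1 h x).

(** Integrands of the two singular integrals, at [x], as functions of [y]. *)
Definition normal_integrand (h w : R -> R) (x y : R) : R :=
  (y + derive1 h x * (h x - h (x - y))) / (y ^+ 2 + (h x - h (x - y)) ^+ 2)
    * w (x - y).

Definition tangential_integrand (h w : R -> R) (x y : R) : R :=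
  (y * derive1 h x - (h x - h (x - y))) / (y ^+ 2 + (h x - h (x - y)) ^+ 2)
    * w (x - y).

Definition solves_evolution (T : \bar R) (f0 : R -> R) (f w : R -> R -> R)
    : Prop :=
  initial_condition f f0 /\
  forall t, equation_times T t ->
    [/\ forall x, PV_exists (normal_integrand (f t) (w t) x) /\
                  PV_exists (tangential_integrand (f t) (w t) x),
        L2_is_derive (equation_times T) f t
          (fun x => (2 * pi)^-1 * PV_integral (normal_integrand (f t) (w t) x)) &
        forall x : R,
          is_derive x 1
            (fun x => sigma * curvature (f t) x
               - (g * (rho minus - rho plus) + (mu minus - mu plus) / k * V)
                 * f t x)
            ((mu minus + mu plus) / (2 * k) * w t x
             + (mu minus - mu plus) / (2 * pi * k)
               * PV_integral (tangential_integrand (f t) (w t) x))].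

End Muskat.

Arguments constants R : clear implicits.

(* Main.v *)
(** At a fixed time the flow is free of divergence and curl off the interface,
    so its velocity should be [(0, V)] plus the Biot-Savart integral of the
    vorticity [w] carried by the interface. Seen from height [eta] above or below
    a point of the interface, that integral differs from the one over the tangent
    segment with constant density by an integral that is continuous across the
    interface, because the slope and [w] are 1/2-Hoelder; the tangent contribution
    is explicit (an arctangent and a logarithm) and jumps by
    [w (1, f') / (1 + f' ^ 2)]. At [eta = 0] the continuous part is the principal
    value, which gives the two traces of the velocity occurring in the evolution
    problem; the pressure is obtained by integrating the velocity along the
    interface and away from it. Conversely, the velocity of a solution minus the
    Biot-Savart velocity is continuous on the plane, solves the Cauchy-Riemann
    equations off the interface and vanishes at infinity. It has two primitives,
    which give it the mean value property on circles, so it is zero. *)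

Require Import Defs.
From mathcomp Require Import all_boot all_order all_algebra.
From mathcomp Require Import all_classical all_reals all_analysis.
From mathcomp Require Import measurable_realfun lebesgue_integral_under.
From mathcomp Require Import ring lra.
Import Order.TTheory GRing.Theory Num.Theory.
Import numFieldNormedType.Exports.

Local Open Scope ring_scope.
Local Open Scope classical_set_scope.

(** * Lebesgue integrals on the line *)

Section integrals.
Context {R : realType}.
Notation mu := (@lebesgue_measure R).
Notation itg D f := (mu.-integrable D (EFin \o f)).

(** Time is only a parameter: at each admissible [t] a problem in the plane is solved or inverted,
    and the two kinematic conditions then give the curve [f] the same derivative in L_2. Low
    regularity shapes the rest. The remainder left by the tangent segment is bounded by a multiple
    of [|u| ^ (- 1/2)], uniformly in the height, which is what carries continuity and principal
    values to the curve. At infinity the density is only square integrable, so decay comes without a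
    rate, from Young's inequality and dominated convergence. The Hoelder bounds themselves are read
    off weak derivatives, tested against smoothed indicators and ramps whose derivatives of the
    right order approximate Dirac masses. Each pressure is determined up to a constant, and
    differentiating the jump condition along the interface loses one constant, restored by
    normalising one of the two pressures. In the uniqueness part nothing is known about derivatives
    on the curve; integrating closed forms up to the curve asks only for continuity there. *)

Lemma measurable_itg (D : set R) (f : R -> R) : itg D f -> measurable_fun D f.
Proof. by move=> /integrableP[/measurable_EFinP]. Qed.

Lemma dominated_itg (D : set R) (f g : R -> R) : measurable D ->
  measurable_fun D f -> (forall x, D x -> `|f x| <= g x) -> itg D g -> itg D f.
Proof.
move=> mD mf fg; apply: le_integrable => //; first exact/measurable_EFinP.
by move=> x Dx /=; rewrite lee_fin (le_trans (fg _ Dx))// ler_norm.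
Qed.

Lemma itgD (D : set R) (f g : R -> R) : measurable D -> itg D f -> itg D g ->
  itg D (fun x => f x + g x).
Proof. by move=> mD /integrableD h /h; exact. Qed.

Lemma itgB (D : set R) (f g : R -> R) : measurable D -> itg D f -> itg D g ->
  itg D (fun x => f x - g x).
Proof. by move=> mD /integrableB h /h; exact. Qed.

Lemma itgZ (D : set R) (k : R) (f : R -> R) : measurable D -> itg D f ->
  itg D (fun x => k * f x).
Proof. by move=> mD /(integrableZl _ k)h; exact: h. Qed.

Lemma itgS (E D : set R) (f : R -> R) : measurable E -> measurable D ->
  D `<=` E -> itg E f -> itg D f.
Proof. by move=> mE mD DE h; exact: (@integrableS _ _ _ mu E D). Qed.

Lemma eq_itg (D : set R) (f g : R -> R) : measurable D ->
  (forall x, D x -> f x = g x) -> itg D f -> itg D g.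
Proof.
by move=> mD fg; apply: eq_integrable => // x /set_mem Dx /=; rewrite fg.
Qed.

Lemma itg_norm (D : set R) (f : R -> R) : measurable D -> itg D f ->
  itg D (fun x => `|f x|).
Proof. by move=> mD /integrable_abse; apply. Qed.

Lemma norm_Rintegral_le (D : set R) (f g : R -> R) : measurable D ->
  measurable_fun D f -> (forall x, D x -> `|f x| <= g x) -> itg D g ->
  `|\int[mu]_(x in D) f x| <= \int[mu]_(x in D) g x.
Proof.
move=> mD mf fg ig; have if_ : itg D f by apply: dominated_itg ig.
apply: (le_trans (le_normr_Rintegral _ if_)) => //.
by apply: le_Rintegral => //; exact: itg_norm.
Qed.

Lemma continuous_itg (a b : R) (f : R -> R) :
  {within `[a, b], continuous f} -> itg `[a, b] f.
Proof.
by move=> cf; apply: continuous_compact_integrable => //; exact: segment_compact.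
Qed.

Lemma ftc_derive (f F : R -> R) (a b : R) : a <= b ->
  (forall x, a <= x <= b -> is_derive x 1 F (f x)) ->
  {within `[a, b], continuous f} ->
  \int[mu]_(x in `[a, b]) f x = F b - F a.
Proof.
rewrite le_eqVlt => /predU1P[<- _ _|ab dF cf].
  by rewrite subrr set_itv1 Rintegral_set1.
have cF x : a <= x <= b -> F y @[y --> x] --> F x.
  move=> /dF dFx; apply: differentiable_continuous.
  by apply/derivable1_diffP; exact: ex_derive.
rewrite /Rintegral (@continuous_FTC2 _ f F)//.
- split => [x| |].
  + by rewrite in_itv/= => /andP[ax xb]; have := dF x; rewrite !ltW//; case.
  + by apply: cvg_at_right_filter; apply: cF; rewrite lexx ltW.
  + by apply: cvg_at_left_filter; apply: cF; rewrite lexx ltW.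
- move=> x; rewrite in_itv/= => /andP[ax xb].
  have ? := dF x; rewrite derive1E.
  by apply: derive_val; apply: dF; rewrite !ltW.
Qed.

Lemma measurable_subl (x : R) :
  measurable_fun setT (fun u : R => (x - u) : measurableTypeR R).
Proof. exact: measurable_funB. Qed.

(** A measure is determined by its values on the intervals []a, b]]; the reflection turns such an
    interval into one of the same length, closed at the other end. *)
Lemma lebesgue_measure_subl (x : R) (A : set R) : measurable A ->
  pushforward mu (fun u => (x - u) : measurableTypeR R) A = mu A.
Proof.
move=> mA; apply/esym/lebesgue_measure_unique => //=.
  exact: measurable_subl.
move=> _ _ [[a b]] _ <-.
rewrite /pushforward/=.
have -> : (fun u => x - u) @^-1` `]a, b]%classic = `[x - b, x - a[%classic.
  apply/seteqP; split => u /=; rewrite !in_itv/= => /andP[h1 h2].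
    by apply/andP; split; lra.
  by apply/andP; split; lra.
rewrite !lebesgue_measure_itv/= !lte_fin.
have -> : (x - b < x - a) = (a < b) by apply/idP/idP; lra.
by case: ifP => // _; rewrite -!EFinB; congr EFin; lra.
Qed.

Lemma integral_subl (x : R) (f : R -> R) : itg setT f ->
  itg setT (fun u => f (x - u)) /\
  \int[mu]_u f (x - u) = \int[mu]_u f u.
Proof.
move=> intf; have mf : measurable_fun setT f by exact: measurable_itg.
have E (g : R -> \bar R) : measurable_fun setT g ->
    (forall y, 0 <= g y)%E ->
    (\int[mu]_u g (x - u)%R = \int[mu]_u g u)%E.
  move=> mg g0.
  pose phi := (fun u : R => (x - u) : measurableTypeR R).
  rewrite -[X in integral mu X _](preimage_setT phi).
  rewrite -(@ge0_integral_pushforward _ _ (measurableTypeR R) (measurableTypeR R)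
    R phi (measurable_subl x) mu setT g)//.
  apply: eq_measure_integral => [|mphi A mA _]; first exact: measurable_subl.
  exact: lebesgue_measure_subl.
have mf' : measurable_fun setT (fun u : R => f (x - u)).
  by apply: (measurableT_comp mf); exact: measurable_subl.
split.
  apply/integrableP; split; first exact/measurable_EFinP.
  rewrite (E (fun y => `|(f y)%:E|%E))//.
    by case/integrableP: intf.
  by apply: measurableT_comp => //; exact/measurable_EFinP.
rewrite /Rintegral; congr fine.
rewrite integralE [RHS]integralE; congr (_ - _)%E.
- rewrite -(E ((fun y : R => (f y)%:E)^\+)%E)//; last first.
    exact/measurable_funepos/measurable_EFinP.
  by apply: eq_integral => u _; rewrite !funeposE.
- rewrite -(E ((fun y : R => (f y)%:E)^\-)%E)//; last first.
    exact/measurable_funeneg/measurable_EFinP.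
  by apply: eq_integral => u _; rewrite !funenegE.
Qed.

(** Dominated convergence concerns sequences. Any choice of points [z n] in [U n] tends to the
    filter, so that a sequential limit theorem applies to neighbourhoods in the plane and to
    infinity alike. *)
Definition countable_base {T} (G : set_system T) :=
  exists2 U : nat -> set T, (forall n, G (U n)) &
    (forall A, G A -> exists N, forall n, (N <= n)%N -> U n `<=` A).

Lemma countable_base_nbhs (z : R * R) : countable_base (nbhs z).
Proof.
exists (fun n => ball z n.+1%:R^-1) => [n|A].
  by apply: nbhsx_ballx; rewrite invr_gt0.
case/nbhs_ballP => e /= e0 eA.
near \oo => N; exists N => n Nn y yz; apply: eA.
apply: (le_ball _ yz).
apply: (@le_trans _ _ N.+1%:R^-1).
  by rewrite lef_pV2 ?posrE// ler_nat ltnS.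
by apply: ltW; near: N; exact: near_infty_natSinv_lt (PosNum e0).
Unshelve. all: by end_near. Qed.

Lemma countable_base_nbhsR (z : R) : countable_base (nbhs z).
Proof.
exists (fun n => ball z n.+1%:R^-1) => [n|A].
  by apply: nbhsx_ballx; rewrite invr_gt0.
case/nbhs_ballP => e /= e0 eA.
near \oo => N; exists N => n Nn y yz; apply: eA.
apply: (le_ball _ yz).
apply: (@le_trans _ _ N.+1%:R^-1).
  by rewrite lef_pV2 ?posrE// ler_nat ltnS.
by apply: ltW; near: N; exact: near_infty_natSinv_lt (PosNum e0).
Unshelve. all: by end_near. Qed.

Lemma countable_base_within T (G : set_system T) (A : set T) :
  Filter G -> countable_base G -> countable_base (within A G).
Proof.
move=> FG [U GU UA]; exists (fun n => A `&` U n) => [n|B] /=.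
  by rewrite /within/=; apply: filterS (GU n) => x Ux Ax.
rewrite {1}/within/= => /UA[N UB]; exists N => n Nn x [Ax Ux].
exact: (UB n Nn x Ux Ax).
Qed.

Lemma countable_base_pinfty T (f : T -> R) (G : set_system T) :
  (forall A, G A <-> exists M, forall x, M < f x -> A x) -> countable_base G.
Proof.
move=> GE; exists (fun n => [set x | n%:R < f x]) => [n|A /GE[M MA]].
  by apply/GE; exists n%:R.
have [N MN] : exists N, M <= N%:R.
  exists (Num.trunc `|M|).+1.
  by apply: (le_trans (ler_norm _)); apply: ltW; exact: truncnS_gt.
exists N => n Nn x /= nx; apply: MA; apply: le_lt_trans nx.
by rewrite (le_trans MN)// ler_nat.
Qed.

Lemma dominated_cvg_filter T (G : set_system T) (F : T -> R -> R)
    (f g : R -> R) (D : set R) : Filter G -> countable_base G ->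
  measurable D ->
  (\forall z \near G, measurable_fun D (F z)) ->
  (\forall z \near G, forall u, D u -> `|F z u| <= g u) ->
  itg D g -> measurable_fun D f ->
  {ae mu, forall u, D u -> F z u @[z --> G] --> f u} ->
  \int[mu]_(u in D) F z u @[z --> G] --> \int[mu]_(u in D) f u.
Proof.
move=> FG [U GU UA] mD mF Fg ig mf Ff.
apply/cvgrPdist_lt => e e0.
have [//|nE] := pselect (\forall z \near G,
  `|\int[mu]_(u in D) f u - \int[mu]_(u in D) F z u| < e).
pose P z := measurable_fun D (F z) /\ forall u, D u -> `|F z u| <= g u.
have [N0 UP] : exists N, forall n, (N <= n)%N -> U n `<=` P.
  by apply: UA; apply: filterS2 mF Fg => z; split.
(* If the limit fails for [e], every [U (N0 + n)] contains a point where it fails; these points form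
   a sequence tending to [G] that contradicts dominated convergence. *)
have /choice[z zP] : forall n, exists z, U (N0 + n)%N z /\
    ~ `|\int[mu]_(u in D) f u - \int[mu]_(u in D) F z u| < e.
  move=> n; apply: contrapT => /forallNP h; apply: nE.
  by apply: filterS (GU (N0 + n)%N) => x Ux; apply: contrapT => nx; apply: (h x).
have zG A : G A -> \forall n \near \oo, A (z n).
  move=> /UA[N UNA]; exists N => // n /= Nn; apply: (UNA (N0 + n)%N).
    by rewrite (leq_trans Nn)// leq_addl.
  by have [] := zP n.
have Pz n : P (z n) by apply: (UP (N0 + n)%N); [exact: leq_addr|case: (zP n)].
suff : \int[mu]_(u in D) F (z n) u @[n --> \oo] --> \int[mu]_(u in D) f u.
  move=> /cvgrPdist_lt/(_ _ e0)[n _ /(_ n (leqnn n))/=].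
  by have [] := zP n.
have cv : {ae mu, forall u, D u ->
    (EFin \o F (z n)) u @[n --> \oo] --> (EFin \o f) u}.
  have [N [mN muN sN]] := Ff; exists N; split => //.
  apply: subset_trans sN => u; apply: contra_not => + Du.
  move=> /(_ Du)/cvgrPdist_lt Ffu.
  apply: cvg_EFin; first exact: nearW.
  by apply/cvgrPdist_lt => d d0; exact: (zG _ (Ffu d d0)).
have mfz n : measurable_fun D (EFin \o F (z n)).
  by apply/measurable_EFinP; exact: (Pz n).1.
have mfE : measurable_fun D (EFin \o f) by exact/measurable_EFinP.
have Fg' : {ae mu, forall u n, D u -> (`|(EFin \o F (z n)) u| <= (EFin \o g) u)%E}.
  by apply: aeW => x n Dx /=; rewrite lee_fin; exact: (Pz n).2.
have [int_f _ cF] := @dominated_convergence _ _ _ mu D mD _ _ _ mfz mfE cv ig Fg'.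
by apply: fine_cvg; rewrite fineK//; exact: integrable_fin_num.
Qed.

End integrals.

(** * Integrals depending on a parameter, and primitives *)

Section parameter_integrals.
Context {R : realType}.
Notation mu := (@lebesgue_measure R).
Notation itg D f := (mu.-integrable D (EFin \o f)).

Lemma itg_mkcond (D : set R) (f : R -> R) : measurable D ->
  itg D f <-> itg setT (f \_ D).
Proof.
move=> mD.
have h := @integrable_restrict _ _ _ mu D mD setT measurableT (EFin \o f).
rewrite restrict_EFin setTI in h; exact: h.
Qed.

Lemma ge0_itg (D : set R) (f : R -> R) (M : R) : measurable D ->
  measurable_fun D f -> (forall x, D x -> 0 <= f x) ->
  (\int[mu]_(x in D) (f x)%:E <= M%:E)%E -> itg D f.
Proof.
move=> mD mf f0 fM; apply/integrableP; split; first exact/measurable_EFinP.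
apply: le_lt_trans (ltry M); apply: le_trans fM.
rewrite le_eqVlt; apply/orP; left; apply/eqP; apply: eq_integral => x.
by rewrite inE => Dx; rewrite /= ger0_norm// f0.
Qed.

(** One point is a measurable set, whatever the value taken there; the kernel integrands below are
    singular at [0] only. *)
Lemma measurable_off0 (f : R -> R) :
  (forall x, x != 0 -> {for x, continuous f}) -> measurable_fun setT f.
Proof.
move=> cf; rewrite -(setUv [set (0 : R)]).
have m0 : measurable [set (0 : R)] by exact: measurable_set1.
apply/measurable_funU => //; first exact: measurableC.
split; first exact: measurable_fun_set1.
apply: open_continuous_measurable_fun.
  by rewrite openC; exact: closed_eq.
by move=> x /set_mem/= /eqP; exact: cf.
Qed.

(** On [[1 / (n + 1), 1]] the primitive [2 sqrt x] bounds the integral by [2]; monotone convergence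
    reaches []0, 1]], and a reflection the other half. *)
Lemma itg_invsqrt : itg `[-1, 1] (fun u : R => (Num.sqrt `|u|)^-1).
Proof.
set g := fun u : R => _.
have cg0 x : x != 0 -> {for x, continuous g}.
  move=> x0; apply: cvgV; first by rewrite sqrtr_eq0 -ltNge normr_gt0.
  by apply: continuous_comp; [exact: norm_continuous|exact: sqrt_continuous].
have mg : measurable_fun setT g by exact: measurable_off0.
have g0 x : 0 <= g x by rewrite invr_ge0 sqrtr_ge0.
have dg (x : R) : 0 < x -> is_derive x 1 (fun x => 2 * Num.sqrt x) (g x).
  move=> x0; have ? := is_derive1_sqrt x0.
  apply: is_derive_eq.
  rewrite /g gtr0_norm// invfM /GRing.scale/= mulrA mulfV ?mul1r//.
have cg (a : R) : 0 < a -> {within `[a, 1], continuous g}.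
  move=> a0; apply: continuous_in_subspaceT => x /set_mem/=.
  rewrite in_itv/= => /andP[ax _].
  by apply: cg0; rewrite gt_eqF//; exact: lt_le_trans ax.
pose F (n : nat) : set R := `[n.+1%:R^-1, 1].
have Fn n : (\int[mu]_(x in F n) (g x)%:E <= 2%:E)%E.
  have n0 : 0 < n.+1%:R^-1 :> R by rewrite invr_gt0.
  have ig : itg (F n) g by apply: continuous_itg; exact: cg.
  have fin : (\int[mu]_(x in F n) (g x)%:E)%E \is a fin_num.
    apply: integrable_fin_num => //; exact: measurable_itv.
  rewrite -(fineK fin) lee_fin -[leLHS]/(\int[mu]_(x in F n) g x).
  have -> : \int[mu]_(x in F n) g x = 2 * Num.sqrt 1 - 2 * Num.sqrt n.+1%:R^-1.
    apply: (ftc_derive g (fun x => 2 * Num.sqrt x)).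
    - by rewrite invf_le1// ler1n.
    - by move=> x /andP[nx _]; apply: dg; exact: lt_le_trans nx.
    - exact: cg.
  by rewrite sqrtr1 mulr1 gerBl mulr_ge0// sqrtr_ge0.
have UF : \bigcup_n F n = `]0, 1]%classic.
  apply/seteqP; split => [x [n _]|x]/=.
    rewrite /F/= !in_itv/= => /andP[nx ->]; rewrite andbT.
    by apply: lt_le_trans nx; rewrite invr_gt0.
  rewrite in_itv/= => /andP[x0 x1].
  near \oo => n; exists n => //=; rewrite /F/= in_itv/= x1 andbT ltW//.
  by near: n; exact: near_infty_natSinv_lt (PosNum x0).
have I1 : itg `]0, 1] g.
  apply: (@ge0_itg _ _ 2) => //; first exact: measurable_funTS.
  rewrite -UF.
  have ndF : {homo F : n m / (n <= m)%N >-> (n <= m)%O}.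
    move=> n m nm; apply/subsetPset; apply: subset_itvr.
    by rewrite bnd_simp lef_pV2 ?posrE// ler_nat.
  have mF n : measurable (F n) by exact: measurable_itv.
  have mgF n : measurable_fun (F n) (EFin \o g).
    by apply/measurable_EFinP; exact: measurable_funTS.
  have gF n x : F n x -> (0 <= (EFin \o g) x)%E by rewrite lee_fin.
  have cF := @ge0_nondecreasing_set_cvg_integral _ (measurableTypeR R) R
    F (EFin \o g) mu ndF mF mgF gF.
  rewrite -(cvg_lim _ cF)//; apply: lime_le; last exact: nearW.
  by apply/cvg_ex; eexists; exact: cF.
have I2 := (itg_mkcond _ g (measurable_itv _)).1 I1.
have [I3 _] := integral_subl 0 _ I2.
have I4 := itgS _ `[-1, 1] _ measurableT _ _ (itgD _ _ _ measurableT I2 I3).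
apply: eq_itg (I4 _ _) => // x/=; rewrite in_itv/= => /andP[x1 x2].
rewrite !patchE sub0r !mem_setE !in_itv/= x2.
have -> : (- x <= 1) by lra.
rewrite oppr_gt0 !andbT -[point]/(0 : R).
case: (ltgtP x 0) => [x0|x0|->]; rewrite ?addr0 ?add0r//.
  by rewrite /g normrN.
(* At the origin both sides are [0], by the convention [0^-1 = 0]. *)
by rewrite /g normr0 sqrtr0 invr0.
Unshelve. all: by end_near. Qed.

Lemma itg_oneDsqrV : itg setT (fun u : R => (1 + u ^+ 2)^-1).
Proof.
have c1 : continuous (fun u : R => (1 + u ^+ 2)^-1).
  exact: continuous_oneDsqrV.
apply: (@ge0_itg _ _ pi) => //.
- by apply: continuous_measurable_fun.
- by move=> x _; rewrite invr_ge0 addr_ge0// sqr_ge0.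
rewrite ge0_symfun_integralT//.
- rewrite -set_itvcy integral0y_oneDsqr -EFinM.
  by rewrite mulrCA mulfV// mulr1.
- by move=> x; rewrite invr_ge0 addr_ge0// sqr_ge0.
- by move=> x /=; rewrite sqrrN.
Qed.

Lemma is_derive_Rintegral (F dF : R -> R -> R) (g : R -> R) (D : set R)
    (a e : R) : 0 < e -> measurable D ->
  (forall x, `|x - a| < e -> itg D (F x)) ->
  (forall x u, `|x - a| < e -> D u -> is_derive x 1 (F^~ u) (dF x u)) ->
  (forall x u, `|x - a| < e -> D u -> `|dF x u| <= g u) -> itg D g ->
  is_derive a 1 (fun x => \int[mu]_(u in D) F x u) (\int[mu]_(u in D) dF a u).
Proof.
move=> e0 mD iF dFF dFg ig.
(* Differentiation under the integral is applied with a bound that is nonnegative everywhere, while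
   [g] is controlled on [D] only. *)
pose G (u : R) : R := `|g u|.
have iG : itg D G by exact: itg_norm.
have Ia : `]a - e, a + e[%classic a by rewrite /= in_itv/=; apply/andP; split; lra.
have I x : `]a - e, a + e[%classic x -> `|x - a| < e.
  rewrite /= in_itv/= => /andP[? ?]; rewrite ltr_norml; apply/andP; split; lra.
have d1 x u : `|x - a| < e -> D u -> partial1of2 F x u = dF x u.
  move=> xe Du; rewrite partial1of2E.
  by have ? := dFF x u xe Du; exact: derive_val.
have iF' x : `]a - e, a + e[%classic x -> itg D (F x) by move=> /I; exact: iF.
have dF' x u : `]a - e, a + e[%classic x -> D u -> derivable (F^~ u) x 1.
  by move=> /I xe Du; have ? := dFF x u xe Du; exact: ex_derive.
have Gub x u : `]a - e, a + e[%classic x -> D u -> `|partial1of2 F x u| <= G u.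
  move=> /I xe Du; rewrite d1//; apply: (le_trans (dFg _ _ xe Du)).
  exact: ler_norm.
apply: DeriveDef.
  exact: (@derivable_under_integral _ _ _ mu F D mD a _ _ Ia iF' dF' G
    (fun u => normr_ge0 _) iG Gub).
rewrite -derive1E.
rewrite (@differentiation_under_integral _ _ _ mu F D mD a _ _ Ia iF' dF' G
  (fun u => normr_ge0 _) iG Gub).
by apply: eq_Rintegral => u /set_mem Du; rewrite d1// subrr normr0.
Qed.

(** The oriented integral from [0] to [x]: for [x != 0] one of the two intervals is empty. *)
Definition prim (f : R -> R) (x : R) : R :=
  \int[mu]_(t in `[0, x]) f t - \int[mu]_(t in `[x, 0]) f t.

Lemma prim0 (f : R -> R) : prim f 0 = 0.
Proof. by rewrite /prim subrr. Qed.

Lemma is_derive_prim (f : R -> R) (x : R) : continuous f ->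
  is_derive x 1 (prim f) (f x).
Proof.
(* For [y >= - N] the primitive is [F y - F 0], with the fixed base point [- N]; this [N] puts both
   [0] and a neighbourhood of [x] to the right of [- N]. *)
move=> cf; pose N : R := `|x| + 2.
have ci (a b : R) : itg `[a, b] f.
  by apply: continuous_itg; exact: continuous_subspaceT.
pose F (y : R) : R := \int[mu]_(t in `[- N, y]) f t.
have FE (y z : R) : - N <= y -> y <= z ->
    F z - F y = \int[mu]_(t in `[y, z]) f t.
  move=> Ny yz; rewrite Rintegral_itvB ?bnd_simp//.
  rewrite Rintegral_itv_obnd_cbnd//; apply: itgS (ci y z) => //.
  exact: subset_itv_oc_cc.
have PE y : - N <= y -> prim f y = F y - F 0.
  move=> Ny; have N0 : - N <= 0 by rewrite oppr_le0 addr_ge0.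
  rewrite /prim; have [y0|y0] := leP 0 y.
    rewrite -FE//; move: y0; rewrite le_eqVlt => /predU1P[<-|y0].
      by rewrite set_itv1 Rintegral_set1 subr0 subrr.
    have -> : `[y, 0]%classic = set0.
      by apply: set_itv_ge; rewrite bnd_simp -ltNge.
    by rewrite Rintegral_set0 subr0.
  rewrite set_itv_ge ?Rintegral_set0 ?sub0r; last by rewrite bnd_simp -ltNge.
  by rewrite -FE ?opprB// ltW.
have Nx : - N < x - 1.
  rewrite /N; have := ler_norm (- x); rewrite normrN; lra.
have xx1 : x < x + 1 by lra.
have Nx' : - N < x by lra.
have [dF F'] := continuous_FTC1_closed xx1 (ci (- N) (x + 1)) Nx' (cf x).
apply: (near_eq_is_derive (f := fun y => F y - F 0)).
  near=> y; rewrite PE//; near: y.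
  exact: (cvgr_ge x).
have dFx : is_derive x 1 F (f x).
  by apply: (DeriveDef dF); rewrite -derive1E; exact: F'.
by rewrite -[f x]subr0; apply: is_deriveB.
Unshelve. all: by end_near. Qed.

End parameter_integrals.

(** * Calculus in the plane and Liouville's theorem *)

Section plane_calculus.
Context {R : realType}.

Lemma is_derive1P (f : R -> R) (x d : R) :
  is_derive x 1 f d <-> h^-1 * (f (x + h) - f x) @[h --> 0^'] --> d.
Proof.
have E : (fun h : R => h^-1 *: (f (h *: 1 + x) - f x)) =
         (fun h : R => h^-1 * (f (x + h) - f x)).
  by apply/funext => h; rewrite scaler1 [h + x]addrC.
split=> [[dv <-]|cv].
  by have := dv; rewrite /derivable /derive E => /cvg_ex[l cl]; rewrite (cvg_lim _ cl).
apply: DeriveDef.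
  by rewrite /derivable E; apply/cvg_ex; exists d.
by rewrite /derive E; exact: cvg_lim cv.
Qed.

Lemma is_derive_continuous (f : R -> R) (x d : R) : is_derive x 1 f d ->
  {for x, continuous f}.
Proof.
by move=> fd; apply/differentiable_continuous/derivable1_diffP; exact: ex_derive.
Qed.

Lemma continuous_fst2 : continuous (fst : R * R -> R).
Proof. move=> [x y]; exact: cvg_fst. Qed.
Lemma continuous_snd2 : continuous (snd : R * R -> R).
Proof. move=> [x y]; exact: cvg_snd. Qed.
Lemma continuous_pair2 {T : topologicalType} (f g : T -> R) (x : T) :
  {for x, continuous f} -> {for x, continuous g} ->
  {for x, continuous (fun t => (f t, g t))}.
Proof. move=> cf cg; exact: (cvg_pair cf cg). Qed.

Lemma is_derive_inv (f : R -> R) (x df : R) : f x != 0 -> is_derive x 1 f df ->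
  is_derive x 1 (fun y => (f y)^-1) (- df / f x ^+ 2).
Proof.
move=> fx0 dfx.
have df0 : derivable f x 1 by apply: ex_derive.
apply: (DeriveDef (derivableV fx0 df0)); rewrite deriveV//.
by rewrite derive_val /GRing.scale/= mulrC mulrN mulNr.
Qed.

Lemma mvt_between (f df : R -> R) (a b : R) :
  (forall x, Num.min a b <= x <= Num.max a b -> is_derive x 1 f (df x)) ->
  exists2 c, Num.min a b <= c <= Num.max a b & f b - f a = df c * (b - a).
Proof.
wlog ab : a b / a <= b.
  move=> H; case: (leP a b) => [ab|/ltW ab] dfx.
    by have := H a b ab; rewrite (min_l ab) (max_r ab); exact.
  have [|c cab E] := H b a ab.
    by rewrite (min_l ab) (max_r ab).
  exists c; first by rewrite (min_l ab) (max_r ab) in cab.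
  by rewrite -[LHS]opprB E -mulrN opprB.
rewrite (min_l ab) (max_r ab) => dfx.
move: ab; rewrite le_eqVlt => /predU1P[<-|ab].
  by exists a; rewrite ?lexx// !subrr mulr0.
have [||c] := @MVT _ f df a b ab.
- by move=> x; rewrite in_itv/= => /andP[ax xb]; apply: dfx; rewrite !ltW.
- apply: derivable_within_continuous => x; rewrite in_itv/= => xab.
  by have [] := dfx x xab.
by rewrite in_itv/= => /andP[ac cb] E; exists c => //; rewrite !ltW.
Qed.

Lemma zero_derive_constant (f : R -> R) (a b : R) :
  (forall x, Num.min a b < x < Num.max a b -> is_derive x 1 f 0) ->
  {within `[Num.min a b, Num.max a b], continuous f} -> f a = f b.
Proof.
wlog ab : a b / a <= b.
  move=> H; case: (leP a b) => [ab|/ltW ab] dfx.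
    by have := H a b ab; rewrite (min_l ab) (max_r ab); exact.
  move=> cf; apply/esym; apply: (H b a ab).
    by rewrite (min_l ab) (max_r ab).
  by rewrite (min_l ab) (max_r ab).
rewrite (min_l ab) (max_r ab) => dfx cf.
move: ab; rewrite le_eqVlt => /predU1P[<-//|ab].
have dfx' x : x \in `]a, b[%R -> is_derive x 1 f 0 by rewrite in_itv/= => /dfx.
have [c _] := @MVT _ f (fun=> 0) a b ab dfx' cf.
by move=> /eqP; rewrite mul0r subr_eq0 => /eqP.
Qed.

(** The mean value theorem on horizontal segments, with [F1] continuous at [z], makes the
    first-order approximation uniform in the height [y] and in both end points. *)
Lemma partial1_slope (F F1 : R * R -> R) (z : R * R) (e : R) : 0 < e ->
  (\forall w \near (z : R * R), is_derive (w : R * R).1 1 (fun x => F (x, w.2)) (F1 w)) ->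
  {for z, continuous F1} ->
  exists2 d, 0 < d & forall x x' y, `|x - z.1| < d -> `|x' - z.1| < d ->
    `|y - z.2| < d ->
    `|F (x', y) - F (x, y) - F1 z * (x' - x)| <= e * `|x' - x|.
Proof.
move=> e0 dF /cvgrPdist_le/(_ e e0) cF.
have [d /= d0 dP] := (nbhs_ballP _ _).1 (filterI dF cF).
exists d => // x x' y xd x'd yd.
have B c : Num.min x x' <= c <= Num.max x x' -> ball z d (c, y).
  move=> /andP[c1 c2]; split; rewrite /ball/=; last by rewrite distrC.
  rewrite distrC; move: xd x'd; rewrite !ltr_norml => /andP[x1 x2] /andP[x3 x4].
  apply/andP; split.
    have : z.1 - d < Num.min x x' by rewrite lt_min; apply/andP; split; lra.
    by lra.
  have : Num.max x x' < z.1 + d by rewrite gt_max; apply/andP; split; lra.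
  by lra.
have [c cx ->] : exists2 c, Num.min x x' <= c <= Num.max x x' &
    F (x', y) - F (x, y) = F1 (c, y) * (x' - x).
  apply: (mvt_between (fun x => F (x, y)) (fun x => F1 (x, y))) => c cx.
  by have [] := dP (c, y) (B c cx).
rewrite -mulrBl normrM ler_wpM2r// distrC.
by have [_] := dP (c, y) (B c cx).
Qed.

Lemma partial2_slope (F F2 : R * R -> R) (z : R * R) (e : R) : 0 < e ->
  (\forall w \near (z : R * R), is_derive (w : R * R).2 1 (fun y => F (w.1, y)) (F2 w)) ->
  {for z, continuous F2} ->
  exists2 d, 0 < d & forall x y y', `|x - z.1| < d -> `|y - z.2| < d ->
    `|y' - z.2| < d ->
    `|F (x, y') - F (x, y) - F2 z * (y' - y)| <= e * `|y' - y|.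
Proof.
move=> e0; case: z => z1 z2 dF cF.
pose sw (w : R * R) := (w.2, w.1).
have csw (w : R * R) : {for w, continuous sw}.
  by apply: continuous_pair2; [exact: continuous_snd2|exact: continuous_fst2].
have [||d d0 dP] := @partial1_slope (F \o sw) (F2 \o sw) (z2, z1) e e0.
- exact: (csw (z2, z1) _ dF).
- by apply: continuous_comp; [exact: csw|exact: cF].
exists d => // x y y' xd yd y'd.
exact: (dP y y' x yd y'd xd).
Qed.

(** Continuity of the partial derivatives at the point stands in for differentiability in the plane:
    the increment is a horizontal step at the height already reached, followed by a vertical one,
    and the two slope estimates control them. *)
Lemma is_derive_chain2 (F F1 F2 : R * R -> R) (a b : R -> R) (t da db : R) :
  let z := (a t, b t) in
  (\forall w \near (z : R * R), is_derive (w : R * R).1 1 (fun x => F (x, w.2)) (F1 w)) ->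
  (\forall w \near (z : R * R), is_derive (w : R * R).2 1 (fun y => F (w.1, y)) (F2 w)) ->
  {for z, continuous F1} -> {for z, continuous F2} ->
  is_derive t 1 a da -> is_derive t 1 b db ->
  is_derive t 1 (fun s => F (a s, b s)) (F1 z * da + F2 z * db).
Proof.
move=> z dF1 dF2 cF1 cF2 dea deb.
have ca := is_derive_continuous _ _ _ dea.
have cb := is_derive_continuous _ _ _ deb.
move/is_derive1P : dea => dea; move/is_derive1P : deb => deb.
apply/is_derive1P.
have cvs (f : R -> R) : {for t, continuous f} ->
    f (t + h) @[h --> 0^'] --> f t.
  move=> cf; apply: cvg_within_filter.
  rewrite -[X in _ --> f X](addr0 t).
  apply: continuous_comp; last by rewrite addr0.
  by apply: cvgD; [exact: cvg_cst|exact: cvg_id].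
pose s1 h := F (a (t + h), b (t + h)) - F (a t, b (t + h))
             - F1 z * (a (t + h) - a t).
pose s2 h := F (a t, b (t + h)) - F (a t, b t) - F2 z * (b (t + h) - b t).
have S1 : h^-1 * s1 h @[h --> 0^'] --> 0.
  apply/cvgr0Pnorm_le => e e0.
  have K0 : 0 < `|da| + 1 by rewrite ltr_wpDl.
  have [d d0 dP] := partial1_slope _ _ _ _ (divr_gt0 e0 K0) dF1 cF1.
  have ha : \forall h \near 0^', `|a (t + h) - a t| < d.
    have /cvgrPdist_lt/(_ d d0) := cvs a ca.
    by apply: filterS => h; rewrite distrC.
  have hb : \forall h \near 0^', `|b (t + h) - b t| < d.
    have /cvgrPdist_lt/(_ d d0) := cvs b cb.
    by apply: filterS => h; rewrite distrC.
  have hq : \forall h \near 0^', `|h^-1 * (a (t + h) - a t)| <= `|da| + 1.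
    have /cvgrPdist_le/(_ 1 ltr01) := dea.
    apply: filterS => h H.
    rewrite -[X in `|X|](subrK da) (le_trans (ler_normD _ _))// addrC lerD2l.
    by rewrite distrC.
  near=> h.
  have H1 : `|a (t + h) - a t| < d by near: h.
  have H2 : `|b (t + h) - b t| < d by near: h.
  have H3 : `|h^-1 * (a (t + h) - a t)| <= `|da| + 1 by near: h.
  have := dP (a t) (a (t + h)) (b (t + h)).
  rewrite subrr normr0 => /(_ d0 H1 H2) H4.
  rewrite normrM; apply: (@le_trans _ _ (`|h^-1| * (e / (`|da| + 1) * `|a (t + h) - a t|))).
    by rewrite ler_wpM2l.
  rewrite mulrCA -normrM.
  rewrite -[leRHS](divfK (lt0r_neq0 K0)).
  by rewrite ler_wpM2l// divr_ge0// ltW.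
have S2 : h^-1 * s2 h @[h --> 0^'] --> 0.
  apply/cvgr0Pnorm_le => e e0.
  have K0 : 0 < `|db| + 1 by rewrite ltr_wpDl.
  have [d d0 dP] := partial2_slope _ _ _ _ (divr_gt0 e0 K0) dF2 cF2.
  have hb : \forall h \near 0^', `|b (t + h) - b t| < d.
    have /cvgrPdist_lt/(_ d d0) := cvs b cb.
    by apply: filterS => h; rewrite distrC.
  have hq : \forall h \near 0^', `|h^-1 * (b (t + h) - b t)| <= `|db| + 1.
    have /cvgrPdist_le/(_ 1 ltr01) := deb.
    apply: filterS => h H.
    rewrite -[X in `|X|](subrK db) (le_trans (ler_normD _ _))// addrC lerD2l.
    by rewrite distrC.
  near=> h.
  have H2 : `|b (t + h) - b t| < d by near: h.
  have H3 : `|h^-1 * (b (t + h) - b t)| <= `|db| + 1 by near: h.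
  have := dP (a t) (b t) (b (t + h)).
  rewrite !subrr normr0 => /(_ d0 d0 H2) H4.
  rewrite normrM; apply: (@le_trans _ _ (`|h^-1| * (e / (`|db| + 1) * `|b (t + h) - b t|))).
    by rewrite ler_wpM2l.
  rewrite mulrCA -normrM.
  rewrite -[leRHS](divfK (lt0r_neq0 K0)).
  by rewrite ler_wpM2l// divr_ge0// ltW.
have -> : (fun h => h^-1 * (F (a (t + h), b (t + h)) - F (a t, b t))) =
  (fun h => h^-1 * s1 h + h^-1 * s2 h + (F1 z * (h^-1 * (a (t + h) - a t))
     + F2 z * (h^-1 * (b (t + h) - b t)))).
  by apply/funext => h; rewrite /s1 /s2; ring.
rewrite -[X in _ --> X]add0r -[X in _ --> X + _]addr0.
by apply: cvgD; apply: cvgD => //; apply: cvgMr.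
Unshelve. all: by end_near. Qed.

End plane_calculus.

Section partial_derivatives.
Context {R : realType}.
Notation mu := (@lebesgue_measure R).

Lemma is_derive_e1 (p : R * R -> R) (x y d : R) :
  is_derive (x, y) e1 p d <-> is_derive x 1 (fun s => p (s, y)) d.
Proof.
have E : (fun h : R => h^-1 *: (p (h *: e1 + (x, y)) - p (x, y))) =
         (fun h : R => h^-1 *: (p (h *: 1 + x, y) - p (x, y))).
  apply/funext => h; congr (_ *: (p _ - _)); rewrite /e1.
  by congr pair; rewrite /= scaler0 add0r.
split=> -[] dv dE; apply: DeriveDef.
- by move: dv; rewrite /derivable E.
- by move: dE; rewrite /derive E.
- by rewrite /derivable E.
- by rewrite /derive E.
Qed.

Lemma is_derive_e2 (p : R * R -> R) (x y d : R) :
  is_derive (x, y) e2 p d <-> is_derive y 1 (fun s => p (x, s)) d.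
Proof.
have E : (fun h : R => h^-1 *: (p (h *: e2 + (x, y)) - p (x, y))) =
         (fun h : R => h^-1 *: (p (x, h *: 1 + y) - p (x, y))).
  apply/funext => h; congr (_ *: (p _ - _)); rewrite /e2.
  by congr pair; rewrite /= scaler0 add0r.
split=> -[] dv dE; apply: DeriveDef.
- by move: dv; rewrite /derivable E.
- by move: dE; rewrite /derive E.
- by rewrite /derivable E.
- by rewrite /derive E.
Qed.

Lemma Cn_open_eq (n : nat) (O : set (R * R)) (h h' : R * R -> R) :
  open O -> (forall z, O z -> h z = h' z) -> Cn_open n O h -> Cn_open n O h'.
Proof.
move=> oO; elim: n h h' => [|n IH] h h' hh' /=.
  by move=> [ch _]; split => //; apply: subspace_eq_continuous ch => z /set_mem; exact: hh'.
move=> [ch dh]; split.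
  by apply: subspace_eq_continuous ch => z /set_mem; exact: hh'.
have nz z : O z -> \forall w \near z, h w = h' w.
  by move=> Oz; near=> w; apply: hh'; near: w; exact: open_nbhs_nbhs.
move=> e ee; have [dhe Ch] := dh e ee; split.
  move=> z Oz; apply: near_eq_derivable (dhe z Oz).
  exact: nz.
apply: IH Ch => z Oz; apply: near_eq_derive.
exact: nz.
Unshelve. all: by end_near. Qed.

Lemma continuous_sec1 (f : R * R -> R) (x y : R) : {for (x, y), continuous f} ->
  {for x, continuous (fun s => f (s, y))}.
Proof.
move=> cf; apply: (@continuous_comp _ _ _ (fun s => (s, y))); last exact: cf.
by apply: continuous_pair2; [exact: cvg_id|exact: cvg_cst].
Qed.

Lemma continuous_sec2 (f : R * R -> R) (x y : R) : {for (x, y), continuous f} ->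
  {for y, continuous (fun s => f (x, s))}.
Proof.
move=> cf; apply: (@continuous_comp _ _ _ (fun s => (x, s))); last exact: cf.
by apply: continuous_pair2; [exact: cvg_cst|exact: cvg_id].
Qed.

Lemma bounded_rectangle (f : R * R -> R) (a b c d : R) :
  (forall x y, a <= x <= b -> c <= y <= d -> {for (x, y), continuous f}) ->
  exists M, forall x y, a <= x <= b -> c <= y <= d -> `|f (x, y)| <= M.
Proof.
move=> cf; pose K := `[a, b]%classic `*` `[c, d]%classic.
have cK : compact K by apply: compact_setX; exact: segment_compact.
have cfK : {within K, continuous f}.
  apply: continuous_in_subspaceT => -[x y] /set_mem[/=].
  by rewrite !in_itv/=; exact: cf.
have [M [_ /(_ (M + 1))MP]] := compact_bounded (continuous_compact cfK cK).
exists (M + 1) => x y xab ycd; apply: MP; first by rewrite ltrDl.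
by exists (x, y) => //; split; rewrite /= in_itv.
Qed.

Lemma continuous_prim_param (f : R * R -> R) (b y : R) : continuous f ->
  {for y, continuous (fun y => prim (fun s => f (s, y)) b)}.
Proof.
move=> cf.
have main (u v : R) : {for y, continuous (fun y =>
    \int[mu]_(s in `[u, v]) f (s, y))}.
  have [M MP] := @bounded_rectangle f u v (y - 1) (y + 1) (fun x y _ _ => cf (x, y)).
  apply: (@dominated_cvg_filter _ _ (nbhs y) (fun y s => f (s, y))
    (fun s => f (s, y)) (fun=> M) `[u, v]).
  - exact: countable_base_nbhsR.
  - exact: measurable_itv.
  - near=> z; apply: measurable_funTS; apply: continuous_measurable_fun => s.
    by apply: continuous_sec1; exact: cf.
  - near=> z => s; rewrite /= in_itv/= => suv; apply: MP => //.
    have : `|y - z| <= 1 by near: z; apply: (@cvgr_dist_le _ _ _ _ _ id y cvg_id).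
    by rewrite ler_norml => /andP[? ?]; apply/andP; split; lra.
  - by apply: continuous_itg; apply: continuous_subspaceT; exact: cst_continuous.
  - apply: measurable_funTS; apply: continuous_measurable_fun => s.
    by apply: continuous_sec1; exact: cf.
  - by apply: aeW => s _; apply: continuous_sec2; exact: cf.
by apply: cvgB; exact: main.
Unshelve. all: by end_near. Qed.

Lemma is_derive_prim_param (f df : R * R -> R) (b y e : R) : 0 < e ->
  continuous f ->
  (forall s y', `|y' - y| < e -> is_derive y' 1 (fun t => f (s, t)) (df (s, y'))) ->
  (forall s y', `|y' - y| < e -> {for (s, y'), continuous df}) ->
  is_derive y 1 (fun y => prim (fun s => f (s, y)) b)
    (prim (fun s => df (s, y)) b).
Proof.
move=> e0 cf dff cdf.
have main (u v : R) : is_derive y 1 (fun y => \int[mu]_(s in `[u, v]) f (s, y))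
    (\int[mu]_(s in `[u, v]) df (s, y)).
  have e2 : 0 < e / 2 by rewrite divr_gt0.
  have [|M MP] := @bounded_rectangle df u v (y - e / 2) (y + e / 2).
    move=> x y' _ /andP[? ?]; apply: cdf; rewrite ltr_norml; apply/andP; split; lra.
  apply: (@is_derive_Rintegral _ (fun y s => f (s, y)) (fun y s => df (s, y))
    (fun=> M) `[u, v] y (e / 2)) => //.
  - move=> x _; apply: continuous_itg; apply: continuous_subspaceT => s.
    by apply: continuous_sec1; exact: cf.
  - by move=> x s xy _; apply: dff; apply: (lt_le_trans xy); lra.
  - move=> x s; rewrite ltr_norml /= in_itv/= => /andP[? ?] suv; apply: MP => //.
    by apply/andP; split; lra.
  - by apply: continuous_itg; apply: continuous_subspaceT; exact: cst_continuous.
by apply: is_deriveB; exact: main.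
Qed.

Lemma prim_derive (F f : R -> R) (b : R) : continuous f ->
  (forall x : R, is_derive x 1 F (f x)) -> prim f b = F b - F 0.
Proof.
move=> cf dF.
have dG (x : R) : is_derive x 1 (fun x => prim f x - F x) 0.
  rewrite -(subrr (f x)); apply: is_deriveB; exact: is_derive_prim.
have : prim f b - F b = prim f 0 - F 0.
  apply: (zero_derive_constant (fun x => prim f x - F x)).
  by apply: continuous_subspaceT => x; exact: is_derive_continuous (dG x).
by rewrite prim0 sub0r => /eqP; rewrite subr_eq addrC => /eqP.
Qed.

(* The circulation of the closed form [a dx + q dy] along coordinate
   rectangles vanishes, including those with a side on the axis, where the form
   is only continuous. *)
Lemma closed_form_circulation (a q c : R * R -> R) (P : R -> Prop) (b y : R) :
  continuous a -> continuous q ->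
  (forall y : R, P y -> \forall y' \near y, P y') ->
  (forall x y : R, P y -> is_derive y 1 (fun t => a (x, t)) (c (x, y))) ->
  (forall x y : R, P y -> is_derive x 1 (fun s => q (s, y)) (c (x, y))) ->
  (forall x y, P y -> {for (x, y), continuous c}) ->
  (forall t, Num.min 0 y < t < Num.max 0 y -> P t) ->
  prim (fun t => q (b, t)) y + prim (fun s => a (s, 0)) b =
  prim (fun s => a (s, y)) b + prim (fun t => q (0, t)) y.
Proof.
move=> ca cq oP day dqx cc Py.
(* [E 0 - E y] is the circulation around the rectangle with opposite corners [(0, 0)] and [(b, y)].
   Its derivative vanishes strictly between [0] and [y], because [c] differentiates both [a] and
   [q]; continuity covers the two ends. *)
pose E y := prim (fun s => a (s, y)) b -
  (prim (fun t => q (b, t)) y - prim (fun t => q (0, t)) y).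
have cq2 x : continuous (fun t => q (x, t)).
  by move=> t; apply: continuous_sec2; exact: cq.
suff : E 0 = E y.
  rewrite /E !prim0; lra.
apply: zero_derive_constant => [t /Py Pt|].
  have [e /= e0 eP] := (nbhs_ballP _ _).1 (oP t Pt).
  have eP' y' : `|y' - t| < e -> P y' by move=> ?; apply: eP; rewrite /ball/= distrC.
  have -> : 0 = prim (fun s => c (s, t)) b - (q (b, t) - q (0, t)).
    apply/esym/eqP; rewrite subr_eq0; apply/eqP.
    apply: (prim_derive (fun s => q (s, t))) => s.
      by apply: continuous_sec1; exact: cc.
    exact: dqx.
  apply: is_deriveB.
    apply: (is_derive_prim_param a c b t e) => //.
      by move=> s y' /eP'; exact: day.
    by move=> s y' /eP'; exact: cc.
  by apply: is_deriveB; exact: is_derive_prim.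
apply: continuous_subspaceT => t; apply: cvgB.
  exact: continuous_prim_param.
by apply: cvgB; apply: (is_derive_continuous _ _ _ (is_derive_prim _ _ (cq2 _))).
Qed.

End partial_derivatives.

Section partials_continuous.
Context {R : realType}.

Lemma partials_continuous (F F1 F2 : R * R -> R) (z : R * R) :
  (\forall w \near (z : R * R), is_derive (w : R * R).1 1 (fun x => F (x, w.2)) (F1 w)) ->
  (\forall w \near (z : R * R), is_derive (w : R * R).2 1 (fun y => F (w.1, y)) (F2 w)) ->
  {for z, continuous F1} -> {for z, continuous F2} -> {for z, continuous F}.
Proof.
move=> dF1 dF2 cF1 cF2.
have [d d0 dP] := @partial1_slope _ F F1 z 1 ltr01 dF1 cF1.
have [d' d'0 dP'] := @partial2_slope _ F F2 z 1 ltr01 dF2 cF2.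
apply/cvgrPdist_le => e e0.
(* The two moves cost at most [1 + |F1 z|] and [1 + |F2 z|] times their lengths; [K] is the sum of
   these factors. *)
pose K := `|F1 z| + `|F2 z| + 2.
have K0 : 0 < K by rewrite ltr_wpDl// addr_ge0.
pose r := Num.min (Num.min d d') (e / K).
have r0 : 0 < r by rewrite !lt_min d0 d'0 divr_gt0.
apply: filterS (nbhsx_ballx z r r0); case: z {dF1 dF2 cF1 cF2} @K @r K0 r0 dP dP'.
move=> x y K r K0 r0 dP dP' [x' y'] [].
rewrite /ball/= distrC [`|y - y'|]distrC => bx byy.
have xd : `|x' - x| < d by apply: (lt_le_trans bx); rewrite !ge_min lexx.
have yd : `|y' - y| < d by apply: (lt_le_trans byy); rewrite !ge_min lexx.
have yd' : `|y' - y| < d' by apply: (lt_le_trans byy); rewrite !ge_min lexx orbT.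
have xe : `|x' - x| <= e / K by apply/ltW/(lt_le_trans bx); rewrite !ge_min lexx orbT.
have ye : `|y' - y| <= e / K by apply/ltW/(lt_le_trans byy); rewrite !ge_min lexx orbT.
have S1 := dP x x' y'; rewrite /= subrr normr0 in S1.
have {}S1 := S1 d0 xd yd.
have S2 := dP' x y y'; rewrite /= !subrr normr0 in S2.
have {}S2 := S2 d'0 d'0 yd'.
have B1 : `|F (x', y') - F (x, y')| <= (1 + `|F1 (x, y)|) * `|x' - x|.
  rewrite -[X in `|X|](subrK (F1 (x, y) * (x' - x))) mulrDl -normrM.
  by apply: (le_trans (ler_normD _ _)); rewrite lerD2r.
have B2 : `|F (x, y') - F (x, y)| <= (1 + `|F2 (x, y)|) * `|y' - y|.
  rewrite -[X in `|X|](subrK (F2 (x, y) * (y' - y))) mulrDl -normrM.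
  by apply: (le_trans (ler_normD _ _)); rewrite lerD2r.
rewrite distrC -[X in `|X|](subrKA (F (x, y'))) (le_trans (ler_normD _ _))//.
apply: (le_trans (lerD B1 B2)).
apply: (@le_trans _ _ ((1 + `|F1 (x, y)|) * (e / K) + (1 + `|F2 (x, y)|) * (e / K))).
  by apply: lerD; rewrite ler_wpM2l// addr_ge0.
rewrite -mulrDl mulrC -[leRHS](divfK (lt0r_neq0 K0)).
rewrite ler_wpM2l//; first by rewrite divr_ge0// ltW.
by rewrite /K; lra.
Qed.

End partials_continuous.

(** * Mean value property on circles and Liouville's theorem *)

Section liouville.
Context {R : realType}.
Variables U1 U2 Phi Psi : R * R -> R.
Hypothesis cU1 : continuous U1.
Hypothesis cU2 : continuous U2.
Hypothesis Phi1 : forall x y : R, is_derive x 1 (fun s => Phi (s, y)) (U1 (x, y)).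
Hypothesis Phi2 : forall x y : R, is_derive y 1 (fun s => Phi (x, s)) (U2 (x, y)).
Hypothesis Psi1 : forall x y : R, is_derive x 1 (fun s => Psi (s, y)) (- U2 (x, y)).
Hypothesis Psi2 : forall x y : R, is_derive y 1 (fun s => Psi (x, s)) (U1 (x, y)).

(** [Phi + i Psi] is a holomorphic primitive of [U1 - i U2], and [k] is the real part of its product
    with [exp (- i t)]. With [A] and [M] the integrals of [k] and of [U1] over the angle, [A' = M]
    by differentiation in the radius and [A s = s * M s] by integration by parts in the angle; so
    [A s / s = M s] is constant for [s > 0], and by continuity equal to its value at the centre.
    [U1] and [U2] are never differentiated. *)
Lemma circle_mean_value (x0 y0 r : R) : 0 < r -> exists t,
  U1 (x0, y0) = U1 (x0 + r * cos t, y0 + r * sin t).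
Proof.
move=> r0; pose g1 (t s : R) := x0 + s * cos t; pose g2 (t s : R) := y0 + s * sin t.
pose u (w : R * R) := U1 (g1 w.1 w.2, g2 w.1 w.2).
pose k (w : R * R) := Phi (g1 w.1 w.2, g2 w.1 w.2) * cos w.1 +
  Psi (g1 w.1 w.2, g2 w.1 w.2) * sin w.1.
have cPhi z : {for z, continuous Phi}.
  apply: (partials_continuous Phi U1 U2).
  - by near=> w; case: (w) => ? ?; exact: Phi1.
  - by near=> w; case: (w) => ? ?; exact: Phi2.
  - exact: cU1.
  - exact: cU2.
have cPsi z : {for z, continuous Psi}.
  apply: (partials_continuous Psi (fun z => - U2 z) U1).
  - by near=> w; case: (w) => ? ?; exact: Psi1.
  - by near=> w; case: (w) => ? ?; exact: Psi2.
  - by apply: cvgN; exact: cU2.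
  - exact: cU1.
have cco : continuous (fun w : R * R => cos w.1).
  by move=> w; apply: continuous_comp; [exact: continuous_fst2|exact: continuous_cos].
have csi : continuous (fun w : R * R => sin w.1).
  by move=> w; apply: continuous_comp; [exact: continuous_fst2|exact: continuous_sin].
have cg : continuous (fun w : R * R => (g1 w.1 w.2, g2 w.1 w.2)).
  move=> w; apply: (@continuous_pair2 _ _ (fun w : R * R => g1 w.1 w.2)
    (fun w : R * R => g2 w.1 w.2)); apply: cvgD; try exact: cvg_cst.
    by apply: cvgM; [exact: continuous_snd2|exact: cco].
  by apply: cvgM; [exact: continuous_snd2|exact: csi].
have cu : continuous u.
  by move=> w; apply: continuous_comp; [exact: cg|exact: cU1].
have ck : continuous k.
  move=> w; apply: cvgD; apply: cvgM.
  - by apply: continuous_comp; [exact: cg|exact: cPhi].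
  - exact: cco.
  - by apply: continuous_comp; [exact: cg|exact: cPsi].
  - exact: csi.
have dg1s (t s : R) : is_derive s 1 (g1 t) (cos t).
  rewrite /g1; apply: is_derive_eq; rewrite /GRing.scale/=; ring.
have dg2s (t s : R) : is_derive s 1 (g2 t) (sin t).
  rewrite /g2; apply: is_derive_eq; rewrite /GRing.scale/=; ring.
have dg1t (t s : R) : is_derive t 1 (g1 ^~ s) (- s * sin t).
  rewrite /g1; apply: is_derive_eq; rewrite /GRing.scale/=; ring.
have dg2t (t s : R) : is_derive t 1 (g2 ^~ s) (s * cos t).
  rewrite /g2; apply: is_derive_eq; rewrite /GRing.scale/=; ring.
have chain (F F1 F2 : R * R -> R) (a b : R -> R) (t da db : R) :
  (forall x y : R, is_derive x 1 (fun s => F (s, y)) (F1 (x, y))) ->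
  (forall x y : R, is_derive y 1 (fun s => F (x, s)) (F2 (x, y))) ->
  continuous F1 -> continuous F2 -> is_derive t 1 a da -> is_derive t 1 b db ->
  is_derive t 1 (fun s => F (a s, b s)) (F1 (a t, b t) * da + F2 (a t, b t) * db).
  move=> h1 h2 c1 c2 ha hb; apply: (is_derive_chain2 F F1 F2) => //.
  - by near=> w; case: (w) => ? ?; exact: h1.
  - by near=> w; case: (w) => ? ?; exact: h2.
  - exact: c1.
  - exact: c2.
have cNU2 : continuous (fun z => - U2 z) by move=> z; apply: cvgN; exact: cU2.
have dk (t s : R) : is_derive s 1 (fun s => k (t, s)) (u (t, s)).
  have h1 := chain _ _ _ _ _ _ _ _ Phi1 Phi2 cU1 cU2 (dg1s t s) (dg2s t s).
  have h2 := chain _ _ _ _ _ _ _ _ Psi1 Psi2 cNU2 cU1 (dg1s t s) (dg2s t s).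
  rewrite /k /=; apply: is_derive_eq.
  rewrite /GRing.scale/= /u/=.
  have := cos2Dsin2 t; set U := U1 _; set V := U2 _ => E.
  rewrite -[RHS]mulr1 -E; ring.
pose twopi : R := 2 * pi.
pose A s := prim (fun t => k (t, s)) twopi.
pose M s := prim (fun t => u (t, s)) twopi.
have dA (s : R) : is_derive s 1 A (M s).
  apply: (is_derive_prim_param k u twopi s 1 ltr01 ck).
  by move=> t s' _; exact: cu.
have AM (s : R) : A s = s * M s.
  (* Integration by parts in the angle: over a full turn the terms in [Phi] and [Psi] return to
     their initial values and only [s * M s] remains. *)
  have dH (t : R) : is_derive t 1 (fun t => Phi (g1 t s, g2 t s) * sin t -
      Psi (g1 t s, g2 t s) * cos t + s * prim (fun t => u (t, s)) t) (k (t, s)).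
    have h1 := chain _ _ _ _ _ _ _ _ Phi1 Phi2 cU1 cU2 (dg1t t s) (dg2t t s).
    have h2 := chain _ _ _ _ _ _ _ _ Psi1 Psi2 cNU2 cU1 (dg1t t s) (dg2t t s).
    have h3 : is_derive (t : R) 1 (prim (fun t => u (t, s))) (u (t, s)).
      apply: (@is_derive_prim _ (fun t => u (t, s)) t) => t'.
      by apply: continuous_sec1; exact: cu.
    apply: is_derive_eq.
    rewrite /GRing.scale/= /u /k /=.
    have := cos2Dsin2 t; set U := U1 _; set V := U2 _ => E.
    have -> : s * U = s * U * (cos t ^+ 2 + sin t ^+ 2) by rewrite E mulr1.
    ring.
  rewrite /A (prim_derive _ _ _ _ dH); last first.
    by move=> t; apply: continuous_sec1; exact: ck.
  rewrite /M prim0 /g1 /g2 /twopi mulr_natl cos2pi sin2pi cos0 sin0.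
  ring.
have MC : M 0 = M r.
  apply: zero_derive_constant => [s|].
    rewrite min_l ?ltW// => /andP[s0 _].
    have hA := dA s.
    have : is_derive s 1 (fun s => s^-1 * A s) 0.
      have ? : is_derive s 1 (fun s : R => s^-1) (- s ^- 2).
        have := @is_derive_inv _ id s 1 (lt0r_neq0 s0) (is_derive_id _ _).
        by rewrite mulN1r.
      apply: is_derive_eq.
      rewrite /GRing.scale/= AM; field; exact: lt0r_neq0.
    apply: near_eq_is_derive; near=> s'; rewrite AM mulKf//.
    by rewrite gt_eqF//; near: s'; exact: (cvgr_gt s).
  by apply: continuous_subspaceT => s; exact: continuous_prim_param.
have pi2 : twopi != 0 by rewrite mulf_neq0// ?pnatr_eq0// gt_eqF// pi_gt0.
have cus (s : R) : continuous (fun t => u (t, s)).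
  by move=> t; apply: continuous_sec1; exact: cu.
have [c _ Mr] := @mvt_between _ (prim (fun t => u (t, r))) (fun t => u (t, r)) 0
  twopi (fun t _ => is_derive_prim _ t (cus r)).
have [c' _ M0] := @mvt_between _ (prim (fun t => u (t, 0))) (fun t => u (t, 0)) 0
  twopi (fun t _ => is_derive_prim _ t (cus 0)).
exists c; move: Mr M0; rewrite !prim0 !subr0 -/(M r) -/(M 0) MC => -> /(mulIf pi2).
by rewrite /u/= /g1 /g2 !mul0r !addr0 => <-.
Unshelve. all: by end_near. Qed.

Lemma liouville :
  (forall e, 0 < e -> exists M, forall z, M < `|z| -> `|U1 z| < e) ->
  forall z, U1 z = 0.
Proof.
move=> U10 [x y]; apply/eqP; rewrite -normr_le0; apply/ler_addgt0Pr => e e0.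
rewrite add0r; have [M MP] := U10 e e0.
(* The norm of the plane is the maximum norm. If a point of the circle had norm at most [M], both
   coordinates would differ from those of the centre by at most [N = r / 2], giving
   [r ^ 2 <= 2 N ^ 2], against [r = 2 N]. *)
pose r : R := 2 * (`|M| + `|x| + `|y| + 1).
have r0 : 0 < r.
  by rewrite mulr_gt0// ltr_wpDl// !addr_ge0.
have [t ->] := circle_mean_value x y r r0.
apply/ltW/MP; rewrite prod_normE/=.
set a := x + _; set b := y + _.
have Ea : r * cos t = a - x by rewrite /a addrC addKr.
have Eb : r * sin t = b - y by rewrite /b addrC addKr.
have H : r ^+ 2 = (a - x) ^+ 2 + (b - y) ^+ 2.
  by rewrite -Ea -Eb !exprMn -mulrDr cos2Dsin2 mulr1.
rewrite ltNge; apply/negP; rewrite ge_max => /andP[aM bM].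
have L (s u : R) : `|s| <= M -> `|s - u| <= `|M| + `|u|.
  move=> sM; apply: (le_trans (ler_normB _ _)); rewrite lerD2r.
  by apply: (le_trans sM); exact: ler_norm.
pose N := `|M| + `|x| + `|y| + 1.
have N0 : 0 < N by rewrite ltr_wpDl// !addr_ge0.
have La : `|a - x| <= N.
  apply: (le_trans (L _ x aM)); rewrite /N -addrA lerDl addr_ge0//.
have Lb : `|b - y| <= N.
  apply: (le_trans (L _ y bM)); rewrite /N.
  have := normr_ge0 x; lra.
have : r ^+ 2 <= N ^+ 2 + N ^+ 2.
  rewrite H; apply: lerD; rewrite -[leLHS]real_normK ?num_real//.
    by rewrite ler_sqr ?nnegrE// ltW.
  by rewrite ler_sqr ?nnegrE// ltW.
rewrite /r -/N; have := mulr_gt0 N0 N0; nra.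
Qed.
End liouville.

(** * Pointwise consequences of Sobolev regularity *)

Section smooth_step.
Context {R : realType}.

(** A smooth function [F 0] is carried along with all its derivatives, which makes it a test
    function without computing iterated derivatives. *)
Definition derivative_tower (F : nat -> R -> R) :=
  forall n (x : R), is_derive x 1 (F n) (F n.+1 x).

Lemma derivative_tower_derive1n (F : nat -> R -> R) (n : nat) :
  derivative_tower F -> derive1n n (F 0%N) = F n.
Proof.
move=> dF; elim: n => [|n IH]; first by rewrite derive1n0.
rewrite derive1nS IH; apply/funext => x; rewrite derive1E.
by have ? := dF n x; rewrite derive_val.
Qed.

(** The derivatives of [exp (- 1 / x)] extended by [0], up to linear combinations: the family is
    stable under derivation. *)
Definition flat (n : nat) (x : R) : R :=
  if 0 < x then x^-1 ^+ n * expR (- x^-1) else 0.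

Lemma flat_ge0 n x : 0 <= flat n x.
Proof.
by rewrite /flat; case: ifPn => // x0; rewrite mulr_ge0 ?expR_ge0// exprn_ge0// invr_ge0 ltW.
Qed.

(** One term of the exponential series, of order [n + 2], absorbs [x ^ (- n)] and leaves a factor
    [x ^ 2]; the difference quotient at [0] then tends to [0]. *)
Lemma flat_le n x : 0 < x -> flat n x <= n.+2`!%:R * x ^+ 2.
Proof.
move=> x0; rewrite /flat x0.
have u0 : 0 < x^-1 by rewrite invr_gt0.
have := expR_ge1Dxn n.+1 (ltW u0); set u := x^-1 in u0 *.
have f0 : 0 < n.+2`!%:R :> R by rewrite ltr0n fact_gt0.
move=> H.
have : u ^+ n.+2 / n.+2`!%:R <= expR u by apply: le_trans H; rewrite lerDr.
rewrite ler_pdivrMr// => {}H.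
have -> : x = u^-1 by rewrite /u invrK.
rewrite expRN ler_pdivrMr ?expR_gt0//.
rewrite -(ler_pM2r (exprn_gt0 2 u0)) -exprD addn2.
rewrite (le_trans H)// exprVn -[leRHS]mulrA mulrAC mulrC.
by rewrite mulrA mulfK// lt0r_neq0// exprn_gt0.
Qed.

Lemma is_derive_flat n (x : R) :
  is_derive x 1 (flat n) (flat n.+2 x - n%:R * flat n.+1 x).
Proof.
have [x0|x0|x0] := ltgtP 0 x.
- have dV : is_derive x 1 (fun x : R => x^-1) (- x ^- 2).
    have := @is_derive_inv _ id x 1 (lt0r_neq0 x0) (is_derive_id _ _).
    by rewrite mulN1r.
  apply: (near_eq_is_derive (f := fun x : R => x^-1 ^+ n * expR (- x^-1))).
    near=> y; rewrite /flat ifT//; near: y; exact: (cvgr_gt x).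
  have dE : is_derive x 1 (fun x : R => expR (- x^-1)) (x ^- 2 * expR (- x^-1)).
    have d1 : is_derive x 1 (fun x : R => - x^-1) (x ^- 2).
      by rewrite -[x ^- 2]opprK; exact: is_deriveN.
    have := @is_derive1_comp _ expR (fun x : R => - x^-1) x _ _ (is_derive_expR _) d1.
    by rewrite mulrC.
  have dX := @is_deriveX _ _ (fun x : R => x^-1) n x 1 _ dV.
  have := is_deriveM dX dE; rewrite /flat x0 /GRing.scale/=.
  rewrite exprfctE => dM; apply: (is_derive_eq dM).
  by case: n {dX dM} => [|n]; rewrite /= -?exprVn ?exprS; ring.
- have -> : flat n.+2 x - n%:R * flat n.+1 x = 0.
    by rewrite /flat ltNge ltW//= mulr0 subr0.
  apply: (near_eq_is_derive (f := fun _ : R => 0 : R)).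
    near=> y; rewrite /flat ifF//; apply/negbTE; rewrite -leNgt ltW//.
    by near: y; exact: (cvgr_lt x).
- rewrite -x0 /flat ltxx mulr0 subr0; apply/is_derive1P.
  apply/cvgr0Pnorm_le => e e0.
  have f0 : 0 < n.+2`!%:R :> R by rewrite ltr0n fact_gt0.
  near=> h; rewrite add0r ltxx subr0 -/(flat n h).
  have [h0|h0] := ltP 0 h; last first.
    by rewrite /flat ltNge h0/= mulr0 normr0 ltW.
  rewrite ger0_norm; last by rewrite mulr_ge0 ?flat_ge0// invr_ge0 ltW.
  apply: (@le_trans _ _ (n.+2`!%:R * h)).
    rewrite mulrC ler_pdivrMr// -mulrA -expr2; exact: flat_le.
  rewrite mulrC -ler_pdivlMr//; apply: le_trans (ler_norm h) _.
  near: h; apply: dnbhs0_le; exact: divr_gt0.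
Unshelve. all: by end_near. Qed.

(** A triple [(c, n, m)] stands for [c] times [flat n x * flat m (1 - x)], which vanishes outside
    []0, 1[]. Derivation acts on the lists, so that all derivatives exist by iterating
    [flat_sum_deriv]. *)
Fixpoint flat_sum (l : seq (R * nat * nat)) (x : R) : R :=
  if l is (c, n, m) :: l' then
    c * (flat n x * flat m (1 - x)) + flat_sum l' x
  else 0.

Fixpoint flat_sum_deriv (l : seq (R * nat * nat)) : seq (R * nat * nat) :=
  if l is (c, n, m) :: l' then
    [:: (c, n.+2, m), (- (n%:R * c), n.+1, m), (- c, n, m.+2),
       (m%:R * c, n, m.+1) & flat_sum_deriv l']
  else [::].

Lemma is_derive_flat_sum (l : seq (R * nat * nat)) (x : R) :
  is_derive x 1 (flat_sum l) (flat_sum (flat_sum_deriv l) x).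
Proof.
elim: l => [|[[c n] m] l IH] /=; first exact: is_derive_cst.
have d1 := is_derive_flat n x.
have d2 : is_derive x 1 (fun x : R => flat m (1 - x))
    (- (flat m.+2 (1 - x) - m%:R * flat m.+1 (1 - x))).
  have d3 : is_derive x 1 (fun x : R => 1 - x) (-1).
    apply: is_derive_eq. ring.
  have := @is_derive1_comp _ (flat m) (fun x : R => 1 - x) x _ _ (is_derive_flat m _) d3.
  by rewrite mulrN1.
apply: is_derive_eq; rewrite /GRing.scale/=; ring.
Qed.

(** [T 2] is a bump of mass one in [[0, 1]], [T 1] the step that it integrates to and [T 0] the ramp
    above this step. Steps will test first weak derivatives, ramps second ones, and the bump
    approximates a Dirac mass in both cases. *)
Lemma smooth_step : exists T : nat -> R -> R,
  [/\ derivative_tower T,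
      (forall x, x <= 0 -> T 0%N x = 0) /\
        (forall x, 1 <= x -> T 0%N x = T 0%N 1 + (x - 1)),
      (forall x, 0 <= T 1%N x <= 1),
      (forall x, x <= 0 -> T 1%N x = 0) /\ (forall x, 1 <= x -> T 1%N x = 1) &
      (forall x, 0 <= T 2%N x) /\ (forall x, ~~ (0 < x < 1) -> T 2%N x = 0)].
Proof.
pose F n := flat_sum (iter n flat_sum_deriv [:: (1, 0%N, 0%N)]).
have dF n (x : R) : is_derive x 1 (F n) (F n.+1 x) by exact: is_derive_flat_sum.
have F0E x : F 0%N x = flat 0 x * flat 0 (1 - x) by rewrite /F/= mul1r addr0.
have F0 x : 0 <= F 0%N x by rewrite F0E mulr_ge0// flat_ge0.
have F0out x : ~~ (0 < x < 1) -> F 0%N x = 0.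
  rewrite negb_and -!leNgt F0E /flat => /orP[x0|x1].
    by rewrite ltNge x0 mul0r.
  by rewrite [0 < 1 - x]ltNge subr_le0 x1 mulr0.
have F0in x : 0 < x < 1 -> 0 < F 0%N x.
  move=> /andP[x0 x1]; rewrite F0E /flat x0 subr_gt0 x1 !expr0 !mul1r.
  by rewrite mulr_gt0 ?expR_gt0.
have cF0 : continuous (F 0%N) by move=> x; exact: (is_derive_continuous _ _ _ (dF 0%N x)).
pose G := prim (F 0%N).
have dG (x : R) : is_derive x 1 G (F 0%N x) by exact: is_derive_prim.
have cG : continuous G by move=> x; exact: (is_derive_continuous _ _ _ (dG x)).
have G_nd x y : x <= y -> G x <= G y.
  move=> xy; have [c _ E] := @mvt_between _ G (F 0%N) x y (fun t _ => dG t).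
  by rewrite -subr_ge0 E mulr_ge0// subr_ge0.
have Gcst x y : (forall c, Num.min x y <= c <= Num.max x y -> F 0%N c = 0) -> G x = G y.
  move=> H; have [c cxy E] := @mvt_between _ G (F 0%N) x y (fun t _ => dG t).
  by apply/esym/eqP; rewrite -subr_eq0 E H// mul0r.
have Gle0 x : x <= 0 -> G x = 0.
  move=> x0; rewrite -[RHS](prim0 (F 0%N)) -/G; apply: Gcst => c.
  by rewrite max_r// => /andP[_ c0]; apply: F0out; rewrite ltNge c0.
have Gge1 x : 1 <= x -> G x = G 1.
  move=> x1; apply: Gcst => c.
  by rewrite min_r// => /andP[c0 _]; apply: F0out; rewrite [c < 1]ltNge c0 andbF.
have G1 : 0 < G 1.
  have [|c] := @MVT _ G (F 0%N) 0 1 ltr01 (fun t _ => dG t).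
    exact: continuous_subspaceT.
  by rewrite in_itv/= => /F0in Fc; rewrite {2}/G prim0 !subr0 mulr1 => ->.
pose k := (G 1)^-1.
have k0 : 0 < k by rewrite invr_gt0.
have kG1 : k * G 1 = 1 by rewrite mulVf// gt_eqF.
pose H x := prim (fun x => k * G x) x.
have dkG (x : R) : is_derive x 1 (fun x => k * G x) (k * F 0%N x).
  exact: (is_deriveZ _ _).
have dH (x : R) : is_derive x 1 H (k * G x).
  apply: (@is_derive_prim _ (fun x => k * G x)) => t.
  exact: (is_derive_continuous _ _ _ (dkG t)).
exists (fun n => match n with 0%N => H | 1%N => fun x => k * G x
                 | n.+2 => fun x => k * F n x end); split.
- move=> [|[|n]] x //=.
  exact: (is_deriveZ _ _).
- split=> x xx.
    rewrite -[RHS](prim0 (fun x => k * G x)) -/(H 0).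
    have [c + E] := @mvt_between _ H (fun x => k * G x) x 0 (fun t _ => dH t).
    rewrite max_r// => /andP[_ c0].
    by apply/esym/eqP; rewrite -subr_eq0 E Gle0// mulr0 mul0r.
  have [c + E] := @mvt_between _ H (fun x => k * G x) 1 x (fun t _ => dH t).
  rewrite min_l// => /andP[c1 _].
  by apply/eqP; rewrite addrC -subr_eq E Gge1// kG1 mul1r.
- move=> x; apply/andP; split.
    rewrite mulr_ge0 ?(ltW k0)//; have [x0|x0] := leP x 0; first by rewrite Gle0.
    by rewrite -(Gle0 0)// G_nd// ltW.
  rewrite -[leRHS]kG1 ler_pM2l//; have [x1|x1] := leP x 1; first exact: G_nd.
  by rewrite Gge1// ltW.
- split=> x xx; first by rewrite Gle0// mulr0.
  by rewrite Gge1.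
- split=> x; first by rewrite mulr_ge0// ltW.
  by move=> xx; rewrite F0out// mulr0.
Qed.
End smooth_step.

(** * Pointwise bounds from weak derivatives *)

Section sobolev_embedding.
Context {R : realType}.
Notation mu := (@lebesgue_measure R).
Notation itg D f := (mu.-integrable D (EFin \o f)).

Lemma L2_itg_sqr (h : R -> R) : L2 h ->
  measurable_fun setT h /\ itg setT (fun x => h x ^+ 2).
Proof.
move=> h2; split; last exact: Lfun2_integrable_sqr.
by have := sub_Lfun_mfun h2; rewrite inE.
Qed.

Lemma itg_indic (p q k : R) : itg setT ((fun=> k) \_ `[p, q]) /\
  (p <= q -> \int[mu]_x ((fun=> k) \_ `[p, q]) x = k * (q - p)).
Proof.
split.
  apply/(itg_mkcond _ (fun=> k) (measurable_itv _)).
  by apply: continuous_itg; apply: continuous_subspaceT; exact: cst_continuous.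
move=> pq; rewrite -Rintegral_mkcond Rintegral_cst//.
rewrite /= lebesgue_measure_itv/= lte_fin; move: pq; rewrite le_eqVlt.
by move=> /predU1P[->|->]//=; rewrite ltxx subrr.
Qed.

(** Pointwise, [|g|] is at most half of [g ^ 2 / la + la], and [phi] confines the second term to
    [[p, q]]. The parameter [la] is left free, to be balanced later; this replaces the
    Cauchy-Schwarz inequality. *)
Lemma L2_pairing_bound (g phi : R -> R) (p q la : R) : L2 g ->
  measurable_fun setT phi -> (forall x, `|phi x| <= 1) ->
  (forall x, ~~ (p <= x <= q) -> phi x = 0) -> p <= q -> 0 < la ->
  `|\int[mu]_x (g x * phi x)| <= (\int[mu]_x (g x ^+ 2) / la + la * (q - p)) / 2.
Proof.
move=> /L2_itg_sqr[mg ig2] mphi phi1 phi0 pq la0.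
have [i1 /(_ pq) I1] := itg_indic p q la.
have i2 : itg setT (fun x => la^-1 * g x ^+ 2) by exact: itgZ.
have i3 := itgD _ _ _ measurableT i2 i1.
have i4 := itgZ _ 2^-1 _ measurableT i3.
apply: le_trans (norm_Rintegral_le _ _ _ measurableT _ _ i4) _.
- exact: measurable_funM.
- move=> x _; rewrite patchE mem_setE in_itv/=.
  have G : 0 <= la^-1 * g x ^+ 2 by rewrite mulr_ge0 ?sqr_ge0// invr_ge0 ltW.
  case: ifPn => [_|/phi0 ->]; last first.
    by rewrite mulr0 normr0 mulr_ge0// addr_ge0.
  rewrite normrM; apply: (@le_trans _ _ `|g x|).
    by rewrite ler_piMr.
  have : 0 <= la^-1 * (`|g x| - la) ^+ 2.
    by rewrite mulr_ge0 ?sqr_ge0// invr_ge0 ltW.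
  have -> : la^-1 * (`|g x| - la) ^+ 2 = la^-1 * g x ^+ 2 + la - 2 * `|g x|.
    by rewrite sqrrB real_normK ?num_real//; field; rewrite gt_eqF.
  lra.
- rewrite RintegralZl// RintegralD// RintegralZl// I1 mulrC [_^-1 * _]mulrC//.
Qed.

Lemma continuous_compact_support_itg (f : R -> R) (p q : R) : continuous f ->
  (forall x, ~~ (p <= x <= q) -> f x = 0) ->
  itg setT f /\ \int[mu]_x f x = \int[mu]_(x in `[p, q]) f x.
Proof.
move=> cf f0; have E : f = f \_ `[p, q].
  apply/funext => x; rewrite patchE mem_setE in_itv/=.
  by case: ifPn => // /f0.
split; last by rewrite [RHS]Rintegral_mkcond -E.
rewrite E; apply/(itg_mkcond _ _ (measurable_itv _)).
by apply: continuous_itg; exact: continuous_subspaceT.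
Qed.

Variable T : nat -> R -> R.
Hypothesis dT : derivative_tower T.
Hypothesis T0 : (forall x, x <= 0 -> T 0%N x = 0) /\
        (forall x, 1 <= x -> T 0%N x = T 0%N 1 + (x - 1)).
Hypothesis T1 : forall x, 0 <= T 1%N x <= 1.
Hypothesis T1b : (forall x, x <= 0 -> T 1%N x = 0) /\
        (forall x, 1 <= x -> T 1%N x = 1).
Hypothesis T2 : (forall x, 0 <= T 2%N x) /\
        (forall x, ~~ (0 < x < 1) -> T 2%N x = 0).

Let rescale (n : nat) (d a x : R) := T n (d^-1 * (x - a)).

Let is_derive_rescale n (d a x : R) :
  is_derive x 1 (rescale n d a) (d^-1 * rescale n.+1 d a x).
Proof.
have d1 : is_derive x 1 (fun x => d^-1 * (x - a)) (d^-1).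
  have h : is_derive x 1 (fun x => x - a) 1.
    by apply: is_derive_eq; rewrite subr0.
  have := @is_deriveZ _ _ _ (fun x => x - a) d^-1 x 1 _ h.
  by rewrite /GRing.scale/= mulr1.
have := @is_derive1_comp _ (T n) (fun x => d^-1 * (x - a)) x _ _ (dT n _) d1.
by rewrite mulrC.
Qed.

Let continuous_rescale n d a : continuous (rescale n d a).
Proof. by move=> x; exact: (is_derive_continuous _ _ _ (is_derive_rescale n d a x)). Qed.

(** An approximation, as [d] tends to [0], of the sum of the Dirac masses at the points [ca.2] with
    weights [ca.1]. *)
Let bump (d : R) (cs : seq (R * R)) (x : R) :=
  \sum_(ca <- cs) ca.1 * (d^-1 * rescale 2 d ca.2 x).

Let rescale2_out d a x : 0 < d -> ~~ (a <= x <= a + d) -> rescale 2 d a x = 0.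
Proof.
move=> d0 xa; apply: T2.2; apply: contra xa => /andP[H1 H2].
move: H1; rewrite pmulr_rgt0 ?invr_gt0// subr_gt0 => /ltW ->/=.
move: H2; rewrite mulrC ltr_pdivrMr// mul1r ltrBlDl => /ltW; exact.
Qed.

Let bump_cvg (h : R -> R) (cs : seq (R * R)) : continuous h ->
  (forall d, 0 < d -> itg setT (fun x => h x * bump d cs x)) /\
  \int[mu]_x (h x * bump d cs x) @[d --> 0^'+] --> \sum_(ca <- cs) ca.1 * h ca.2.
Proof.
move=> ch; elim: cs => [|[c a] cs [IH1 IH2]].
  have E d : (fun x => h x * bump d [::] x) = fun=> 0.
    by apply/funext => x; rewrite /bump big_nil mulr0.
  split=> [d d0|]; first by rewrite E; exact: integrable0.
  under eq_fun do rewrite E.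
  by rewrite big_nil Rintegral_cst// mul0r; exact: cvg_cst.
have E d : (fun x => h x * bump d ((c, a) :: cs) x) =
    fun x => c * (h x * (d^-1 * rescale 2 d a x)) + h x * bump d cs x.
  by apply/funext => x; rewrite /bump big_cons/=; ring.
have ck d : continuous (fun x => h x * (d^-1 * rescale 2 d a x)).
  move=> x; apply: cvgM; first exact: ch.
  by apply: cvgM; [exact: cvg_cst|exact: continuous_rescale].
have k0 d x : 0 < d -> ~~ (a <= x <= a + d) -> h x * (d^-1 * rescale 2 d a x) = 0.
  by move=> d0 xa; rewrite rescale2_out// !mulr0.
have ik d : 0 < d -> itg setT (fun x => h x * (d^-1 * rescale 2 d a x)).
  move=> d0; have [] := @continuous_compact_support_itg _ a (a + d) (ck d); last by [].
  by move=> x; exact: k0.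
split=> [d d0|].
  by rewrite E; apply: itgD => //; [apply: itgZ => //; exact: ik|exact: IH1].
rewrite big_cons/=.
have : c * \int[mu]_x (h x * (d^-1 * rescale 2 d a x)) +
     \int[mu]_x (h x * bump d cs x) @[d --> 0^'+] -->
     c * h a + \sum_(ca <- cs) ca.1 * h ca.2.
  apply: cvgD => //; apply: cvgM; first exact: cvg_cst.
  apply/cvgrPdist_le => e e0.
  have /cvgrPdist_le/(_ e e0)/nbhs_ballP[r /= r0 rP] := ch a.
  near=> d.
  have d0 : 0 < d by near: d; exact: nbhs_right_gt.
  have dr : d < r by near: d; exact: nbhs_right_lt.
  have ad : a <= a + d by rewrite lerDl ltW.
  have cr : continuous (fun x => d^-1 * rescale 2 d a x).
    by move=> x; apply: cvgM; [exact: cvg_cst|exact: continuous_rescale].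
  have ir : itg `[a, a + d] (fun x => d^-1 * rescale 2 d a x).
    by apply: continuous_itg; exact: continuous_subspaceT.
  have Ir : \int[mu]_(x in `[a, a + d]) (d^-1 * rescale 2 d a x) = 1.
    rewrite (_ : 1 = rescale 1 d a (a + d) - rescale 1 d a a); last first.
      rewrite /rescale subrr mulr0 addrAC subrr add0r mulVf ?gt_eqF//.
      by rewrite (T1b.1 0)// (T1b.2 1)// subr0.
    apply: ftc_derive => //.
    exact: continuous_subspaceT.
  have [_ ->] := @continuous_compact_support_itg _ a (a + d) (ck d) (fun x => k0 d x d0).
  rewrite -[h a]mulr1 -Ir -RintegralZl// -RintegralB//; last 2 first.
  - exact: itgZ.
  - by apply: continuous_itg; exact: continuous_subspaceT.
  rewrite -[leRHS]mulr1 -Ir -RintegralZl//.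
  apply: norm_Rintegral_le => //.
  - apply: measurable_funTS; apply: continuous_measurable_fun => x.
    apply: cvgB; last exact: ck.
    by apply: cvgM; [exact: cvg_cst|exact: cr].
  - move=> x; rewrite /= in_itv/= => /andP[ax xd].
    have K0 : 0 <= d^-1 * rescale 2 d a x.
      by rewrite mulr_ge0 ?invr_ge0 ?(ltW d0)//; exact: T2.1.
    rewrite -mulrBl normrM (ger0_norm K0) ler_wpM2r//.
    apply: rP; rewrite /ball/= ler0_norm ?subr_le0// opprB.
    by rewrite ltrBlDl (le_lt_trans xd)// ltrD2l.
  - exact: itgZ.
apply: cvg_trans; apply: near_eq_cvg; near=> d.
have d0 : 0 < d by near: d; exact: nbhs_right_gt.
rewrite E RintegralD//; last 2 first.
- by apply: itgZ => //; exact: ik.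
- exact: IH1.
by rewrite RintegralZl//; exact: ik.
Unshelve. all: by end_near. Qed.

(** If the bumps are the [k]-th derivative of a test function with values in [[-1, 1]], the weak
    derivative moves onto [g], whose pairing with this test function is bounded independently of its
    shape; as [d] tends to [0] the bumps become point values of [h]. *)
Let weak_pairing (k : nat) (h g : R -> R) (cs : seq (R * R)) (p q la : R) :
  continuous h -> L2 g -> weak_derivative k h g -> p <= q -> 0 < la ->
  (forall d, 0 < d -> exists F, [/\ derivative_tower F, F k = bump d cs,
     forall x, `|F 0%N x| <= 1 & forall x, ~~ (p <= x <= q + d) -> F 0%N x = 0]) ->
  `|\sum_(ca <- cs) ca.1 * h ca.2| <=
    (\int[mu]_x (g x ^+ 2) / la + la * (q - p)) / 2.
Proof.
move=> ch g2 hg pq la0 HF.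
have [_ cv] := bump_cvg h cs ch.
apply/ler_addgt0Pr => e e0.
have e2 : 0 < e / 2 by rewrite divr_gt0.
have /cvgrPdist_le/(_ _ e2) cv' := cv.
near (0 : R)^'+ => d.
have d0 : 0 < d by near: d; exact: nbhs_right_gt.
have dl : la * d <= e.
  rewrite mulrC -ler_pdivlMr//; near: d; apply: nbhs_right_le; exact: divr_gt0.
have [F [dF Fk F1 F0]] := HF d d0.
have tF : test_function (F 0%N).
  split=> [n x|].
    by rewrite derivative_tower_derive1n//; have [] := dF n x.
  exists (`|p| + `|q + d|) => x px; apply: F0; apply: contraTN px => /andP[xp xq].
  rewrite -leNgt; have := ler_norm (q + d); have := ler_norm (- p); rewrite normrN.
  have := normr_ge0 p; have := normr_ge0 (q + d).
  by case: (ger0P x) => ?; lra.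
have := hg _ tF; rewrite derivative_tower_derive1n// Fk => H.
have B : `|\int[mu]_x (h x * bump d cs x)| <=
    (\int[mu]_x (g x ^+ 2) / la + la * (q + d - p)) / 2.
  rewrite H normrM normrX normrN1 expr1n mul1r; apply: L2_pairing_bound => //.
    apply: continuous_measurable_fun => x.
    exact: (is_derive_continuous _ _ _ (dF 0%N x)).
  by rewrite (le_trans pq)// lerDl ltW.
rewrite -[X in `|X|](subrK (\int[mu]_x (h x * bump d cs x))).
apply: (le_trans (ler_normD _ _)).
have C : `|\sum_(ca <- cs) ca.1 * h ca.2 - \int[mu]_x (h x * bump d cs x)| <= e / 2.
  by near: d.
move: B C dl; set I := \int[mu]_x (g x ^+ 2) / la; lra.
Unshelve. all: by end_near. Qed.

(** The test function is a smoothed indicator of [[a, b]], a difference of two steps; its derivative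
    is a bump at [a] minus a bump at [b]. *)
Lemma weak_derivative1_estimate (h g : R -> R) (a b la : R) :
  continuous h -> L2 g -> weak_derivative 1 h g -> a <= b -> 0 < la ->
  `|h a - h b| <= (\int[mu]_x (g x ^+ 2) / la + la * (b - a)) / 2.
Proof.
move=> ch g2 hg ab la0.
have := @weak_pairing 1 h g [:: (1, a); (-1, b)] a b la ch g2 hg ab la0.
rewrite !big_cons big_nil/= mul1r mulN1r addr0; apply => d d0.
exists (fun n x => d^-1 ^+ n * (rescale n.+1 d a x - rescale n.+1 d b x)); split.
- move=> n x.
  have h1 := is_derive_rescale n.+1 d a x.
  have h2 := is_derive_rescale n.+1 d b x.
  have := @is_deriveZ _ _ _ _ (d^-1 ^+ n) x 1 _ (is_deriveB h1 h2).
  move=> H; apply: (is_derive_eq H).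
  by rewrite /GRing.scale/= exprS; ring.
- apply/funext => x; rewrite /bump !big_cons big_nil/= expr1; ring.
- move=> x; rewrite expr0 mul1r /rescale ler_norml.
  have /andP[? ?] := T1 (d^-1 * (x - a)); have /andP[? ?] := T1 (d^-1 * (x - b)).
  by apply/andP; split; lra.
- move=> x; rewrite negb_and -!ltNge expr0 mul1r /rescale => /orP[xa|xb].
    rewrite !T1b.1 ?subrr//.
      rewrite mulr_ge0_le0// ?invr_ge0 ?(ltW d0)// subr_le0 ltW//.
      exact: lt_le_trans ab.
    by rewrite mulr_ge0_le0// ?invr_ge0 ?(ltW d0)// subr_le0 ltW.
  rewrite !T1b.2 ?subrr// mulrC ler_pdivlMr// mul1r; lra.
Qed.

Let T0_slope x y : x <= y -> 0 <= T 0%N y - T 0%N x <= y - x.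
Proof.
move=> xy; have [c _ ->] := @mvt_between _ (T 0%N) (T 1%N) x y (fun t _ => dT 0%N t).
have /andP[c0 c1] := T1 c; have xy0 : 0 <= y - x by rewrite subr_ge0.
by rewrite mulr_ge0//= ler_piMl.
Qed.

(** [P a b] is a smoothed ramp rising from [0] to [1] between [a] and [b]; its second derivative, up
    to sign, is the functional [(f b - f a) / (b - a)]. The difference of two such ramps has compact
    support and stays in [[-1, 1]]. *)
Lemma weak_derivative2_estimate (f g : R -> R) (a b c d p q la : R) :
  continuous f -> L2 g -> weak_derivative 2 f g -> a < b -> c < d ->
  p <= a -> b <= q -> p <= c -> d <= q -> 0 < la ->
  `|(f b - f a) / (b - a) - (f d - f c) / (d - c)| <=
    (\int[mu]_x (g x ^+ 2) / la + la * (q - p)) / 2.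
Proof.
move=> cf g2 fg ab cd pa bq pc dq la0.
have pq : p <= q by lra.
have ba0 : 0 < b - a by rewrite subr_gt0.
have dc0 : 0 < d - c by rewrite subr_gt0.
have := @weak_pairing 2 f g [:: ((b - a)^-1, a); (- (b - a)^-1, b);
  (- (d - c)^-1, c); ((d - c)^-1, d)] p q la cf g2 fg pq la0.
rewrite !big_cons big_nil/= addr0 => H.
rewrite -normrN; set L := (X in `|X|); set L' := (X in `|X|) in H.
have -> : L = L' by rewrite /L /L'; field; rewrite !gt_eqF.
apply: H => e e0.
pose P a b x := e * (b - a)^-1 * (rescale 0 e a x - rescale 0 e b x).
exists (fun n x => e * e^-1 ^+ n * ((b - a)^-1 * (rescale n e a x - rescale n e b x)
  - (d - c)^-1 * (rescale n e c x - rescale n e d x))); split.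
- move=> n x.
  have h1 := is_derive_rescale n e a x.
  have h2 := is_derive_rescale n e b x.
  have h3 := is_derive_rescale n e c x.
  have h4 := is_derive_rescale n e d x.
  have k1 := @is_deriveZ _ _ _ _ (b - a)^-1 x 1 _ (is_deriveB h1 h2).
  have k2 := @is_deriveZ _ _ _ _ (d - c)^-1 x 1 _ (is_deriveB h3 h4).
  have := @is_deriveZ _ _ _ _ (e * e^-1 ^+ n) x 1 _ (is_deriveB k1 k2).
  move=> H'; apply: (is_derive_eq H').
  by rewrite /GRing.scale/= exprS; ring.
- apply/funext => x; rewrite /bump !big_cons big_nil/= expr2 mulrA mulfV ?gt_eqF//.
  ring.
- have P01 a' b' x : a' < b' -> 0 <= P a' b' x <= 1.
    move=> ab'; have ba' : 0 < b' - a' by rewrite subr_gt0.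
    have : e^-1 * (x - b') <= e^-1 * (x - a').
      by rewrite ler_pM2l ?invr_gt0// lerD2l lerN2 ltW.
    move=> /T0_slope/andP[S1 S2]; rewrite /P /rescale; apply/andP; split.
      by rewrite mulr_ge0// mulr_ge0 ?(ltW e0)// invr_ge0 ltW.
    apply: (@le_trans _ _ (e * (b' - a')^-1 * (e^-1 * (b' - a')))).
      rewrite ler_wpM2l// ?mulr_ge0 ?(ltW e0)// ?invr_ge0 ?(ltW ba')//.
      by apply: (le_trans S2); rewrite -mulrBr le_eqVlt; apply/orP; left; apply/eqP; ring.
    by rewrite mulrACA mulfV ?gt_eqF// mulVf ?gt_eqF// mulr1.
  move=> x; have /andP[? ?] := P01 a b x ab; have /andP[? ?] := P01 c d x cd.
  rewrite expr0 mulr1 mulrBr !mulrA -/(P a b x) -/(P c d x) ler_norml.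
  by apply/andP; split; lra.
- move=> x; rewrite negb_and -!ltNge expr0 mulr1 /rescale => /orP[xp|xq].
    have N y : p <= y -> T 0%N (e^-1 * (x - y)) = 0.
      move=> py; rewrite T0.1// mulr_ge0_le0// ?invr_ge0 ?(ltW e0)// subr_le0; lra.
    by rewrite !N ?subrr ?mulr0 ?subr0 ?mulr0//; lra.
  (* Beyond [q + e] all four functions are in their affine regime, where both ramps are equal to [1]
     and cancel. *)
  have N y : y <= q -> T 0%N (e^-1 * (x - y)) = T 0%N 1 + (e^-1 * (x - y) - 1).
    by move=> yq; rewrite T0.2// mulrC ler_pdivlMr// mul1r; lra.
  rewrite !N; try lra.
  field; rewrite !gt_eqF//.
Qed.

End sobolev_embedding.

(** * Hoelder continuity, boundedness and decay of Sobolev functions *)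

Section holder.
Context {R : realType}.
Notation mu := (@lebesgue_measure R).
Notation itg D f := (mu.-integrable D (EFin \o f)).

Definition half_holder (C : R) (h : R -> R) :=
  forall x y, `|h x - h y| <= C * Num.sqrt `|x - y|.

(** The choice [la = |x - y| ^ (- 1/2)] balances the two terms of the estimate; [N] is the squared
    L_2 norm of the weak derivative. *)
Lemma sobolev1_half_holder (h : R -> R) : sobolev 1 h ->
  exists2 C, 0 <= C & half_holder C h.
Proof.
move=> [ch h2 /(_ 1%N (leqnn _))[g g2 hg]].
have [T [dT T0 T1 T1b T2]] := @smooth_step R.
pose N := \int[mu]_x g x ^+ 2.
have N0 : 0 <= N by apply: Rintegral_ge0 => x _; exact: sqr_ge0.
exists ((N + 1) / 2) => [|x y]; first by rewrite divr_ge0// addr_ge0.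
wlog xy : x y / x < y.
  move=> H; have [xy|xy|->] := ltgtP x y; first exact: H.
    by rewrite distrC [`|x - y|]distrC; exact: H.
  by rewrite !subrr !normr0 sqrtr0 mulr0.
rewrite distrC [`|x - y|]distrC.
have yx0 : 0 < y - x by rewrite subr_gt0.
rewrite (gtr0_norm yx0); set s := Num.sqrt _.
have s0 : 0 < s by rewrite sqrtr_gt0.
have sE : s ^+ 2 = y - x by rewrite sqr_sqrtr// ltW.
have := weak_derivative1_estimate T dT T1 T1b T2 h g x y s^-1 ch g2 hg (ltW xy).
rewrite invr_gt0 distrC -/N invrK -sE => /(_ s0) H; apply: (le_trans H).
rewrite le_eqVlt; apply/orP; left; apply/eqP; field; exact: lt0r_neq0.
Qed.

Lemma half_holder_continuous (C : R) (h : R -> R) : half_holder C h -> continuous h.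
Proof.
move=> hC x; apply/cvgrPdist_le => e e0.
have cv : C * Num.sqrt `|x - y| @[y --> x] --> (0 : R).
  rewrite -[X in _ --> X](mulr0 C) -(@sqrtr0 R) -(@normr0 _ R) -(subrr x).
  apply: cvgM; first exact: cvg_cst.
  apply: continuous_comp; last exact: sqrt_continuous.
  apply: continuous_comp; last exact: norm_continuous.
  by apply: cvgB; [exact: cvg_cst|exact: cvg_id].
move/cvgrPdist_le: cv => /(_ e e0); apply: filterS => y.
rewrite sub0r normrN => H; apply: (le_trans (hC x y)); apply: le_trans H.
exact: ler_norm.
Qed.

(** Over the unit interval to the right of [x] the oscillation is at most [C], so [h x ^ 2] is
    bounded by [2 h y ^ 2 + 2 C ^ 2]; averaging over [y] leaves the L_2 norm. *)
Lemma half_holder_L2_bounded (C : R) (h : R -> R) : half_holder C h ->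
  itg setT (fun x => h x ^+ 2) -> exists B, forall x, `|h x| <= B.
Proof.
move=> hC ih; pose N := \int[mu]_x h x ^+ 2.
have ch := half_holder_continuous _ _ hC.
exists (1 + 2 * N + 2 * C ^+ 2) => x.
have i1 : itg `[x, x + 1] (fun y => h y ^+ 2) by apply: itgS ih.
have N1 : \int[mu]_(y in `[x, x + 1]) h y ^+ 2 <= N.
  rewrite /N Rintegral_mkcond; apply: le_Rintegral => //.
    exact/(itg_mkcond _ _ (measurable_itv _)).
  by move=> y _; rewrite patchE; case: ifPn => // _; exact: sqr_ge0.
have cst_i (k : R) : itg `[x, x + 1] (fun=> k).
  by apply: continuous_itg; apply: continuous_subspaceT; exact: cst_continuous.
have cst_I (k : R) : \int[mu]_(y in `[x, x + 1]) k = k.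
  by rewrite Rintegral_cst//= lebesgue_measure_itv/= lte_fin ltrDl ltr01/= addrAC subrr
      add0r mulr1.
have : h x ^+ 2 <= 2 * N + 2 * C ^+ 2.
  rewrite -(cst_I (h x ^+ 2)).
  apply: (@le_trans _ _ (\int[mu]_(y in `[x, x + 1]) (2 * h y ^+ 2 + 2 * C ^+ 2))).
    apply: le_Rintegral => //; first by apply: itgD => //; exact: itgZ.
    move=> y; rewrite /= in_itv/= => /andP[xy yx1].
    have H : (h x - h y) ^+ 2 <= C ^+ 2.
      rewrite -[X in X <= _]real_normK ?num_real//.
      have := hC x y; set s := Num.sqrt _ => H.
      have s1 : s <= 1.
        rewrite -(@sqrtr1 R) ler_wsqrtr// distrC ger0_norm; lra.
      have s0 : 0 <= s by exact: sqrtr_ge0.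
      apply: (@le_trans _ _ ((C * s) ^+ 2)).
        by rewrite ler_sqr ?nnegrE// (le_trans _ H).
      rewrite exprMn ler_piMr ?sqr_ge0//; nra.
    have := sqr_ge0 (h x - 2 * h y); nra.
  by rewrite RintegralD//; [rewrite RintegralZl// cst_I lerD2r ler_pM2l|exact: itgZ].
have := sqr_ge0 (`|h x| - 1); rewrite sqrrB real_normK ?num_real//.
have := normr_ge0 (h x); nra.
Qed.

(** A value [|h x| >= e] forces [|h| >= e / 2] on a window of fixed length [r] starting at [x],
    while the integral of [h ^ 2] over a window that escapes to infinity tends to [0]. *)
Lemma half_holder_L2_vanishing (C : R) (h : R -> R) : 0 <= C -> half_holder C h ->
  itg setT (fun x => h x ^+ 2) ->
  forall e, 0 < e -> exists M, forall x, M < `|x| -> `|h x| < e.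
Proof.
move=> C0 hC ih e e0.
have ch := half_holder_continuous _ _ hC.
(* The window length for which [C * sqrt r <= e / 2]; the [C + 1] in the denominator covers
   [C = 0]. *)
pose r : R := (e / (2 * (C + 1))) ^+ 2.
have K0 : 0 < 2 * (C + 1) by rewrite mulr_gt0// ltr_wpDl.
have r0 : 0 < r by rewrite exprn_gt0// divr_gt0.
have Cr : C * Num.sqrt r <= e / 2.
  rewrite sqrtr_sqr ger0_norm; last by rewrite divr_ge0// ltW.
  have -> : e / 2 = (C + 1) * (e / (2 * (C + 1))).
    by field; rewrite lt0r_neq0// ltr_wpDl.
  by rewrite ler_wpM2r ?lerDl// divr_ge0// ltW.
pose G : set_system R := [set A | exists M, forall x, M < `|x| -> A x].
have FG : Filter G.
  split; first by exists 0.
    move=> A B [M MA] [N NB]; exists (Num.max M N) => x.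
    by rewrite gt_max => /andP[xM xN]; split; [exact: MA|exact: NB].
  by move=> A B AB [M MA]; exists M => x /MA/AB.
have cb : countable_base G by apply: (countable_base_pinfty _ (fun x => `|x|)).
pose F x u := ((fun y => h y ^+ 2) \_ `[x, x + r]) u.
have mF x : measurable_fun setT (F x).
  by apply/(measurable_restrictT _ (measurable_itv _)); apply: measurable_funTS;
      exact: measurable_itg ih.
have cv : \int[mu]_(u in setT) F x u @[x --> G] --> \int[mu]_(u in setT) (0 : R).
  apply: (dominated_cvg_filter _ _ F _ (fun y => h y ^+ 2)) => //.
  - exact: nearW.
  - apply: nearW => x u _; rewrite /F patchE; case: ifPn => _.
      by rewrite ger0_norm// sqr_ge0.
    by rewrite normr0 sqr_ge0.
  - apply: aeW => u _; apply: cvg_near_cst; exists (`|u| + r) => x ux.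
    rewrite /F patchE mem_setE in_itv/= ifF//; apply/negP => /andP[xu uxr].
    move: ux; rewrite ltNge => /negP; apply; rewrite ler_norml.
    have := ler_norm u; have := ler_norm (- u); rewrite normrN => ? ?.
    by apply/andP; split; lra.
rewrite Rintegral_cst// mul0r in cv.
have E0 : 0 < r * (e / 2) ^+ 2 by rewrite mulr_gt0// exprn_gt0// divr_gt0.
move/cvgrPdist_lt: cv => /(_ _ E0)[M MP].
exists M => x xM; rewrite ltNge; apply/negP => hx.
have := MP x xM; rewrite sub0r normrN ltNge => /negP; apply.
apply: le_trans (ler_norm _); rewrite /F -Rintegral_mkcond.
have -> : r * (e / 2) ^+ 2 = \int[mu]_(u in `[x, x + r]) ((e / 2) ^+ 2).
  rewrite Rintegral_cst//= lebesgue_measure_itv/= lte_fin ltrDl r0/= mulrC.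
  by congr (_ * _); rewrite addrAC subrr add0r.
apply: le_Rintegral => //.
- by apply: continuous_itg; apply: continuous_subspaceT; exact: cst_continuous.
- exact: itgS ih.
move=> y; rewrite /= in_itv/= => /andP[xy yxr].
rewrite -[leRHS]real_normK ?num_real// ler_sqr ?nnegrE//; last by rewrite divr_ge0// ltW.
have H : `|h x - h y| <= e / 2.
  apply: (le_trans (hC x y)); apply: le_trans Cr; rewrite ler_wpM2l// ler_wsqrtr//.
  by rewrite distrC ger0_norm; lra.
have := ler_normD (h x - h y) (h y); rewrite subrK; lra.
Qed.

(** The second-order estimate compares any two difference quotients at [x]: they form a Cauchy
    family as the step tends to [0], and the rate of convergence is the Taylor bound. *)
Lemma sobolev2_derivative (f : R -> R) : sobolev 2 f -> exists m C,
  [/\ 0 <= C, forall x : R, is_derive x 1 f (m x), half_holder C m,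
      forall x y, `|f x - f y - m x * (x - y)| <= C * `|x - y| * Num.sqrt `|x - y| &
      exists L, forall x, `|m x| <= L].
Proof.
move=> sf; have [cf f2 /(_ 2%N (leqnn _))[g g2 fg]] := sf.
have [T [dT T0 T1 T1b T2]] := @smooth_step R.
pose N := \int[mu]_x g x ^+ 2.
have N0 : 0 <= N by apply: Rintegral_ge0 => x _; exact: sqr_ge0.
pose q x s := s^-1 * (f (x + s) - f x).
have main x s t r : s != 0 -> t != 0 -> `|s| <= r -> `|t| <= r ->
    `|q x s - q x t| <= (N + 1) * Num.sqrt r.
  move=> s0 t0 sr tr.
  have r0 : 0 < r by apply: lt_le_trans sr; rewrite normr_gt0.
  have Q s' : s' != 0 -> `|s'| <= r -> exists a b, [/\ a < b, x - r <= a, b <= x + r &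
      q x s' = (f b - f a) / (b - a)].
    move=> s'0 /ler_normlP[s1 s2]; have [s'n|s'p|s'e] := ltgtP s' 0.
    - exists (x + s'), x; split; try lra.
      have -> : x - (x + s') = - s' by ring.
      by rewrite /q; field.
    - exists x, (x + s'); split; try lra.
      by rewrite /q addrAC subrr add0r mulrC.
    - by rewrite s'e eqxx in s'0.
  have [a [b [ab xa bx ->]]] := Q s s0 sr.
  have [c [d [cd xc dx ->]]] := Q t t0 tr.
  pose l := Num.sqrt r.
  have l0 : 0 < l by rewrite sqrtr_gt0.
  have lE : l ^+ 2 = r by rewrite sqr_sqrtr// ltW.
  (* Both quotients live in [[x - r, x + r]]; with [la = r ^ (- 1/2)] the bound is
     [(N / 2 + 1) * sqrt r]. *)
  have := weak_derivative2_estimate T dT T0 T1 T1b T2 f g a b c d (x - r) (x + r) l^-1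
    cf g2 fg ab cd xa bx xc dx.
  rewrite invr_gt0 -/N invrK => /(_ l0) H; apply: (le_trans H).
  have -> : x + r - (x - r) = 2 * l ^+ 2 by rewrite lE; ring.
  have -> : l^-1 * (2 * l ^+ 2) = 2 * l by field; exact: lt0r_neq0.
  rewrite -/l; nra.
have cq x : cvg (q x s @[s --> 0^']).
  apply: cauchy_cvg; apply: cauchy_exP => e e0.
  pose r := (e / (2 * (N + 1))) ^+ 2.
  have K0 : 0 < 2 * (N + 1) by rewrite mulr_gt0// ltr_wpDl.
  have r0 : 0 < r by rewrite exprn_gt0// divr_gt0.
  have Cr : (N + 1) * Num.sqrt r < e.
    rewrite sqrtr_sqr ger0_norm; last by rewrite divr_ge0// ltW.
    have -> : (N + 1) * (e / (2 * (N + 1))) = e / 2.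
      by field; rewrite lt0r_neq0// ltr_wpDl.
    lra.
  exists (q x r).
  suff : \forall s \near 0^', ball (q x r) e (q x s) by [].
  near=> s; rewrite /ball/=.
  apply: le_lt_trans Cr; apply: main.
  - exact: lt0r_neq0.
  - by near: s; exact: nbhs_dnbhs_neq.
  - by rewrite gtr0_norm.
  - by near: s; exact: dnbhs0_le.
pose m x := lim (q x s @[s --> 0^']).
have mq x s : s != 0 -> `|q x s - m x| <= (N + 1) * Num.sqrt `|s|.
  move=> s0; apply/ler_addgt0Pr => e e0.
  have /cvgrPdist_le/(_ e e0) H := cq x.
  near (0 : R)^' => t.
  have t0 : t != 0 by near: t; exact: nbhs_dnbhs_neq.
  have ts : `|t| <= `|s| by near: t; apply: dnbhs0_le; rewrite normr_gt0.
  have tm : `|m x - q x t| <= e by near: t.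
  have := main x s t `|s| s0 t0 (lexx _) ts.
  have := ler_normD (q x s - q x t) (q x t - m x).
  by rewrite addrA subrK [`|q x t - m x|]distrC; lra.
have dm (x : R) : is_derive x 1 f (m x) by apply/is_derive1P; exact: cq.
have NK : 0 <= N + 1 by rewrite addr_ge0.
have m_holder : half_holder (2 * (N + 1)) m.
  move=> x y; have [->|xy] := eqVneq x y.
    by rewrite !subrr normr0 sqrtr0 mulr0.
  have h1 : `|q x (y - x) - m x| <= (N + 1) * Num.sqrt `|x - y|.
    by rewrite [`|x - y|]distrC; apply: mq; rewrite subr_eq0 eq_sym.
  have h2 : `|q y (x - y) - m y| <= (N + 1) * Num.sqrt `|x - y|.
    by apply: mq; rewrite subr_eq0.
  (* The quotient over the segment between [x] and [y] is symmetric in its end points, hence close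
     to the slope at each of them. *)
  have qE : q y (x - y) = q x (y - x).
    rewrite /q (_ : x + (y - x) = y); last by ring.
    rewrite (_ : y + (x - y) = x); last by ring.
    by rewrite -(opprB y x) invrN mulNr -mulrN opprB.
  rewrite qE in h2.
  have := ler_normD (m x - q x (y - x)) (q x (y - x) - m y).
  by rewrite addrA subrK [`|m x - q x _|]distrC; lra.
exists m, (2 * (N + 1)); split => //.
- by rewrite mulr_ge0.
- move=> x y; have [->|xy] := eqVneq x y.
    by rewrite !subrr mulr0 subrr normr0 mulr0 mul0r.
  have yx : y - x != 0 by rewrite subr_eq0 eq_sym.
  have -> : f x - f y - m x * (x - y) = - (y - x) * (q x (y - x) - m x).
    rewrite /q (_ : x + (y - x) = y); [by field; exact: yx|ring].
  rewrite normrM normrN [`|y - x|]distrC [leRHS]mulrAC [leRHS]mulrC ler_wpM2l//.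
  have := mq x _ yx; rewrite [`|y - x|]distrC.
  have : 0 <= (N + 1) * Num.sqrt `|x - y| by rewrite mulr_ge0// sqrtr_ge0.
  lra.
(* The slope is within [N + 1] of the increment of [f] over a unit step, and [f] is bounded. *)
- have [_ if2] := L2_itg_sqr _ f2.
  have s1 : sobolev 1 f.
    by have [_ _ H] := sf; split => // n n1; apply: H; exact: leq_trans n1 _.
  have [Cf Cf0 hf] := sobolev1_half_holder _ s1.
  have [B fB] := half_holder_L2_bounded _ _ hf if2.
  exists (2 * B + (N + 1)) => x.
  have := mq x 1 (oner_neq0 _); rewrite normr1 sqrtr1 mulr1 /q invr1 mul1r.
  have := fB (x + 1); have := fB x; rewrite !ler_norml.
  by move=> /andP[? ?] /andP[? ?] /andP[? ?]; apply/andP; split; lra.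
Unshelve. all: by end_near. Qed.

End holder.

(** * Biot-Savart integrals over a graph *)

Section planar_kernels.
Context {R : realType}.

(** What the analysis uses of either component of the Biot-Savart kernel. The first bound is
    [|K z| <= 1 / |z|], written without root or quotient so that it holds at the origin; the
    Lipschitz bound in the second variable serves to replace the curve by its tangent, and oddness
    makes the tangent part drop out of principal values. *)
Record planar_kernel (K Ka Kb : R * R -> R) : Prop := PlanarKernel {
  planar_kernel_bound : forall a b, K (a, b) ^+ 2 * (a ^+ 2 + b ^+ 2) <= 1 ;
  planar_kernel_lip : forall a b b', a != 0 ->
    `|K (a, b) - K (a, b')| <= `|b - b'| / a ^+ 2 ;
  planar_kernel_continuous : forall a b, 0 < a ^+ 2 + b ^+ 2 ->
    [/\ {for (a, b), continuous K}, {for (a, b), continuous Ka} &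
        {for (a, b), continuous Kb}] ;
  planar_kernel_derive : forall a b : R, 0 < a ^+ 2 + b ^+ 2 ->
    is_derive a 1 (fun a => K (a, b)) (Ka (a, b)) /\
    is_derive b 1 (fun b => K (a, b)) (Kb (a, b)) ;
  planar_kernel_derive_bound : forall a b, 0 < a ^+ 2 + b ^+ 2 ->
    `|Ka (a, b)| <= (a ^+ 2 + b ^+ 2)^-1 /\ `|Kb (a, b)| <= (a ^+ 2 + b ^+ 2)^-1 ;
  planar_kernel_odd : forall a b, K (- a, - b) = - K (a, b) }.

(** In complex notation [1 / (a + i b) = kernel2 + i kernel1], and its derivative
    [- 1 / (a + i b) ^ 2] is [kernel_d + i kernel_e]. *)
Definition kernel1 (z : R * R) : R := - z.2 / (z.1 ^+ 2 + z.2 ^+ 2).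
Definition kernel2 (z : R * R) : R := z.1 / (z.1 ^+ 2 + z.2 ^+ 2).
Definition kernel_d (z : R * R) : R :=
  (z.2 ^+ 2 - z.1 ^+ 2) / (z.1 ^+ 2 + z.2 ^+ 2) ^+ 2.
Definition kernel_e (z : R * R) : R :=
  2 * z.1 * z.2 / (z.1 ^+ 2 + z.2 ^+ 2) ^+ 2.

Lemma continuous_sqr2 {T : topologicalType} (f : T -> R) (x : T) :
  {for x, continuous f} -> {for x, continuous (fun t => f t ^+ 2)}.
Proof. by move=> cf; exact: (cvgM cf cf). Qed.

Let r2_continuous : continuous (fun z : R * R => z.1 ^+ 2 + z.2 ^+ 2).
Proof.
move=> z; apply: cvgD.
  by apply: continuous_sqr2; exact: continuous_fst2.
by apply: continuous_sqr2; exact: continuous_snd2.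
Qed.

Let kernels_continuous a b : 0 < a ^+ 2 + b ^+ 2 ->
  [/\ {for (a, b), continuous kernel1}, {for (a, b), continuous kernel2},
      {for (a, b), continuous kernel_d} & {for (a, b), continuous kernel_e}].
Proof.
move=> ab0.
have V : {for (a, b), continuous (fun z : R * R => (z.1 ^+ 2 + z.2 ^+ 2)^-1)}.
  by apply: cvgV; [rewrite gt_eqF|exact: r2_continuous].
have V2 : {for (a, b), continuous (fun z : R * R => ((z.1 ^+ 2 + z.2 ^+ 2) ^+ 2)^-1)}.
  apply: cvgV; first by rewrite gt_eqF// exprn_gt0.
  exact: (continuous_sqr2 (fun z : R * R => z.1 ^+ 2 + z.2 ^+ 2) _ (r2_continuous _)).
have c1 := @continuous_fst2 R (a, b); have c2 := @continuous_snd2 R (a, b).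
split; apply: cvgM => //.
- exact: cvgN.
- apply: cvgB.
    by apply: continuous_sqr2; exact: c2.
  by apply: continuous_sqr2; exact: c1.
- apply: cvgM; last exact: c2.
  by apply: cvgM; [exact: cvg_cst|exact: c1].
Qed.

Let is_derive_sqrD (a b : R) :
  is_derive a 1 (fun a : R => a ^+ 2 + b ^+ 2) (2 * a).
Proof. apply: is_derive_eq; rewrite /GRing.scale/=; ring. Qed.

Let is_derive_Dsqr (a b : R) :
  is_derive b 1 (fun b : R => a ^+ 2 + b ^+ 2) (2 * b).
Proof. apply: is_derive_eq; rewrite /GRing.scale/=; ring. Qed.

Let sqrr2_bound a b : 0 < a ^+ 2 + b ^+ 2 ->
  `|kernel_d (a, b)| <= (a ^+ 2 + b ^+ 2)^-1 /\
  `|kernel_e (a, b)| <= (a ^+ 2 + b ^+ 2)^-1.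
Proof.
rewrite /kernel_d /kernel_e /=; set r := a ^+ 2 + b ^+ 2 => r0.
have r20 : 0 < r ^+ 2 by rewrite exprn_gt0.
have E : r^-1 = r / r ^+ 2 by rewrite expr2 invfM mulrA mulfV ?mul1r// gt_eqF.
rewrite E.
split; rewrite normrM normfV (gtr0_norm r20) ler_pM2r ?invr_gt0//.
  by rewrite /r; have := sqr_ge0 a; have := sqr_ge0 b; rewrite ler_norml => ? ?;
      apply/andP; split; lra.
have := sqr_ge0 (a - b); have := sqr_ge0 (a + b); rewrite /r ler_norml => ? ?.
by apply/andP; split; nra.
Qed.

Lemma planar_kernel1 : planar_kernel kernel1 kernel_e kernel_d.
Proof.
split.
- move=> a b; rewrite /kernel1/=; set r := a ^+ 2 + b ^+ 2.
  have r0 : 0 <= r by rewrite addr_ge0// sqr_ge0.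
  have [->|rn0] := eqVneq r 0; first by rewrite mulr0.
  have rp : 0 < r by rewrite lt_neqAle eq_sym rn0.
  have -> : (- b / r) ^+ 2 * r = b ^+ 2 / r by field.
  by rewrite ler_pdivrMr// mul1r /r lerDr sqr_ge0.
- move=> a b b' a0; rewrite /kernel1/=.
  have a2 : 0 < a ^+ 2 by rewrite exprn_even_gt0.
  have r1 : 0 < a ^+ 2 + b ^+ 2 by rewrite ltr_wpDr// sqr_ge0.
  have r2 : 0 < a ^+ 2 + b' ^+ 2 by rewrite ltr_wpDr// sqr_ge0.
  have -> : - b / (a ^+ 2 + b ^+ 2) - - b' / (a ^+ 2 + b' ^+ 2) =
    (b' - b) * ((a ^+ 2 - b * b') / ((a ^+ 2 + b ^+ 2) * (a ^+ 2 + b' ^+ 2))).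
    by field; rewrite !gt_eqF.
  rewrite normrM distrC ler_wpM2l//.
  have p0 : 0 < (a ^+ 2 + b ^+ 2) * (a ^+ 2 + b' ^+ 2) by rewrite mulr_gt0.
  rewrite normrM normfV (gtr0_norm p0) ler_pdivrMr// [a ^- 2 * _]mulrC ler_pdivlMr//.
  rewrite -[X in _ * X <= _](gtr0_norm a2) -normrM.
  have := sqr_ge0 (b - b'); have := sqr_ge0 (b + b').
  have := sqr_ge0 (b * b'); have := sqr_ge0 (a ^+ 2); rewrite ler_norml.
  move=> ? ? ? ?; apply/andP; split; nra.
- by move=> a b /kernels_continuous[].
- move=> a b r0; rewrite /kernel1 /kernel_e /kernel_d/=; split.
    have := @is_derive_inv _ _ a _ (lt0r_neq0 r0) (is_derive_sqrD a b) => H.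
    have := @is_deriveZ _ _ _ _ (- b) a 1 _ H => H'; apply: (is_derive_eq H').
    by rewrite /GRing.scale/=; field; rewrite gt_eqF.
  have := @is_derive_inv _ _ b _ (lt0r_neq0 r0) (is_derive_Dsqr a b) => H.
  have := is_deriveM (is_deriveNid b 1) H => H'; apply: (is_derive_eq H').
  by rewrite /GRing.scale/=; field; rewrite gt_eqF.
- by move=> a b /sqrr2_bound[].
- by move=> a b; rewrite /kernel1/= !sqrrN mulNr.
Qed.

Lemma planar_kernel2 : planar_kernel kernel2 kernel_d (fun z => - kernel_e z).
Proof.
split.
- move=> a b; rewrite /kernel2/=; set r := a ^+ 2 + b ^+ 2.
  have r0 : 0 <= r by rewrite addr_ge0// sqr_ge0.
  have [->|rn0] := eqVneq r 0; first by rewrite mulr0.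
  have rp : 0 < r by rewrite lt_neqAle eq_sym rn0.
  have -> : (a / r) ^+ 2 * r = a ^+ 2 / r by field.
  by rewrite ler_pdivrMr// mul1r /r lerDl sqr_ge0.
- move=> a b b' a0; rewrite /kernel2/=.
  have a2 : 0 < a ^+ 2 by rewrite exprn_even_gt0.
  have r1 : 0 < a ^+ 2 + b ^+ 2 by rewrite ltr_wpDr// sqr_ge0.
  have r2 : 0 < a ^+ 2 + b' ^+ 2 by rewrite ltr_wpDr// sqr_ge0.
  have -> : a / (a ^+ 2 + b ^+ 2) - a / (a ^+ 2 + b' ^+ 2) =
    (b - b') * (- (a * (b + b')) / ((a ^+ 2 + b ^+ 2) * (a ^+ 2 + b' ^+ 2))).
    by field; rewrite !gt_eqF.
  rewrite normrM ler_wpM2l//.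
  have p0 : 0 < (a ^+ 2 + b ^+ 2) * (a ^+ 2 + b' ^+ 2) by rewrite mulr_gt0.
  rewrite normrM normfV (gtr0_norm p0) ler_pdivrMr// [a ^- 2 * _]mulrC ler_pdivlMr//.
  rewrite -[X in _ * X <= _](gtr0_norm a2) -normrM.
  have h1 : 0 <= (a + b) ^+ 2 * a ^+ 2 by rewrite mulr_ge0 ?sqr_ge0.
  have h2 : 0 <= (a - b) ^+ 2 * a ^+ 2 by rewrite mulr_ge0 ?sqr_ge0.
  have h3 : 0 <= (a + b') ^+ 2 * a ^+ 2 by rewrite mulr_ge0 ?sqr_ge0.
  have h4 : 0 <= (a - b') ^+ 2 * a ^+ 2 by rewrite mulr_ge0 ?sqr_ge0.
  have h5 := sqr_ge0 (b * b').
  rewrite ler_norml; apply/andP; split; nra.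
- move=> a b /kernels_continuous[? ? ? ?]; split => //; exact: cvgN.
- move=> a b r0; rewrite /kernel2 /kernel_e /kernel_d/=; split.
    have := @is_derive_inv _ _ a _ (lt0r_neq0 r0) (is_derive_sqrD a b) => H.
    have := is_deriveM (is_derive_id a 1) H => H'; apply: (is_derive_eq H').
    by rewrite /GRing.scale/=; field; rewrite gt_eqF.
  have := @is_derive_inv _ _ b _ (lt0r_neq0 r0) (is_derive_Dsqr a b) => H.
  have := @is_deriveZ _ _ _ _ a b 1 _ H => H'; apply: (is_derive_eq H').
  by rewrite /GRing.scale/=; field; rewrite gt_eqF.
- by move=> a b /sqrr2_bound[? ?]; rewrite normrN.
- by move=> a b; rewrite /kernel2/= !sqrrN mulNr.
Qed.

Lemma planar_kernel_le (K Ka Kb : R * R -> R) (a b : R) : planar_kernel K Ka Kb ->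
  a != 0 -> `|K (a, b)| <= `|a|^-1.
Proof.
move=> pk a0; have a0' : 0 < `|a| by rewrite normr_gt0.
rewrite -(ler_pM2r a0') mulVf ?gt_eqF//.
rewrite -ler_sqr ?nnegrE// ?mulr_ge0// expr1n exprMn !real_normK ?num_real//.
apply: le_trans (planar_kernel_bound _ _ _ pk a b).
by rewrite ler_wpM2l ?sqr_ge0// lerDl sqr_ge0.
Qed.

End planar_kernels.

(** * Layer integrals: splitting, continuity, principal values and decay *)

Section single_layer.
Context {R : realType}.
Notation mu := (@lebesgue_measure R).
Notation itg D f := (mu.-integrable D (EFin \o f)).

(* [m] is the slope of the curve [y = h x], which carries the density [w]. *)
Record vortex_sheet (h m w : R -> R) (C L W : R) : Prop := VortexSheet {
  sheet_C_ge0 : 0 <= C ;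
  sheet_derive : forall x : R, is_derive x 1 h (m x) ;
  sheet_slope_holder : half_holder C m ;
  sheet_slope_le : forall x, `|m x| <= L ;
  sheet_taylor : forall x y,
    `|h x - h y - m x * (x - y)| <= C * `|x - y| * Num.sqrt `|x - y| ;
  sheet_bounded : exists B, forall x, `|h x| <= B ;
  sheet_density_holder : half_holder C w ;
  sheet_density_sqr : itg setT (fun x => w x ^+ 2) ;
  sheet_density_le : forall x, `|w x| <= W ;
  sheet_density_vanish : forall e, 0 < e -> exists M, forall x, M < `|x| -> `|w x| < e }.

Variables (h m w : R -> R) (C L W : R).
Hypothesis sheet : vortex_sheet h m w C L W.
Let C0 : 0 <= C.
Proof. exact: (sheet_C_ge0 _ _ _ _ _ _ sheet). Qed.
Let dh : forall x : R, is_derive x 1 h (m x).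
Proof. exact: (sheet_derive _ _ _ _ _ _ sheet). Qed.
Let m_holder : half_holder C m.
Proof. exact: (sheet_slope_holder _ _ _ _ _ _ sheet). Qed.
Let m_le : forall x, `|m x| <= L.
Proof. exact: (sheet_slope_le _ _ _ _ _ _ sheet). Qed.
Let h_taylor : forall x y,
  `|h x - h y - m x * (x - y)| <= C * `|x - y| * Num.sqrt `|x - y|.
Proof. exact: (sheet_taylor _ _ _ _ _ _ sheet). Qed.
Let w_holder : half_holder C w.
Proof. exact: (sheet_density_holder _ _ _ _ _ _ sheet). Qed.
Let w_sqr : itg setT (fun x => w x ^+ 2).
Proof. exact: (sheet_density_sqr _ _ _ _ _ _ sheet). Qed.
Let w_le : forall x, `|w x| <= W.
Proof. exact: (sheet_density_le _ _ _ _ _ _ sheet). Qed.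
Let w_vanish : forall e, 0 < e -> exists M, forall x, M < `|x| -> `|w x| < e.
Proof. exact: (sheet_density_vanish _ _ _ _ _ _ sheet). Qed.
Variables K Ka Kb : R * R -> R.
Hypothesis pk : planar_kernel K Ka Kb.

Definition layer (x eta u : R) : R := K (u, eta + (h x - h (x - u))) * w (x - u).
Definition frozen (x eta u : R) : R := K (u, eta + m x * u) * w x.
Definition near_layer (x eta : R) : R :=
  \int[mu]_(u in `[-1, 1]) (layer x eta u - frozen x eta u).
Definition far_layer (x eta : R) : R := \int[mu]_(u in ~` `[-1, 1]) layer x eta u.

Let ch : continuous h.
Proof. by move=> x; exact: (is_derive_continuous _ _ _ (dh x)). Qed.
Let cm : continuous m. Proof. exact: half_holder_continuous m_holder. Qed.
Let cw : continuous w. Proof. exact: half_holder_continuous w_holder. Qed.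

Lemma continuous_kernel_comp {T : topologicalType} (a b c : T -> R) (t : T) :
  {for t, continuous a} -> {for t, continuous b} -> {for t, continuous c} ->
  0 < a t ^+ 2 + b t ^+ 2 ->
  {for t, continuous (fun s => K (a s, b s) * c s)}.
Proof.
move=> ca cb cc ab0; apply: cvgM; last exact: cc.
apply: (@continuous_comp _ _ _ (fun s => (a s, b s))).
  exact: continuous_pair2.
by have [] := planar_kernel_continuous _ _ _ pk _ _ ab0.
Qed.

Let sqr_gt0_l (a b : R) : a != 0 -> 0 < a ^+ 2 + b ^+ 2.
Proof. by move=> a0; rewrite ltr_wpDr ?sqr_ge0// exprn_even_gt0. Qed.

Lemma continuous_comp1 {T : topologicalType} (g : R -> R) (f : T -> R) (t : T) :
  continuous g -> {for t, continuous f} -> {for t, continuous (fun s => g (f s))}.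
Proof. by move=> cg cf; apply: (@continuous_comp _ _ _ f g); [exact: cf|exact: cg]. Qed.

Lemma continuous_layer_u (x eta u : R) : u != 0 ->
  {for u, continuous (layer x eta)}.
Proof.
move=> u0.
have cs : {for u, continuous (fun u => x - u)}.
  by apply: cvgB; [exact: cvg_cst|exact: cvg_id].
apply: continuous_kernel_comp.
- exact: cvg_id.
- apply: cvgD; first exact: cvg_cst.
  apply: cvgB; first exact: cvg_cst.
  exact: (continuous_comp1 h (fun u => x - u) u ch cs).
- exact: (continuous_comp1 w (fun u => x - u) u cw cs).
- exact: sqr_gt0_l.
Qed.

Lemma continuous_frozen_u (x eta u : R) : u != 0 ->
  {for u, continuous (frozen x eta)}.
Proof.
move=> u0; apply: continuous_kernel_comp.
- exact: cvg_id.
- apply: cvgD; first exact: cvg_cst.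
  by apply: cvgM; [exact: cvg_cst|exact: cvg_id].
- exact: cvg_cst.
- exact: sqr_gt0_l.
Qed.

Lemma continuous_layer_z (u : R) (z : R * R) : u != 0 ->
  {for z, continuous (fun z => layer z.1 z.2 u)}.
Proof.
move=> u0.
have cs : {for z, continuous (fun z : R * R => z.1 - u)}.
  by apply: cvgB; [exact: continuous_fst2|exact: cvg_cst].
apply: (@continuous_kernel_comp _ (fun=> u)
  (fun z => z.2 + (h z.1 - h (z.1 - u))) (fun z => w (z.1 - u))).
- exact: cvg_cst.
- apply: cvgD; first exact: continuous_snd2.
  apply: cvgB.
    exact: (continuous_comp1 h fst z ch (continuous_fst2 z)).
  exact: (continuous_comp1 h _ z ch cs).
- exact: (continuous_comp1 w _ z cw cs).
- exact: sqr_gt0_l.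
Qed.

Lemma continuous_frozen_z (u : R) (z : R * R) : u != 0 ->
  {for z, continuous (fun z => frozen z.1 z.2 u)}.
Proof.
move=> u0; apply: (@continuous_kernel_comp _ (fun=> u)
  (fun z => z.2 + m z.1 * u) (fun z => w z.1)).
- exact: cvg_cst.
- apply: cvgD; first exact: continuous_snd2.
  apply: cvgM; last exact: cvg_cst.
  exact: (continuous_comp1 m fst z cm (continuous_fst2 z)).
- exact: (continuous_comp1 w fst z cw (continuous_fst2 z)).
- exact: sqr_gt0_l.
Qed.

Lemma measurable_layer (x eta : R) : measurable_fun setT (layer x eta).
Proof. by apply: measurable_off0 => u u0; exact: continuous_layer_u. Qed.

Lemma measurable_frozen (x eta : R) : measurable_fun setT (frozen x eta).
Proof. by apply: measurable_off0 => u u0; exact: continuous_frozen_u. Qed.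

Lemma layer_le (x eta u : R) : u != 0 -> `|layer x eta u| <= `|w (x - u)| / `|u|.
Proof.
move=> u0; rewrite /layer normrM mulrC ler_wpM2l//.
exact: (planar_kernel_le _ _ _ _ _ pk u0).
Qed.

Lemma frozen_le (x eta u : R) : u != 0 -> `|frozen x eta u| <= `|w x| / `|u|.
Proof.
move=> u0; rewrite /frozen normrM mulrC ler_wpM2l//.
exact: (planar_kernel_le _ _ _ _ _ pk u0).
Qed.

(* Replacing the curve by its tangent at [x] and the density by its value at
   [x] costs only an integrable singularity, uniformly in [eta]. *)
Lemma layer_sub_frozen_le (x eta u : R) :
  `|layer x eta u - frozen x eta u| <= (C + C * W) * (Num.sqrt `|u|)^-1.
Proof.
have W0 : 0 <= W by apply: le_trans (w_le x).
have CW : 0 <= C + C * W by rewrite addr_ge0// mulr_ge0.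
have [->|u0] := eqVneq u 0.
  by rewrite /layer /frozen subr0 subrr mulr0 subrr normr0 mulr_ge0// invr_ge0 sqrtr_ge0.
set s := Num.sqrt `|u|.
have u0' : 0 < `|u| by rewrite normr_gt0.
have s0 : 0 < s by rewrite sqrtr_gt0.
have sE : s ^+ 2 = `|u| by rewrite sqr_sqrtr.
have -> : layer x eta u - frozen x eta u =
    K (u, eta + (h x - h (x - u))) * (w (x - u) - w x) +
    (K (u, eta + (h x - h (x - u))) - K (u, eta + m x * u)) * w x.
  by rewrite /layer /frozen; ring.
apply: (le_trans (ler_normD _ _)); rewrite [leRHS]mulrDl; apply: lerD.
  rewrite normrM; apply: (@le_trans _ _ (`|u|^-1 * (C * s))).
    apply: ler_pM => //; first exact: (planar_kernel_le _ _ _ _ _ pk u0).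
    by have := w_holder (x - u) x; rewrite addrAC subrr add0r normrN.
  rewrite -sE le_eqVlt; apply/orP; left; apply/eqP; field; exact: lt0r_neq0.
rewrite normrM; apply: (@le_trans _ _ (C * `|u| * s / u ^+ 2 * W)).
  apply: ler_pM => //; apply: (le_trans (planar_kernel_lip _ _ _ pk _ _ _ u0)).
  rewrite ler_wpM2r ?invr_ge0 ?sqr_ge0//.
  have := h_taylor x (x - u); rewrite (_ : x - (x - u) = u); last by ring.
  rewrite -/s.
  by congr (`|_| <= _); ring.
have -> : u ^+ 2 = `|u| ^+ 2 by rewrite real_normK ?num_real.
rewrite -sE le_eqVlt; apply/orP; left; apply/eqP; field; exact: lt0r_neq0.
Qed.

Lemma itg_near_layer (x eta : R) :
  itg `[-1, 1] (fun u => layer x eta u - frozen x eta u).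
Proof.
apply: (dominated_itg `[-1, 1] _ _ (measurable_itv _) _
  (fun u _ => layer_sub_frozen_le x eta u)).
  by apply: measurable_funTS; apply: measurable_funB;
    [exact: measurable_layer|exact: measurable_frozen].
by apply: itgZ => //; exact: itg_invsqrt.
Qed.

Let far_neq0 (u : R) : (~` `[-1, 1]) u -> 1 < `|u|.
Proof.
move=> /= H; rewrite ltNge; apply/negP; rewrite ler_norml => H'; apply: H.
by rewrite in_itv.
Qed.

(** Young's inequality applied to [|w (x - u)| / |u|], because [w] is only square integrable;
    [1 <= u ^ 2] turns [u ^ (- 2) / 2] into [1 / (1 + u ^ 2)]. *)
Lemma layer_far_le (x eta u : R) : (~` `[-1, 1]) u ->
  `|layer x eta u| <= (1 + u ^+ 2)^-1 + w (x - u) ^+ 2 / 2.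
Proof.
move=> /far_neq0 u1.
have u0 : u != 0 by rewrite -normr_gt0 (lt_trans ltr01).
apply: (le_trans (layer_le x eta _ u0)).
have u2 : 1 <= u ^+ 2.
  by rewrite -[u ^+ 2]real_normK ?num_real// exprn_ege1// ltW.
have H : (u ^+ 2)^-1 / 2 <= (1 + u ^+ 2)^-1.
  rewrite -invfM lef_pV2 ?posrE; lra.
apply: (@le_trans _ _ ((u ^+ 2)^-1 / 2 + w (x - u) ^+ 2 / 2)); last by rewrite lerD2r.
have -> : (u ^+ 2)^-1 = `|u|^-1 ^+ 2 by rewrite exprVn real_normK ?num_real.
have := sqr_ge0 (`|u|^-1 - `|w (x - u)|).
by rewrite sqrrB [`|w _| ^+ 2]real_normK ?num_real//; lra.
Qed.

Lemma itg_sqr_subl (x : R) : itg setT (fun u => w (x - u) ^+ 2).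
Proof. by have [] := @integral_subl _ x (fun u => w u ^+ 2) w_sqr. Qed.

Let itg_far_bound (x : R) : itg setT (fun u : R => (1 + u ^+ 2)^-1 + w (x - u) ^+ 2 / 2).
Proof.
apply: itgD => //; first exact: itg_oneDsqrV.
under eq_fun do rewrite mulrC.
by apply: itgZ => //; exact: itg_sqr_subl.
Qed.

Let mfar : measurable (~` `[-1, 1] : set R).
Proof. by apply: measurableC; exact: measurable_itv. Qed.

Lemma itg_far_layer (x eta : R) : itg (~` `[-1, 1]) (layer x eta).
Proof.
apply: (dominated_itg (~` `[-1, 1]) _ _ mfar _ (layer_far_le x eta)).
  by apply: measurable_funTS; exact: measurable_layer.
by apply: itgS (itg_far_bound x).
Qed.

(** The dominating function does not depend on the height, so that continuity includes the points
    [eta = 0] of the curve. *)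
Lemma continuous_near_layer : continuous (fun z : R * R => near_layer z.1 z.2).
Proof.
move=> z.
apply: (dominated_cvg_filter _ (nbhs z)
  (fun z u => layer z.1 z.2 u - frozen z.1 z.2 u)
  (fun u => layer z.1 z.2 u - frozen z.1 z.2 u)
  (fun u => (C + C * W) * (Num.sqrt `|u|)^-1) `[-1, 1]).
- exact: countable_base_nbhs.
- exact: measurable_itv.
- by apply: nearW => y; exact: measurable_itg (itg_near_layer _ _).
- by apply: nearW => y u _; exact: layer_sub_frozen_le.
- by apply: itgZ => //; exact: itg_invsqrt.
- exact: measurable_itg (itg_near_layer _ _).
- exists [set 0]; split; [exact: measurable_set1|exact: lebesgue_measure_set1|].
  move=> u /= H; apply: contrapT => /eqP u0; apply: H => _.
  by apply: cvgB; [exact: continuous_layer_z|exact: continuous_frozen_z].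
Qed.

(** In the variable [u] the bound [w (x - u) ^ 2] moves with [x]; in the position [s = x - u] it
    becomes the fixed function [w s ^ 2]. *)
Lemma far_layer_subl (x eta : R) : far_layer x eta =
  \int[mu]_s (((layer x eta) \_ (~` `[-1, 1])) (x - s)).
Proof.
have [_ ->] := integral_subl x _ ((itg_mkcond _ _ mfar).1 (itg_far_layer x eta)).
by rewrite /far_layer Rintegral_mkcond.
Qed.

Lemma continuous_far_layer : continuous (fun z : R * R => far_layer z.1 z.2).
Proof.
move=> z.
pose F (z : R * R) s := ((layer z.1 z.2) \_ (~` `[-1, 1])) (z.1 - s).
have mF y : measurable_fun setT (F y).
  have [H _] := integral_subl y.1 _ ((itg_mkcond _ _ mfar).1 (itg_far_layer y.1 y.2)).
  exact: measurable_itg H.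
(* Chosen so that [1 + s ^ 2 <= c * (1 + (y.1 - s) ^ 2)] whenever [|y.1 - z.1| <= 1]. *)
pose c := 2 + 2 * (`|z.1| + 1) ^+ 2.
suff : \int[mu]_s F y s @[y --> z] --> \int[mu]_s F z s.
  under eq_fun do rewrite -far_layer_subl.
  by rewrite /F -far_layer_subl.
apply: (dominated_cvg_filter _ (nbhs z) F (F z)
  (fun s => c * (1 + s ^+ 2)^-1 + 2^-1 * w s ^+ 2)).
- exact: countable_base_nbhs.
- by [].
- exact: nearW.
- have /cvgrPdist_le/(_ 1 ltr01) := continuous_fst2 z; apply: filterS => y yz s _.
  have P0 : 0 <= c * (1 + s ^+ 2)^-1 + 2^-1 * w s ^+ 2.
    by rewrite addr_ge0// mulr_ge0// ?sqr_ge0// ?invr_ge0 ?addr_ge0 ?sqr_ge0// mulr_ge0//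
        sqr_ge0.
  rewrite /F patchE; case: ifPn => [/set_mem H|_]; last by rewrite normr0.
  apply: (le_trans (layer_far_le _ _ _ H)).
  rewrite opprB addrC [y.1 + _]addrC subrK addrC [w s ^+ 2 / 2]mulrC lerD2r.
  have p1 : 0 < 1 + s ^+ 2 by rewrite ltr_pwDl// sqr_ge0.
  have p2 : 0 < 1 + (y.1 - s) ^+ 2 by rewrite ltr_pwDl// sqr_ge0.
  rewrite -[leLHS]mul1r ler_pdivrMr// mulrAC ler_pdivlMr// mul1r.
  have y1 : y.1 ^+ 2 <= (`|z.1| + 1) ^+ 2.
    rewrite -[leLHS]real_normK ?num_real// ler_sqr ?nnegrE ?addr_ge0//.
    have := ler_normD z.1 (y.1 - z.1); rewrite addrC subrK.
    by rewrite [`|y.1 - _|]distrC; lra.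
  have := sqr_ge0 (s - 2 * y.1); have := sqr_ge0 (y.1 - s).
  have := sqr_ge0 (`|z.1| + 1).
  rewrite /c; nra.
- apply: itgD => //; apply: itgZ => //; exact: itg_oneDsqrV.
- exact: mF.
(* The cut-off at distance [1] jumps at these two positions only, a null set. *)
- exists [set z.1 - 1; z.1 + 1]; split.
  + by apply: measurableU; exact: measurable_set1.
  + by apply: null_set_setU; try exact: measurable_set1; exact: lebesgue_measure_set1.
  move=> s /= H; apply: contrapT => /not_orP[/eqP s1 /eqP s2]; apply: H => _.
  have cs : {for z, continuous (fun y : R * R => `|y.1 - s|)}.
    apply: continuous_comp; last exact: norm_continuous.
    by apply: cvgB; [exact: continuous_fst2|exact: cvg_cst].
  have [s3|s3] := ltP `|z.1 - s| 1.
    apply: cvg_near_cst.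
    have : \forall y \near z, `|y.1 - s| < 1 by apply: (cvgr_lt _ cs).
    have N (y : R * R) : `|y.1 - s| < 1 -> F y s = 0.
      move=> ys; rewrite /F patchE ifF//; apply/negP => /set_mem/far_neq0.
      by rewrite ltNge ltW.
    by apply: filterS => y ys; rewrite !N.
  have s4 : 1 < `|z.1 - s|.
    rewrite lt_neqAle s3 andbT eq_sym; apply/eqP => E.
    by case: (ler0P (z.1 - s)) E => _ E; [move/eqP: s2|move/eqP: s1]; apply; lra.
  have N (y : R * R) : 1 < `|y.1 - s| -> F y s = layer y.1 y.2 (y.1 - s).
    move=> ys; rewrite /F patchE ifT//; apply/mem_set => /=.
    by rewrite in_itv/= => H; move: ys; rewrite ltNge => /negP; apply; rewrite ler_norml.
  rewrite N//.
  have H : {for z, continuous (fun y : R * R => layer y.1 y.2 (y.1 - s))}.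
    have c1 : {for z, continuous (fun y : R * R => y.1 - s)}.
      by apply: cvgB; [exact: continuous_fst2|exact: cvg_cst].
    have c2 : {for z, continuous (fun y : R * R => y.1 - (y.1 - s))}.
      by apply: cvgB; [exact: continuous_fst2|exact: c1].
    apply: (@continuous_kernel_comp _ (fun y => y.1 - s)
      (fun y => y.2 + (h y.1 - h (y.1 - (y.1 - s))))
      (fun y => w (y.1 - (y.1 - s)))) => //.
    + apply: cvgD; first exact: continuous_snd2.
      apply: cvgB; first exact: (continuous_comp1 h fst z ch (continuous_fst2 z)).
      exact: (continuous_comp1 h _ z ch c2).
    + exact: (continuous_comp1 w _ z cw c2).
    + by apply: sqr_gt0_l; rewrite -normr_gt0 (lt_trans ltr01).
  have ns : \forall y \near z, 1 < `|y.1 - s| by apply: (cvgr_gt _ cs).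
  apply: cvg_trans H; apply: near_eq_cvg.
  by apply: filterS ns => y ys; rewrite N.
Qed.

Definition tangent_integral (k eta : R) : R :=
  \int[mu]_(u in `[-1, 1]) K (u, eta + k * u).

Let setUA : `[-1, 1]%classic `|` ~` `[-1, 1]%classic = [set: R].
Proof. exact: setUv. Qed.

Lemma Rintegral_split (f : R -> R) : itg setT f ->
  \int[mu]_u f u = \int[mu]_(u in `[-1, 1]) f u + \int[mu]_(u in ~` `[-1, 1]) f u.
Proof.
move=> i; rewrite -Rintegral_setU.
- by rewrite setUA.
- exact: measurable_itv.
- exact: mfar.
- by rewrite setUA.
- by apply/disj_setPS => u [].
Qed.

Lemma itg_split (f : R -> R) : itg `[-1, 1] f -> itg (~` `[-1, 1]) f -> itg setT f.
Proof.
move=> i1 i2; have j1 := (itg_mkcond _ _ (measurable_itv _)).1 i1.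
have j2 := (itg_mkcond _ _ mfar).1 i2.
apply: (eq_itg setT _ _ measurableT _ (itgD _ _ _ measurableT j1 j2)) => u _.
rewrite !patchE in_setC; case: ifP => _ /=; first by rewrite addr0.
by rewrite add0r.
Qed.

Lemma itg_frozen (x eta : R) : eta != 0 -> itg `[-1, 1] (frozen x eta).
Proof.
move=> eta0; apply: continuous_itg; apply: continuous_subspaceT => u.
have [->|u0] := eqVneq u 0; last exact: continuous_frozen_u.
apply: (@continuous_kernel_comp _ id (fun u => eta + m x * u) (fun=> w x) 0).
- exact: cvg_id.
- apply: cvgD; first exact: cvg_cst.
  by apply: cvgM; [exact: cvg_cst|exact: cvg_id].
- exact: cvg_cst.
- by rewrite mulr0 addr0 expr0n add0r exprn_even_gt0.
Qed.

Lemma layer_integral (x eta : R) : eta != 0 -> itg setT (layer x eta) /\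
  \int[mu]_u layer x eta u =
    near_layer x eta + far_layer x eta + tangent_integral (m x) eta * w x.
Proof.
move=> eta0; have i1 := itg_near_layer x eta; have i2 := itg_frozen x eta eta0.
have i3 : itg `[-1, 1] (layer x eta).
  apply: (eq_itg _ _ _ (measurable_itv _) _ (itgD _ _ _ (measurable_itv _) i1 i2)).
  by move=> u _; rewrite subrK.
have i4 := itg_split _ i3 (itg_far_layer x eta).
split=> //; rewrite Rintegral_split// -/(far_layer x eta) addrAC; congr (_ + _).
have -> : \int[mu]_(u in `[-1, 1]) layer x eta u =
    \int[mu]_(u in `[-1, 1]) ((layer x eta u - frozen x eta u) + frozen x eta u).
  by apply: eq_Rintegral => u _; rewrite subrK.
rewrite RintegralD//; congr (_ + _).
(* Integrability of the bare kernel is recovered from that of [frozen] on division by [w x]; for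
   [w x = 0] both sides vanish. *)
rewrite /tangent_integral; have [w0|w0] := eqVneq (w x) 0.
  rewrite w0 mulr0 /frozen w0.
  by under eq_Rintegral do rewrite mulr0; rewrite Rintegral_cst// mul0r.
rewrite -RintegralZr//.
have := itgZ _ (w x)^-1 _ (measurable_itv _) i2; apply: eq_itg => // u _.
by rewrite /frozen mulrC mulfK.
Qed.

Lemma measurable_PV_domain (d : R) : measurable (PV_domain d).
Proof.
rewrite (_ : PV_domain d = setT `&` (fun u : R => `|u|) @^-1` `]d, d^-1[%classic).
  by apply: normr_measurable => //; exact: measurable_itv.
by rewrite setTI; apply/seteqP; split => u /=; rewrite in_itv.
Qed.

Let regular (x u : R) : R := ((fun u => layer x 0 u - frozen x 0 u) \_ `[-1, 1]) u
  + ((layer x 0) \_ (~` `[-1, 1])) u.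

Let layer_regular (x u : R) : layer x 0 u = regular x u + ((frozen x 0) \_ `[-1, 1]) u.
Proof.
rewrite /regular !patchE in_setC; case: ifP => _ /=; first by rewrite addr0 subrK.
by rewrite add0r addr0.
Qed.

Let itg_regular (x : R) : itg setT (regular x) /\
  \int[mu]_u regular x u = near_layer x 0 + far_layer x 0.
Proof.
have j1 := (itg_mkcond _ _ (measurable_itv _)).1 (itg_near_layer x 0).
have j2 := (itg_mkcond _ _ mfar).1 (itg_far_layer x 0).
split; first exact: itgD.
by rewrite RintegralD// -!Rintegral_mkcond.
Qed.

Let frozen_odd (x u : R) : frozen x 0 (- u) = - frozen x 0 u.
Proof.
by rewrite /frozen !add0r mulrN (planar_kernel_odd _ _ _ pk) mulNr.
Qed.

Let itg_PV_frozen (x d : R) : 0 < d ->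
  itg (PV_domain d) ((frozen x 0) \_ `[-1, 1]) /\
  \int[mu]_(u in PV_domain d) ((frozen x 0) \_ `[-1, 1]) u = 0.
Proof.
move=> d0.
pose phi := ((frozen x 0) \_ `[-1, 1]) \_ (PV_domain d).
have mphi : measurable_fun setT phi.
  apply/(measurable_restrictT _ (measurable_PV_domain d)); apply: measurable_funTS.
  apply/(measurable_restrictT _ (measurable_itv _)); apply: measurable_funTS.
  exact: measurable_frozen.
have i1 : itg setT phi.
  apply: (dominated_itg _ _ ((fun=> `|w x| / d) \_ `[-1, 1])) => //; last first.
    by have [] := itg_indic (-1) 1 (`|w x| / d).
  move=> u _; rewrite /phi !patchE.
  have P : 0 <= `|w x| / d by rewrite divr_ge0// ltW.
  case: ifPn => [/set_mem/= /andP[du ud]|_]; last by rewrite normr0; case: ifP.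
  case: ifPn => _; last by rewrite normr0.
  apply: (le_trans (frozen_le _ _ _ _)).
    by rewrite -normr_gt0 (lt_trans d0).
  have u0 : 0 < `|u| by exact: lt_trans d0 du.
  by rewrite ler_wpM2l// lef_pV2 ?posrE// ltW.
split; first exact/(itg_mkcond _ _ (measurable_PV_domain d)).
rewrite Rintegral_mkcond -/phi.
have [_ E] := integral_subl 0 _ i1.
have odd u : phi (0 - u) = - phi u.
  rewrite /phi sub0r !patchE.
  have -> : (- u \in PV_domain d) = (u \in PV_domain d).
    by apply/idP/idP => /set_mem H; apply/mem_set; move: H; rewrite /PV_domain/= normrN.
  have -> : (- u \in `[-1, 1]%classic) = (u \in `[-1, 1]%classic).
    by rewrite !mem_setE !in_itv/= lerN2 lerNl andbC.
  rewrite frozen_odd; case: ifP => _; last by rewrite oppr0.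
  by case: ifP => _; rewrite ?oppr0.
move: E; under eq_Rintegral do rewrite odd -mulN1r.
by rewrite RintegralZl// mulN1r; set I := \int[mu]_x0 _; lra.
Qed.

Lemma PV_layer (x : R) :
  (forall d, 0 < d -> itg (PV_domain d) (layer x 0)) /\
  \int[mu]_(u in PV_domain d) layer x 0 u @[d --> 0^'+] -->
    near_layer x 0 + far_layer x 0.
Proof.
have [ir Ir] := itg_regular x.
have mP := measurable_PV_domain.
have irP d : itg (PV_domain d) (regular x) by apply: itgS ir.
split=> [d d0|].
  have [i2 _] := itg_PV_frozen x d d0.
  apply: (eq_itg _ _ _ (mP d) _ (itgD _ _ _ (mP d) (irP d) i2)) => u _.
  by rewrite -layer_regular.
rewrite -Ir.
have : \int[mu]_(u in setT) ((regular x) \_ (PV_domain d)) u @[d --> 0^'+] -->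
    \int[mu]_u regular x u.
  apply: (dominated_cvg_filter _ _ (fun d => (regular x) \_ (PV_domain d)) _
    (fun u => `|regular x u|)) => //.
  - exact: countable_base_within (countable_base_nbhsR _).
  - apply: nearW => d; apply/(measurable_restrictT _ (mP d)).
    exact: measurable_itg (irP d).
  - by apply: nearW => d u _; rewrite patchE; case: ifP => // _; rewrite normr0.
  - exact: itg_norm.
  - exact: measurable_itg ir.
  - exists [set 0]; split; [exact: measurable_set1|exact: lebesgue_measure_set1|].
    move=> u /= H; apply: contrapT => /eqP u0; apply: H => _.
    have u0' : 0 < `|u| by rewrite normr_gt0.
    apply: cvg_near_cst; near=> d.
    have d0 : 0 < d by near: d; exact: nbhs_right_gt.
    rewrite patchE ifT//; apply/mem_set; rewrite /PV_domain/=; apply/andP; split.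
      by near: d; exact: nbhs_right_lt.
    rewrite -[ltLHS]invrK ltf_pV2 ?posrE ?invr_gt0//.
    by near: d; apply: nbhs_right_lt; rewrite invr_gt0.
apply: cvg_trans; apply: near_eq_cvg; near=> d.
have d0 : 0 < d by near: d; exact: nbhs_right_gt.
have [i2 I2] := itg_PV_frozen x d d0.
under [RHS]eq_Rintegral do rewrite layer_regular.
rewrite RintegralD//; [by rewrite I2 addr0 [RHS]Rintegral_mkcond|exact: mP].
Unshelve. all: by end_near. Qed.

Definition at_infinity : set_system (R * R) :=
  [set A | exists M, forall z, M < `|z| -> A z].

Lemma at_infinity_filter : Filter at_infinity.
Proof.
split.
- by exists 0.
- move=> A B [M HA] [N HB]; exists (Num.max M N) => z.
  by rewrite gt_max => /andP[Mz Nz]; split; [exact: HA|exact: HB].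
- by move=> A B AB [M HA]; exists M => z /HA/AB.
Qed.
#[local] Existing Instance at_infinity_filter.

Lemma countable_base_at_infinity : countable_base at_infinity.
Proof. by apply: (countable_base_pinfty _ (fun z : R * R => `|z|)). Qed.

Lemma lt_norm2 (M : R) (z : R * R) : M < `|z| -> M < `|z.1| \/ M < `|z.2|.
Proof. by rewrite prod_normE/= lt_max => /orP. Qed.

Lemma planar_kernel_le_snd (a b : R) : `|K (a, b)| * `|b| <= 1.
Proof.
rewrite -normrM -(@expr_le1 _ 2)// real_normK ?num_real// exprMn.
apply: le_trans (planar_kernel_bound _ _ _ pk a b).
by rewrite ler_wpM2l ?sqr_ge0// lerDr sqr_ge0.
Qed.

(* Away from [u = 0], either the density or the kernel is small. *)
Let vanishing (b c : R * R -> R) (u A : R) : u != 0 ->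
  (forall z, `|c z| <= W) -> (forall z, `|z.2| <= `|b z| + A) ->
  (forall e, 0 < e -> exists M, forall z : R * R, M < `|z.1| -> `|c z| < e) ->
  K (u, b z) * c z @[z --> at_infinity] --> 0.
Proof.
move=> u0 cW bA cv; apply/cvgrPdist_le => e e0.
have u0' : 0 < `|u| by rewrite normr_gt0.
have [M HM] := cv (e * `|u|) (mulr_gt0 e0 u0').
exists (Num.max M (W / e + A)) => z /lt_norm2; rewrite !gt_max sub0r normrN.
rewrite normrM => -[/andP[/HM + _]|/andP[_ H]].
  move=> H; have := planar_kernel_le _ _ _ u (b z) pk u0.
  move=> ?.
  apply: (@le_trans _ _ (`|u|^-1 * (e * `|u|))).
    by apply: ler_pM => //; exact: ltW.
  by rewrite mulrC mulfK ?gt_eqF.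
have {}H : W / e < `|b z| by have := bA z; lra.
have b0 : 0 < `|b z| by apply: le_lt_trans H; rewrite divr_ge0 ?(ltW e0)// (le_trans _ (cW z)).
have := planar_kernel_le_snd u (b z).
rewrite -ler_pdivlMr// mul1r => k1.
apply: (@le_trans _ _ (`|b z|^-1 * W)); first exact: ler_pM.
rewrite mulrC ler_pdivrMr// mulrC; move: H; rewrite ltr_pdivrMr// => H; exact: ltW.
Qed.

Lemma layer_vanishing (u : R) : u != 0 ->
  layer z.1 z.2 u @[z --> at_infinity] --> 0.
Proof.
move=> u0; apply: (vanishing (fun z => z.2 + (h z.1 - h (z.1 - u)))
  (fun z => w (z.1 - u)) u (L * `|u|)) => // [z|e e0].
  have [c _ E] := mvt_between h m (z.1 - u) z.1 (fun x _ => dh x).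
  rewrite {}E (_ : z.1 - (z.1 - u) = u); last by ring.
  rewrite [in leLHS](_ : z.2 = z.2 + m c * u - m c * u); last by ring.
  apply: (le_trans (ler_normB _ _)); rewrite lerD2l.
  by rewrite normrM ler_wpM2r.
have [M HM] := w_vanish e e0; exists (M + `|u|) => z Hz; apply: HM.
have := ler_normD (z.1 - u) u; rewrite subrK; lra.
Qed.

Lemma frozen_vanishing (u : R) : u != 0 ->
  frozen z.1 z.2 u @[z --> at_infinity] --> 0.
Proof.
move=> u0; apply: (vanishing (fun z => z.2 + m z.1 * u)
  (fun z => w z.1) u (L * `|u|)) => // [z|e /w_vanish[M HM]]; last by exists M => z /HM.
rewrite [in leLHS](_ : z.2 = z.2 + m z.1 * u - m z.1 * u); last by ring.
apply: (le_trans (ler_normB _ _)); rewrite lerD2l.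
by rewrite normrM ler_wpM2r.
Qed.

Lemma near_layer_vanishing : near_layer z.1 z.2 @[z --> at_infinity] --> 0.
Proof.
have -> : 0 = \int[mu]_(u in `[-1, 1]) (cst 0 u : R).
  by rewrite Rintegral_cst//= mul0r.
apply: (dominated_cvg_filter _ at_infinity
  (fun z u => layer z.1 z.2 u - frozen z.1 z.2 u) (cst 0)
  (fun u => (C + C * W) * (Num.sqrt `|u|)^-1) `[-1, 1]).
- exact: countable_base_at_infinity.
- exact: measurable_itv.
- by apply: nearW => y; exact: measurable_itg (itg_near_layer _ _).
- by apply: nearW => y u _; exact: layer_sub_frozen_le.
- by apply: itgZ => //; exact: itg_invsqrt.
- exact: measurable_cst.
- exists [set 0]; split; [exact: measurable_set1|exact: lebesgue_measure_set1|].
  move=> u /= H; apply: contrapT => /eqP u0; apply: H => _.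
  have := cvgB (layer_vanishing u u0) (frozen_vanishing u u0).
  by rewrite subr0; apply.
Qed.

(* Where [`|layer|] exceeds [2 lam / (1 + u ^+ 2)] it is at most
   [w (x - u) ^+ 2 / lam], whose integral is small for large [lam]. *)
Lemma far_layer_vanishing : far_layer z.1 z.2 @[z --> at_infinity] --> 0.
Proof.
apply/cvgrPdist_le => e e0.
pose N := \int[mu]_u w u ^+ 2.
have N0 : 0 <= N by apply: Rintegral_ge0 => u _; exact: sqr_ge0.
(* Makes [N / lam <= e / 2]. *)
pose lam := 2 * N / e + 1.
have lam0 : 0 < lam by rewrite ltr_wpDl// divr_ge0 ?(ltW e0)// mulr_ge0.
pose g u := 2 * lam * (1 + u ^+ 2)^-1.
have g0 u : 0 <= g u by rewrite mulr_ge0 ?mulr_ge0 ?(ltW lam0)// invr_ge0 addr_ge0// sqr_ge0.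
(* Truncating at [g] gives a fixed dominating function; the excess over [g] is paid for by
   [w ^ 2 / lam]. *)
pose F (z : R * R) u := Num.min `|layer z.1 z.2 u| (g u).
have ig D : measurable D -> itg D g.
  by move=> mD; apply: (itgS setT D) => //; apply: itgZ => //; exact: itg_oneDsqrV.
have mF z : measurable_fun (~` `[-1, 1] : set R) (F z).
  apply: measurable_minr; last exact: measurable_itg (ig _ mfar).
  exact: measurable_itg (itg_norm _ _ mfar (itg_far_layer _ _)).
have F_le z u : `|F z u| <= g u.
  by rewrite /F ger0_norm ?le_min ?normr_ge0//= ge_min lexx orbT.
have F0 : \int[mu]_(u in ~` `[-1, 1]) F z u @[z --> at_infinity] --> 0.
  have -> : 0 = \int[mu]_(u in ~` `[-1, 1]) (cst 0 u : R).
    by rewrite /Rintegral integral0_eq.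
  apply: (dominated_cvg_filter _ at_infinity F (cst 0) g) => //.
  - exact: countable_base_at_infinity.
  - by apply: nearW => z; exact: mF.
  - by apply: nearW => z u _; exact: F_le.
  - exact: ig.
  - apply: aeW => u /far_neq0 u1.
    have u0 : u != 0 by rewrite -normr_gt0 (lt_trans ltr01).
    apply/cvgrPdist_le => d d0.
    have /cvgrPdist_le/(_ d d0) := layer_vanishing u u0.
    apply: filterS => z; rewrite /cst !sub0r !normrN; apply: le_trans.
    by rewrite /F ger0_norm ?le_min ?normr_ge0//= ge_min lexx.
have /cvgrPdist_le/(_ (e / 2)) := F0; rewrite divr_gt0// => /(_ isT).
apply: filterS => z; rewrite !sub0r !normrN => Hz.
have iF : itg (~` `[-1, 1]) (F z).
  by apply: (dominated_itg _ _ _ mfar (mF z) (fun u _ => F_le z u)); exact: ig.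
have iw : itg (~` `[-1, 1]) (fun u => lam^-1 * w (z.1 - u) ^+ 2).
  by apply: itgZ => //; apply: itgS (itg_sqr_subl z.1).
have H : `|far_layer z.1 z.2| <=
    \int[mu]_(u in ~` `[-1, 1]) (F z u + lam^-1 * w (z.1 - u) ^+ 2).
  apply: norm_Rintegral_le => //; last exact: itgD.
    exact: measurable_itg (itg_far_layer _ _).
  move=> u /[dup] uD /far_neq0 u1.
  have u0 : u != 0 by rewrite -normr_gt0 (lt_trans ltr01).
  have u0' : 0 < `|u| by rewrite normr_gt0.
  rewrite /F; case: (leP `|layer z.1 z.2 u| (g u)) => [_|gl].
    by rewrite lerDl mulr_ge0 ?sqr_ge0// invr_ge0 ltW.
  apply: ler_wpDl => //.
  rewrite mulrC ler_pdivlMr//.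
  have lw := layer_le z.1 z.2 u u0.
  have l0 : 0 <= `|layer z.1 z.2 u| by [].
  have u2 : 1 < u ^+ 2 by rewrite -[u ^+ 2]real_normK ?num_real// exprn_egt1.
  have gu : lam <= g u * u ^+ 2.
    by rewrite /g -mulrA [_^-1 * _]mulrC mulrA ler_pdivlMr; nra.
  move: lw; rewrite ler_pdivlMr// => lw.
  have : (`|layer z.1 z.2 u| * `|u|) ^+ 2 <= `|w (z.1 - u)| ^+ 2.
    by rewrite ler_sqr ?nnegrE ?mulr_ge0.
  rewrite exprMn ![`|_| ^+ 2 in X in _ * X]real_normK ?num_real//.
  rewrite [X in _ <= X]real_normK ?num_real//; apply: le_trans.
  rewrite expr2 -mulrA ler_wpM2l//; apply: (le_trans gu).
  by rewrite ler_wpM2r ?sqr_ge0// ltW.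
apply: (le_trans H); rewrite RintegralD// RintegralZl//; last first.
  by apply: itgS (itg_sqr_subl z.1).
have -> : e = e / 2 + e / 2 by field.
apply: lerD; first exact: le_trans (ler_norm _) Hz.
have [_ NE] := integral_subl z.1 (fun u => w u ^+ 2) w_sqr.
apply: (@le_trans _ _ (lam^-1 * N)).
  rewrite ler_wpM2l ?invr_ge0 ?(ltW lam0)//.
  rewrite /N -NE (Rintegral_split _ (itg_sqr_subl z.1)) lerDr.
  by apply: Rintegral_ge0 => u _; exact: sqr_ge0.
rewrite mulrC ler_pdivrMr// /lam.
rewrite (_ : e / 2 * _ = N + e / 2); first by rewrite lerDl ltW// divr_gt0.
by field; rewrite gt_eqF.
Qed.

(** Over [|u| <= 1] the tangent line varies by at most [L], so the second argument of the kernel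
    keeps modulus at least [|eta| - L], which bounds the kernel from above by its inverse. *)
Lemma tangent_integral_le (x eta : R) : L < `|eta| ->
  `|tangent_integral (m x) eta| <= 2 / (`|eta| - L).
Proof.
move=> Le; have eL : 0 < `|eta| - L by rewrite subr_gt0.
have L0 : 0 <= L by exact: le_trans (m_le x).
have e0 : eta != 0 by rewrite -normr_gt0; exact: le_lt_trans Le.
have b_ge u : -1 <= u <= 1 -> `|eta| - L <= `|eta + m x * u|.
  move=> /andP[u1 u2]; have u3 : `|u| <= 1 by rewrite ler_norml u1.
  have := ler_normB (eta + m x * u) (m x * u); rewrite addrK.
  have : `|m x * u| <= L * 1 by rewrite normrM ler_pM.
  lra.
have -> : 2 / (`|eta| - L) = \int[mu]_(u in `[-1, 1]) (`|eta| - L)^-1.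
  rewrite Rintegral_cst//= lebesgue_measure_itv/= lte_fin ifT; last by lra.
  by rewrite -EFinB/= mulrC; congr (_ * _); ring.
apply: norm_Rintegral_le.
- exact: measurable_itv.
- apply: (@measurable_itg _ `[-1, 1]).
  apply: (eq_itg _ (fun u => K (u, eta + m x * u) * 1)) => [|u _|].
  + exact: measurable_itv.
  + by rewrite mulr1.
  apply: continuous_itg; apply: continuous_subspaceT => u.
  apply: (@continuous_kernel_comp _ id (fun u => eta + m x * u) (fun=> 1) u).
  + exact: cvg_id.
  + apply: cvgD; first exact: cvg_cst.
    by apply: cvgM; [exact: cvg_cst|exact: cvg_id].
  + exact: cvg_cst.
  + have [->|u0] := eqVneq u 0; last exact: sqr_gt0_l.
    by rewrite mulr0 addr0 expr0n add0r exprn_even_gt0.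
- move=> u /=; rewrite in_itv/= => /b_ge b1.
  have b0 : 0 < `|eta + m x * u| by exact: lt_le_trans b1.
  have := planar_kernel_le_snd u (eta + m x * u).
  rewrite -ler_pdivlMr// mul1r => /le_trans; apply.
  by rewrite lef_pV2 ?posrE.
- by apply: continuous_itg; apply: continuous_subspaceT => u; exact: cvg_cst.
Qed.

Lemma is_derive_shift (g : R -> R) (x s d : R) : is_derive (x - s) 1 g d ->
  is_derive x 1 (fun x : R => g (x - s)) d.
Proof.
move=> /is_derive1P H; apply/is_derive1P; apply: cvg_trans H.
by apply: near_eq_cvg; apply: nearW => k; rewrite addrAC.
Qed.

Definition field (Q : R * R -> R) (z : R * R) : R :=
  \int[mu]_s (Q (z.1 - s, z.2 - h s) * w s).

Lemma field_layer (x y : R) : y - h x != 0 ->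
  itg setT (fun s => K (x - s, y - h s) * w s) /\
  field K (x, y) = \int[mu]_u layer x (y - h x) u.
Proof.
move=> /(layer_integral x)[i _]; have [i1 <-] := integral_subl x _ i.
have E s : layer x (y - h x) (x - s) = K (x - s, y - h s) * w s.
  have E : x - (x - s) = s by ring.
  by rewrite /layer E; congr (K (_, _) * _); ring.
split; first by apply: eq_itg i1 => // s _; exact: E.
by apply: eq_Rintegral => s _; rewrite E.
Qed.

(** Near a point off the curve the squared distance to the point of the curve over [s] dominates
    [1 + s ^ 2] uniformly. Kernel derivatives are therefore bounded by an integrable function of
    [s]. *)
Lemma curve_distance (x y : R) : y - h x != 0 -> exists A d, [/\ 0 < A, 0 < d &
  forall x' y' s, `|x' - x| < d -> `|y' - y| < d -> y' - h x' != 0 /\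
    1 + s ^+ 2 <= A * ((x' - s) ^+ 2 + (y' - h s) ^+ 2)].
Proof.
move=> eta0.
have L0 : 0 <= L by exact: le_trans (m_le x).
have hL a b : `|h a - h b| <= L * `|a - b|.
  by have [c _ ->] := mvt_between h m b a (fun x _ => dh x); rewrite normrM ler_wpM2r.
set e := `|y - h x| / 2; have e0 : 0 < e by rewrite divr_gt0// normr_gt0.
pose X := `|x| + 1.
(* [d] keeps the vertical distance to the curve above [e], half of the initial one; with slopes at
   most [L] this gives [e ^ 2 <= (1 + L ^ 2) * r] for the squared distance [r]. The first term of
   [A] absorbs [1 + 2 X ^ 2], and the final [2] comes from [s ^ 2 <= 2 x' ^ 2 + 2 r]. *)
exists ((1 + 2 * X ^+ 2) * (1 + L ^+ 2) / e ^+ 2 + 2), (Num.min 1 (e / (1 + L))).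
have A1 : 0 <= (1 + 2 * X ^+ 2) * (1 + L ^+ 2).
  by have := sqr_ge0 X; have := sqr_ge0 L; nra.
split.
- by rewrite ltr_wpDl// divr_ge0// sqr_ge0.
- by rewrite lt_min ltr01 divr_gt0// ltr_wpDr.
move=> x' y' s; rewrite !lt_min => /andP[x1 x2] /andP[_ y2].
have L1 : 0 < 1 + L by rewrite ltr_wpDr.
have e_le : e < `|y' - h x'|.
  have E : y - h x = (y' - h x') - (y' - y) + (h x' - h x) by ring.
  have := ler_normD (y' - h x' - (y' - y)) (h x' - h x); rewrite -E.
  have := ler_normB (y' - h x') (y' - y); have := hL x' x.
  have : L * `|x' - x| <= L * (e / (1 + L)) by rewrite ler_wpM2l// ltW.
  have : e / (1 + L) + L * (e / (1 + L)) = e by field; rewrite gt_eqF.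
  have : `|y - h x| = 2 * e by rewrite /e; field.
  lra.
split; first by rewrite -normr_gt0 (lt_trans e0).
set r := (x' - s) ^+ 2 + (y' - h s) ^+ 2.
have er : e ^+ 2 <= (1 + L ^+ 2) * r.
  have e1 : e <= `|y' - h s| + L * `|x' - s|.
    have := ler_normB (y' - h s) (h x' - h s); have := hL x' s.
    by rewrite (_ : _ - h s - _ = y' - h x'); [lra|ring].
  apply: (@le_trans _ _ ((`|y' - h s| + L * `|x' - s|) ^+ 2)).
    by rewrite ler_sqr ?nnegrE ?(ltW e0)// addr_ge0// mulr_ge0.
  rewrite /r -[(x' - s) ^+ 2]real_normK ?num_real// -[(y' - h s) ^+ 2]real_normK ?num_real//.
  by have := sqr_ge0 (L * `|y' - h s| - `|x' - s|); nra.
have r0 : 0 <= r by rewrite addr_ge0 ?sqr_ge0.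
have X2 : x' ^+ 2 <= X ^+ 2.
  rewrite -[leLHS]real_normK ?num_real// ler_sqr ?nnegrE ?addr_ge0//.
  have := ler_normD x (x' - x); rewrite addrC subrK /X; lra.
have e2 : 0 < e ^+ 2 by rewrite exprn_gt0.
rewrite mulrDl.
have H1 : 1 + 2 * X ^+ 2 <= (1 + 2 * X ^+ 2) * (1 + L ^+ 2) / e ^+ 2 * r.
  rewrite -!mulrA -[leLHS]mulr1 ler_wpM2l//; last by rewrite mulrCA ler_pdivlMl// mulr1.
  by have := sqr_ge0 X; lra.
have H2 : s ^+ 2 <= 2 * x' ^+ 2 + 2 * r.
  have := sqr_ge0 (2 * x' - s); have := sqr_ge0 (y' - h s); rewrite /r; nra.
lra.
Qed.

(** Meant for the derivatives of the kernels, which are of order [|z| ^ (- 2)]: the density then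
    enters through its supremum. *)
Lemma field_regular (Q : R * R -> R) (x y : R) : y - h x != 0 ->
  (forall a b, 0 < a ^+ 2 + b ^+ 2 -> {for (a, b), continuous Q}) ->
  (forall a b, 0 < a ^+ 2 + b ^+ 2 -> `|Q (a, b)| <= (a ^+ 2 + b ^+ 2)^-1) ->
  itg setT (fun s => Q (x - s, y - h s) * w s) /\
  {for (x, y), continuous (field Q)}.
Proof.
move=> eta0 cQ Q_le; have [A [d [A0 d0 HA]]] := curve_distance x y eta0.
have W0 : 0 <= W by apply: le_trans (w_le 0).
have r0 x' y' s : `|x' - x| < d -> `|y' - y| < d ->
    0 < (x' - s) ^+ 2 + (y' - h s) ^+ 2.
  move=> xd yd; have [_] := HA x' y' s xd yd.
  have : 0 < 1 + s ^+ 2 by rewrite ltr_wpDr ?sqr_ge0.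
  by move=> /lt_le_trans H /H; rewrite pmulr_rgt0.
pose g s := W * A * (1 + s ^+ 2)^-1.
have ig : itg setT g by apply: itgZ => //; exact: itg_oneDsqrV.
have le x' y' s : `|x' - x| < d -> `|y' - y| < d ->
    `|Q (x' - s, y' - h s) * w s| <= g s.
  move=> xd yd; have [_ H] := HA x' y' s xd yd; have r1 := r0 x' y' s xd yd.
  rewrite normrM mulrC /g -mulrA; apply: ler_pM => //.
  apply: (le_trans (Q_le _ _ r1)).
  by rewrite ler_pdivlMr ?ltr_wpDr ?sqr_ge0// mulrC ler_pdivrMr.
have mQ (x' y' : R) : `|x' - x| < d -> `|y' - y| < d ->
    measurable_fun setT (fun s : R => Q (x' - s, y' - h s) * w s).
  move=> xd yd; apply: continuous_measurable_fun => s.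
  apply: cvgM; last exact: cw.
  apply: (@continuous_comp _ _ _ (fun s => (x' - s, y' - h s))); last exact/cQ/r0.
  apply: continuous_pair2; apply: cvgB.
  - exact: cvg_cst.
  - exact: cvg_id.
  - exact: cvg_cst.
  - exact: ch.
have n1 : `|x - x| < d by rewrite subrr normr0.
have n2 : `|y - y| < d by rewrite subrr normr0.
split.
  by apply: (dominated_itg _ _ g) => //; [exact: mQ|move=> s _; exact: le].
have near1 : \forall z \near (x, y), `|(z : R * R).1 - x| < d /\ `|z.2 - y| < d.
  have /cvgrPdist_lt/(_ d d0) H1 := @continuous_fst2 R (x, y).
  have /cvgrPdist_lt/(_ d d0) H2 := @continuous_snd2 R (x, y).
  by apply: filterS2 H1 H2 => z; rewrite distrC [`|_ - z.2|]distrC; split.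
apply: (dominated_cvg_filter _ (nbhs (x, y))
  (fun z s => Q (z.1 - s, z.2 - h s) * w s) _ g) => //.
- exact: countable_base_nbhs.
- by apply: filterS near1 => z [xd yd]; exact: mQ.
- by apply: filterS near1 => z [xd yd] s _; exact: le.
- exact: mQ.
apply: aeW => s _; apply: cvgM; last exact: cvg_cst.
apply: (@continuous_comp _ _ _ (fun z : R * R => (z.1 - s, z.2 - h s))); last exact/cQ/r0.
apply: continuous_pair2; (apply: cvgB; last exact: cvg_cst).
- exact: continuous_fst2.
- exact: continuous_snd2.
Qed.

Lemma field_derive (x y : R) : y - h x != 0 ->
  is_derive x 1 (fun x => field K (x, y)) (field Ka (x, y)) /\
  is_derive y 1 (fun y => field K (x, y)) (field Kb (x, y)).
Proof.
move=> eta0; have [A [d [A0 d0 HA]]] := curve_distance x y eta0.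
have W0 : 0 <= W by apply: le_trans (w_le 0).
have r0 x' y' s : `|x' - x| < d -> `|y' - y| < d ->
    0 < (x' - s) ^+ 2 + (y' - h s) ^+ 2.
  move=> xd yd; have [_] := HA x' y' s xd yd.
  have : 0 < 1 + s ^+ 2 by rewrite ltr_wpDr ?sqr_ge0.
  by move=> /lt_le_trans H /H; rewrite pmulr_rgt0.
pose g s := W * A * (1 + s ^+ 2)^-1.
have ig : itg setT g by apply: itgZ => //; exact: itg_oneDsqrV.
have le x' y' s k : `|x' - x| < d -> `|y' - y| < d ->
    `|k| <= ((x' - s) ^+ 2 + (y' - h s) ^+ 2)^-1 -> `|k * w s| <= g s.
  move=> xd yd kr; have [_ H] := HA x' y' s xd yd; have r1 := r0 x' y' s xd yd.
  rewrite normrM mulrC /g -mulrA; apply: ler_pM => //.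
  apply: (le_trans kr).
  by rewrite ler_pdivlMr ?ltr_wpDr ?sqr_ge0// mulrC ler_pdivrMr.
have n1 : `|x - x| < d by rewrite subrr normr0.
have n2 : `|y - y| < d by rewrite subrr normr0.
have deriveZ (f : R -> R) (t df c : R) : is_derive t 1 f df ->
    is_derive t 1 (fun t => f t * c) (df * c).
  move=> Hf; have H := is_deriveM Hf (is_derive_cst c t 1).
  by apply: (is_derive_eq H); rewrite scaler0 add0r /GRing.scale/= mulrC.
split.
- apply: (is_derive_Rintegral (fun x s => K (x - s, y - h s) * w s)
    (fun x s => Ka (x - s, y - h s) * w s) g _ _ d) => //.
  + by move=> x' xd; apply: (field_layer x' y _).1; exact: (HA x' y 0 xd n2).1.
  + move=> x' s xd _; apply: deriveZ.
    by apply: (is_derive_shift (fun a => K (a, y - h s)));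
      exact: (planar_kernel_derive _ _ _ pk _ _ (r0 _ _ _ xd n2)).1.
  + move=> x' s xd _; apply: (le x' y s _ xd n2).
    exact: (planar_kernel_derive_bound _ _ _ pk _ _ (r0 _ _ _ xd n2)).1.
- apply: (is_derive_Rintegral (fun y s => K (x - s, y - h s) * w s)
    (fun y s => Kb (x - s, y - h s) * w s) g _ _ d) => //.
  + by move=> y' yd; apply: (field_layer x y' _).1; exact: (HA x y' 0 n1 yd).1.
  + move=> y' s yd _; apply: deriveZ.
    by apply: (is_derive_shift (fun b => K (x - s, b)));
      exact: (planar_kernel_derive _ _ _ pk _ _ (r0 _ _ _ n1 yd)).2.
  + move=> y' s yd _; apply: (le x y' s _ n1 yd).
    exact: (planar_kernel_derive_bound _ _ _ pk _ _ (r0 _ _ _ n1 yd)).2.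
Qed.
End single_layer.

(** * Explicit integrals over a tangent segment *)

Section tangent_integrals.
Context {R : realType}.
Notation mu := (@lebesgue_measure R).

(** [tan (pi / 2 - d)] with [d = atan b - atan k] is computed by the addition formulas. An
    arctangent whose argument blows up at the curve is thus exchanged for arctangents of bounded
    arguments and an explicit constant, the source of the jump. *)
Lemma atan_quotient (b k : R) : k < b ->
  atan ((1 + k * b) / (b - k)) = pi / 2 - (atan b - atan k).
Proof.
move=> kb; have db := lt_atan kb.
have b1 := atan_ltpi2 b; have b2 := atan_gtNpi2 b.
have k1 := atan_ltpi2 k; have k2 := atan_gtNpi2 k.
set d := atan b - atan k.
have cb : 0 < cos (atan b) by apply: cos_gt0_pihalf; rewrite b2 b1.
have ck : 0 < cos (atan k) by apply: cos_gt0_pihalf; rewrite k2 k1.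
have sE (x : R) : 0 < cos (atan x) -> sin (atan x) = x * cos (atan x).
  have E : sin (atan x) / cos (atan x) = x := atanK x.
  by move=> cx; rewrite -[X in _ = X * _]E divfK// gt_eqF.
have sd : sin d = cos (atan b) * cos (atan k) * (b - k) by rewrite sinB !sE//; ring.
have cd : cos d = cos (atan b) * cos (atan k) * (1 + k * b) by rewrite cosB !sE//; ring.
have <- : tan (pi / 2 - d) = (1 + k * b) / (b - k).
  rewrite /tan -[pi / 2 - d]opprB sinN cosN sinBpihalf cosBpihalf opprK sd cd.
  by field; rewrite !gt_eqF// subr_gt0.
by rewrite tanK// in_itv/= /d; apply/andP; split; lra.
Qed.

Definition phase_sign (s : phase) : R := if s is plus then 1 else -1.

(* The two components of the integral of the kernels along the segment
   [|u| <= 1] of the tangent of slope [k], seen from height [eta] above or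
   below it; unlike the integrals, these are continuous up to [eta = 0]. *)
Definition trace_angle (s : phase) (k eta : R) : R :=
  atan (eta + k) + atan (eta - k) - phase_sign s * pi.
Definition trace_log (k eta : R) : R :=
  (ln (1 + (eta + k) ^+ 2) - ln (1 + (eta - k) ^+ 2)) / 2.
Definition trace1 (s : phase) (k eta : R) : R :=
  (trace_angle s k eta - k * trace_log k eta) / (1 + k ^+ 2).
Definition trace2 (s : phase) (k eta : R) : R :=
  (k * trace_angle s k eta + trace_log k eta) / (1 + k ^+ 2).

Let onek (k : R) : 0 < 1 + k ^+ 2. Proof. by rewrite ltr_wpDr ?sqr_ge0. Qed.

(** Along the segment [z = u + i (eta + k u)], and [(1 - i k) z] has real part
    [(1 + k ^ 2) u + k eta] and imaginary part [eta]: [angle] is the arctangent of their quotient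
    and [q] is [|z| ^ 2]. Together they form the complex logarithm that integrates [1 / z]; dividing
    it by [1 + i k] produces the combinations in [trace1] and [trace2]. *)
Let angle (k eta u : R) : R := atan (((1 + k ^+ 2) * u + k * eta) / eta).
Let q (k eta u : R) : R := u ^+ 2 + (eta + k * u) ^+ 2.

Let q_gt0 (k eta u : R) : eta != 0 -> 0 < q k eta u.
Proof.
move=> e0; rewrite /q; have [->|u0] := eqVneq u 0.
  by rewrite mulr0 addr0 expr0n add0r exprn_even_gt0.
by rewrite ltr_wpDr ?sqr_ge0// exprn_even_gt0.
Qed.

Let qE (k eta u : R) :
  eta ^+ 2 + ((1 + k ^+ 2) * u + k * eta) ^+ 2 = (1 + k ^+ 2) * q k eta u.
Proof. by rewrite /q; ring. Qed.

Let is_derive_angle (k eta u : R) : eta != 0 ->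
  is_derive u 1 (angle k eta) (eta / q k eta u).
Proof.
move=> e0.
have H1 : is_derive u 1 (fun u : R => ((1 + k ^+ 2) * u + k * eta) / eta)
    ((1 + k ^+ 2) / eta).
  apply: is_derive_eq; rewrite /GRing.scale/=; field.
  by [].
have H := @is_derive1_comp _ atan (fun u : R => ((1 + k ^+ 2) * u + k * eta) / eta) u _ _
  (is_derive1_atan _) H1.
apply: (is_derive_eq H).
have q0 := q_gt0 k eta u e0; have k0 := onek k.
rewrite /GRing.scale/=.
have -> : (1 + (((1 + k ^+ 2) * u + k * eta) / eta) ^+ 2) =
    (1 + k ^+ 2) * q k eta u / eta ^+ 2 by rewrite -qE; field.
by field; rewrite e0 !gt_eqF.
Qed.

Let is_derive_logq (k eta u : R) : eta != 0 ->
  is_derive u 1 (fun u : R => ln (q k eta u) / 2)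
    (((1 + k ^+ 2) * u + k * eta) / q k eta u).
Proof.
move=> e0; have q0 := q_gt0 k eta u e0.
have H1 : is_derive u 1 (q k eta) (2 * u + 2 * k * (eta + k * u)).
  by rewrite /q; apply: is_derive_eq; rewrite /GRing.scale/=; ring.
have H2 := is_derive1_comp (is_derive1_ln q0) H1.
have H := is_deriveM H2 (is_derive_cst (2^-1 : R) u 1).
apply: (is_derive_eq H); rewrite /GRing.scale/=; field.
by rewrite gt_eqF.
Qed.

Let angle_jump (s : phase) (k eta : R) : 0 < phase_sign s * eta ->
  angle k eta 1 - angle k eta (-1) = - trace_angle s k eta.
Proof.
have E (a b : R) : 0 < a -> angle b a 1 - angle b a (-1) =
    pi - atan (a + b) - atan (a - b).
  move=> a0.
  have -> : angle b a 1 = pi / 2 - (atan (a + b) - atan b).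
    rewrite -atan_quotient; last by rewrite ltrDr.
    by congr atan; congr (_ / _); ring.
  have -> : angle b a (-1) = - (pi / 2 - (atan (a - b) - atan (- b))).
    rewrite -atan_quotient; last by rewrite ltrDr.
    by rewrite -atanN -mulNr; congr atan; congr (_ / _); ring.
  by rewrite atanN; lra.
case: s; rewrite /phase_sign/= ?mulN1r ?mul1r => e0; last first.
  by rewrite E// /trace_angle/=; ring.
(* The lower side reduces to the upper one by the symmetry [(u, eta) -> (- u, - eta)]. *)
have N u : angle k eta u = angle k (- eta) (- u).
  by rewrite /angle; congr atan; rewrite invrN mulrN -mulNr; congr (_ / _); ring.
rewrite !N opprK -opprB E// /trace_angle/=.
rewrite (_ : - eta + k = - (eta - k)); last by ring.
rewrite (_ : - eta - k = - (eta + k)); last by ring.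
by rewrite !atanN; ring.
Qed.

Let logq_jump (k eta : R) :
  ln (q k eta 1) / 2 - ln (q k eta (-1)) / 2 = trace_log k eta.
Proof.
rewrite /trace_log mulrBl /q expr1n mulr1 sqrrN expr1n mulrN1.
by [].
Qed.

Let kernel_continuous (K Ka Kb : R * R -> R) (k eta : R) : eta != 0 ->
  planar_kernel K Ka Kb -> {within `[-1, 1], continuous (fun u => K (u, eta + k * u))}.
Proof.
move=> e0 pk; apply: continuous_subspaceT => u.
apply: (@continuous_comp _ _ _ (fun u => (u, eta + k * u))).
  apply: continuous_pair2; first exact: cvg_id.
  apply: cvgD; first exact: cvg_cst.
  by apply: cvgM; [exact: cvg_cst|exact: cvg_id].
by have [] := planar_kernel_continuous _ _ _ pk u (eta + k * u) (q_gt0 k eta u e0).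
Qed.

Lemma tangent_integral1 (s : phase) (k eta : R) : 0 < phase_sign s * eta ->
  tangent_integral kernel1 k eta = trace1 s k eta.
Proof.
move=> se; have e0 : eta != 0.
  by apply: contraTneq se => ->; rewrite mulr0 ltxx.
pose F u := (- angle k eta u - k * (ln (q k eta u) / 2)) / (1 + k ^+ 2).
have -> : tangent_integral kernel1 k eta = F 1 - F (-1).
  apply: ftc_derive => [|u _|].
  - by lra.
  - have H1 := is_derive_angle k eta u e0; have H2 := is_derive_logq k eta u e0.
    have H3 := is_deriveB (is_deriveN H1) (is_deriveM (is_derive_cst k u 1) H2).
    have H := is_deriveM H3 (is_derive_cst ((1 + k ^+ 2)^-1 : R) u 1).
    apply: (is_derive_eq H); have q0 := q_gt0 k eta u e0; have k0 := onek k.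
    rewrite /GRing.scale/= /kernel1/= -/(q k eta u).
    by field; rewrite !gt_eqF.
  - exact: kernel_continuous e0 planar_kernel1.
rewrite /F /trace1 -mulrBl; congr (_ / _).
by rewrite -(logq_jump k eta) -[trace_angle _ _ _]opprK -(angle_jump s k eta se); ring.
Qed.

Lemma tangent_integral2 (s : phase) (k eta : R) : 0 < phase_sign s * eta ->
  tangent_integral kernel2 k eta = trace2 s k eta.
Proof.
move=> se; have e0 : eta != 0.
  by apply: contraTneq se => ->; rewrite mulr0 ltxx.
pose F u := (ln (q k eta u) / 2 - k * angle k eta u) / (1 + k ^+ 2).
have -> : tangent_integral kernel2 k eta = F 1 - F (-1).
  apply: ftc_derive => [|u _|].
  - by lra.
  - have H1 := is_derive_angle k eta u e0; have H2 := is_derive_logq k eta u e0.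
    have H3 := is_deriveB H2 (is_deriveM (is_derive_cst k u 1) H1).
    have H := is_deriveM H3 (is_derive_cst ((1 + k ^+ 2)^-1 : R) u 1).
    apply: (is_derive_eq H); have q0 := q_gt0 k eta u e0; have k0 := onek k.
    rewrite /GRing.scale/= /kernel2/= -/(q k eta u).
    by field; rewrite !gt_eqF.
  - exact: kernel_continuous e0 planar_kernel2.
rewrite /F /trace2 -mulrBl; congr (_ / _).
by rewrite -(logq_jump k eta) -[trace_angle _ _ _]opprK -(angle_jump s k eta se); ring.
Qed.

Lemma trace1_0 (s : phase) (k : R) : trace1 s k 0 = - phase_sign s * pi / (1 + k ^+ 2).
Proof.
rewrite /trace1 /trace_angle /trace_log !add0r sqrrN atanN !subrr; congr (_ / _); ring.
Qed.

Lemma trace2_0 (s : phase) (k : R) :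
  trace2 s k 0 = - phase_sign s * k * pi / (1 + k ^+ 2).
Proof.
rewrite /trace2 /trace_angle /trace_log !add0r sqrrN atanN !subrr; congr (_ / _); ring.
Qed.

(** The arguments [eta + k] and [eta - k] differ by [2 k], so the ratio [(1 + a ^ 2) / (1 + b ^ 2)]
    stays below [2 + 8 L ^ 2] at every height. *)
Let log_le (L k eta : R) : `|k| <= L -> `|trace_log k eta| <= ln (2 + 8 * L ^+ 2) / 2.
Proof.
move=> kL; have L0 : 0 <= L by exact: le_trans kL.
have c0 : 0 < 2 + 8 * L ^+ 2 by have := sqr_ge0 L; lra.
have kL2 : k ^+ 2 <= L ^+ 2.
  by rewrite -[leLHS]real_normK ?num_real// ler_sqr ?nnegrE.
have key (a b : R) : (a - b) ^+ 2 = 4 * k ^+ 2 ->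
    ln (1 + a ^+ 2) - ln (1 + b ^+ 2) <= ln (2 + 8 * L ^+ 2).
  move=> E; rewrite lerBlDr -lnM ?posrE// ler_ln ?posrE ?mulr_gt0//.
  have := sqr_ge0 (a - 2 * b); have := sqr_ge0 b; have := sqr_ge0 L.
  have := mulr_ge0 (sqr_ge0 b) (sqr_ge0 L); nra.
rewrite /trace_log normrM [`|2^-1|]ger0_norm// ler_wpM2r// ler_norml lerNl opprB.
by rewrite !key//; ring.
Qed.

Lemma trace_bounded (L : R) : exists B, forall s k eta, `|k| <= L ->
  `|trace1 s k eta| <= B /\ `|trace2 s k eta| <= B.
Proof.
exists (2 * pi + 2 * (ln (2 + 8 * L ^+ 2) / 2)) => s k eta kL.
have Hl := log_le L k eta kL; set l := ln _ / 2 in Hl *.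
have Ha : `|trace_angle s k eta| <= 2 * pi.
  have H1 := atan_ltpi2 (eta + k); have H2 := atan_gtNpi2 (eta + k).
  have H3 := atan_ltpi2 (eta - k); have H4 := atan_gtNpi2 (eta - k).
  by rewrite ler_norml /trace_angle; case: s; rewrite /phase_sign; apply/andP; split; lra.
have k1 := onek k.
have k2 : `|k| <= 1 + k ^+ 2.
  rewrite -[k ^+ 2]real_normK ?num_real//; have := sqr_ge0 (`|k| - 1); nra.
have k3 : 1 <= 1 + k ^+ 2 by rewrite lerDl sqr_ge0.
set A := trace_angle s k eta in Ha *; set g := trace_log k eta in Hl *.
have A0 := normr_ge0 A; have g0 := normr_ge0 g.
split; rewrite normrM normfV [`|1 + _|]gtr0_norm// ler_pdivrMr//.
  apply: (le_trans (ler_normB _ _)); rewrite normrM; nra.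
apply: (le_trans (ler_normD _ _)); rewrite normrM; nra.
Qed.

Lemma continuous_trace (s : phase) (k eta : R * R -> R) (z : R * R) :
  {for z, continuous k} -> {for z, continuous eta} ->
  {for z, continuous (fun z => trace1 s (k z) (eta z))} /\
  {for z, continuous (fun z => trace2 s (k z) (eta z))}.
Proof.
move=> ck ce.
have cp : {for z, continuous (fun z => eta z + k z)} by exact: cvgD.
have cm : {for z, continuous (fun z => eta z - k z)} by exact: cvgB.
have ca (f : R * R -> R) : {for z, continuous f} -> {for z, continuous (fun z => atan (f z))}.
  by move=> cf; apply: (@continuous_comp _ _ _ f atan) => //; exact: continuous_atan.
have cl (f : R * R -> R) : {for z, continuous f} ->
    {for z, continuous (fun z => ln (1 + f z ^+ 2))}.
  move=> cf; apply: (@continuous_comp _ _ _ (fun z => 1 + f z ^+ 2) (@ln R)).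
    by apply: cvgD; [exact: cvg_cst|exact: continuous_sqr2].
  exact: continuous_ln.
have cA : {for z, continuous (fun z => trace_angle s (k z) (eta z))}.
  by apply: cvgB; [apply: cvgD; exact: ca|exact: cvg_cst].
have cL : {for z, continuous (fun z => trace_log (k z) (eta z))}.
  by apply: cvgM; [apply: cvgB; exact: cl|exact: cvg_cst].
have cV : {for z, continuous (fun z => (1 + k z ^+ 2)^-1)}.
  by apply: cvgV; [rewrite gt_eqF|apply: cvgD; [exact: cvg_cst|exact: continuous_sqr2]].
split; apply: cvgM => //.
  by apply: cvgB => //; exact: cvgM.
by apply: cvgD => //; exact: cvgM.
Qed.
End tangent_integrals.

(** * Potentials on the sides of a graph *)

Section potentials.
Context {R : realType}.

Lemma near_box (x y : R) (A : set (R * R)) : (\forall z \near (x, y), A z) ->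
  exists2 d, 0 < d & forall x' y', `|x' - x| < d -> `|y' - y| < d -> A (x', y').
Proof.
move=> /nbhs_ballP[d /= d0 H]; exists d => // x' y' xd yd; apply: H.
by split; rewrite /ball/= distrC.
Qed.

Lemma box_near (x y d : R) (A : set (R * R)) : 0 < d ->
  (forall x' y', `|x' - x| < d -> `|y' - y| < d -> A (x', y')) ->
  \forall z \near (x, y), A z.
Proof.
move=> d0 H; apply/nbhs_ballP; exists d => // -[x' y'] [/=].
by rewrite /ball/= distrC [`|y - _|]distrC; exact: H.
Qed.

(** The second difference of [F] over a small square of side [k] is evaluated by the mean value
    theorem in both orders, giving a value of [F12] and one of [F21] at nearby points that
    coincide. *)
Lemma mixed_partials (F F1 F2 F12 F21 : R * R -> R) (x y : R) :
  (\forall z \near (x, y),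
    [/\ is_derive (z : R * R).1 1 (fun s => F (s, z.2)) (F1 z),
        is_derive z.2 1 (fun s => F (z.1, s)) (F2 z),
        is_derive z.2 1 (fun s => F1 (z.1, s)) (F12 z) &
        is_derive z.1 1 (fun s => F2 (s, z.2)) (F21 z)]) ->
  {for (x, y), continuous F12} -> {for (x, y), continuous F21} ->
  F12 (x, y) = F21 (x, y).
Proof.
move=> N c12 c21; apply/eqP; rewrite -subr_eq0 -normr_le0.
apply/ler_addgt0Pl => e e0; rewrite addr0.
have e2 : 0 < e / 2 by rewrite divr_gt0.
have N12 : \forall z \near (x, y), `|F12 (x, y) - F12 z| < e / 2.
  by move/cvgrPdist_lt: c12; apply.
have N21 : \forall z \near (x, y), `|F21 (x, y) - F21 z| < e / 2.
  by move/cvgrPdist_lt: c21; apply.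
have [d d0 H] := near_box _ _ _ (filterI N (filterI N12 N21)).
have [k0 kd] : 0 < d / 2 /\ d / 2 < d by split; lra.
set k := d / 2 in k0 kd *.
have B (a t : R) : Num.min a (a + k) <= t <= Num.max a (a + k) -> `|t - a| < d.
  rewrite min_l ?max_r ?lerDl ?(ltW k0)// => /andP[t1 t2].
  by rewrite ger0_norm ?subr_ge0//; lra.
have B0 (a : R) : `|a - a| < d by rewrite subrr normr0.
have B1 (a : R) : `|a + k - a| < d by rewrite addrC addKr gtr0_norm.
have [s1 Hs1 E1] := mvt_between (fun s => F (s, y + k) - F (s, y))
  (fun s => F1 (s, y + k) - F1 (s, y)) x (x + k)
  (fun s Hs => is_deriveB (let: And4 p _ _ _ := (H s (y + k) (B _ _ Hs) (B1 y)).1 in p)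
     (let: And4 p _ _ _ := (H s y (B _ _ Hs) (B0 y)).1 in p)).
have [t1 Ht1 E2] := mvt_between (fun t => F1 (s1, t)) (fun t => F12 (s1, t)) y (y + k)
  (fun t Ht => let: And4 _ _ p _ := (H s1 t (B _ _ Hs1) (B _ _ Ht)).1 in p).
have [t2 Ht2 E3] := mvt_between (fun t => F (x + k, t) - F (x, t))
  (fun t => F2 (x + k, t) - F2 (x, t)) y (y + k)
  (fun t Ht => is_deriveB (let: And4 _ p _ _ := (H (x + k) t (B1 x) (B _ _ Ht)).1 in p)
     (let: And4 _ p _ _ := (H x t (B0 x) (B _ _ Ht)).1 in p)).
have [s2 Hs2 E4] := mvt_between (fun s => F2 (s, t2)) (fun s => F21 (s, t2)) x (x + k)
  (fun s Hs => let: And4 _ _ _ p := (H s t2 (B _ _ Hs) (B _ _ Ht2)).1 in p).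
have E : F12 (s1, t1) = F21 (s2, t2).
  move: E1 E3; rewrite E2 E4 !(addrC _ k) !addrK => E1 E3.
  apply: (mulIf (x := k)); first by rewrite gt_eqF.
  apply: (mulIf (x := k)); first by rewrite gt_eqF.
  by rewrite -E1 -E3; ring.
have /= H1 := (H s1 t1 (B _ _ Hs1) (B _ _ Ht1)).2.1.
have /= H2 := (H s2 t2 (B _ _ Hs2) (B _ _ Ht2)).2.2.
have := ler_normB (F12 (x, y) - F12 (s1, t1)) (F21 (x, y) - F21 (s2, t2)).
rewrite E (_ : _ - _ - _ = F12 (x, y) - F21 (x, y)); last by ring.
move: H1; rewrite E; lra.
Qed.

Lemma continuous_prim2 (f : R * R -> R) : continuous f ->
  continuous (fun z : R * R => prim (fun t => f (z.1, t)) z.2).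
Proof.
move=> cf [x y].
have between (a b t : R) : `|b - a| < 1 -> Num.min a b <= t <= Num.max a b ->
    a - 1 <= t <= a + 1.
  rewrite ltr_norml => /andP[? ?].
  by case: (leP a b) => ? /andP[? ?]; apply/andP; split; lra.
have d2 (x' y' : R) : is_derive y' 1 (prim (fun t => f (x', t))) (f (x', y')).
  by apply: (is_derive_prim (fun t => f (x', t))) => t; apply: continuous_sec2; exact: cf.
have c1 : {for x, continuous (fun x => prim (fun t => f (x, t)) y)}.
  apply: (continuous_prim_param (fun z => f (z.2, z.1))) => z.
  apply: (@continuous_comp _ _ _ (fun z : R * R => (z.2, z.1)) f); last exact: cf.
  by apply: continuous_pair2; [exact: continuous_snd2|exact: continuous_fst2].
have [M HM] := bounded_rectangle f (x - 1) (x + 1) (y - 1) (y + 1) (fun _ _ _ _ => cf _).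
apply/cvgrPdist_lt => e e0; have e2 : 0 < e / 2 by rewrite divr_gt0.
have M0 : 0 <= M by apply: le_trans (HM x y _ _); rewrite ?normr_ge0//; lra.
have /cvgrPdist_lt/(_ _ e2)/nbhs_ballP[d /= d0 Hd] := c1.
pose r := Num.min 1 (Num.min d (e / (2 * (M + 1)))).
have M1 : 0 < 2 * (M + 1) by lra.
have r0 : 0 < r by rewrite !lt_min ltr01 d0 divr_gt0.
apply: (box_near _ _ r) => // x' y'; rewrite !lt_min => /and3P[x1 xd _] /and3P[y1 _ ye].
have [t Ht E] := mvt_between (prim (fun t => f (x', t))) (fun t =>
    f (x', t)) y y' (fun t _ => d2 x' t).
have Hx : `|prim (fun t => f (x, t)) y - prim (fun t => f (x', t)) y| < e / 2.
  by apply: Hd; rewrite /ball/= distrC.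
have Hy : `|prim (fun t => f (x', t)) y' - prim (fun t => f (x', t)) y| <= e / 2.
  rewrite E normrM; apply: (@le_trans _ _ (M * (e / (2 * (M + 1))))).
    apply: ler_pM => //; last exact: ltW.
    by apply: HM; [rewrite -ler_distl ltW|exact: between Ht].
  by rewrite mulrA ler_pdivrMr//; nra.
have := ler_normB (prim (fun t => f (x, t)) y - prim (fun t => f (x', t)) y)
  (prim (fun t => f (x', t)) y' - prim (fun t => f (x', t)) y).
by rewrite /= (_ : _ - _ - _ = prim (fun t => f (x, t)) y - prim (fun t =>
    f (x', t)) y'); [lra|ring].
Qed.

Section below_or_above.
(** [D] is a condition on the height above the curve: one sign for a single fluid, [y != 0] for both
    sides together. The form [u1 dx + u2 dy] is closed where [D] holds and continuous everywhere. *)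
Variables (h m : R -> R) (u1 u2 d1 d2 : R * R -> R) (D : R -> Prop).
Hypothesis dh : forall x : R, is_derive x 1 h (m x).
Hypothesis cm : continuous m.
Hypothesis cu1 : continuous u1.
Hypothesis cu2 : continuous u2.
Hypothesis open_D : forall y : R, D y -> \forall y' \near y, D y'.
Hypothesis u12 : forall x y : R, D (y - h x) ->
  is_derive y 1 (fun s => u1 (x, s)) (d1 (x, y)).
Hypothesis u21 : forall x y : R, D (y - h x) ->
  is_derive x 1 (fun s => u2 (s, y)) (d1 (x, y)).
Hypothesis u22 : forall x y : R, D (y - h x) ->
  is_derive y 1 (fun s => u2 (x, s)) (d2 (x, y)).
Hypothesis cd1 : forall x y : R, D (y - h x) -> {for (x, y), continuous d1}.
Hypothesis cd2 : forall x y : R, D (y - h x) -> {for (x, y), continuous d2}.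

Let ch : continuous h.
Proof. by move=> x; exact: (is_derive_continuous _ _ _ (dh x)). Qed.

Let lift (z : R * R) : R * R := (z.1, h z.1 + z.2).
Let clift : continuous lift.
Proof.
move=> z; apply: continuous_pair2; first exact: continuous_fst2.
apply: cvgD; last exact: continuous_snd2.
by apply: (@continuous_comp _ _ _ fst h); [exact: continuous_fst2|exact: ch].
Qed.

Let cl (f : R * R -> R) (z : R * R) : {for lift z, continuous f} ->
  {for z, continuous (fun z => f (lift z))}.
Proof. by move=> cf; apply: (@continuous_comp _ _ _ lift f); [exact: clift|exact: cf]. Qed.

Let cm1 : continuous (fun z : R * R => m z.1).
Proof. by move=> z; apply: (@continuous_comp _ _ _ fst m);
    [exact: continuous_fst2|exact: cm]. Qed.

(** [a] and [q] are the components of the form pulled back by [lift], and [c] is the derivative of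
    [a] in the second variable and of [q] in the first. [theta] integrates along the curve and then
    vertically. *)
Let a (z : R * R) := u1 (lift z) + u2 (lift z) * m z.1.
Let q (z : R * R) := u2 (lift z).
Let c (z : R * R) := d1 (lift z) + d2 (lift z) * m z.1.
Let theta (z : R * R) := prim (fun t => q (z.1, t)) z.2 + prim (fun s => a (s, 0)) z.1.

Let ca : continuous a.
Proof. by move=> z; apply: cvgD; [apply: cl; exact: cu1|apply: cvgM; [apply: cl;
    exact: cu2|exact: cm1]]. Qed.
Let cq : continuous q. Proof. by move=> z; apply: cl; exact: cu2. Qed.

Let is_derive_up (f : R -> R) (b y d : R) : is_derive (b + y) 1 f d ->
  is_derive y 1 (fun y : R => f (b + y)) d.
Proof.
move=> /is_derive1P H; apply/is_derive1P; apply: cvg_trans H.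
by apply: near_eq_cvg; apply: nearW => k; rewrite addrA.
Qed.

Let D_near (x y : R) : D (y - h x) -> \forall z \near (x, y), D ((z : R * R).2 - h z.1).
Proof.
move=> /open_D H.
have C : {for (x, y), continuous (fun z : R * R => z.2 - h z.1)}.
  apply: cvgB; first exact: continuous_snd2.
  by apply: (@continuous_comp _ _ _ fst h); [exact: continuous_fst2|exact: ch].
exact: C _ H.
Qed.

Let a2 (x y : R) : D y -> is_derive y 1 (fun t => a (x, t)) (c (x, y)).
Proof.
move=> Dy; have Dy' : D (h x + y - h x) by rewrite addrC addKr.
have H1 := is_derive_up (fun s => u1 (x, s)) (h x) y _ (u12 x _ Dy').
have H2 := is_derive_up (fun s => u2 (x, s)) (h x) y _ (u22 x _ Dy').
have H := is_deriveD H1 (is_deriveM H2 (is_derive_cst (m x) y 1)).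
by apply: (is_derive_eq H); rewrite /c /lift/= scaler0 add0r /GRing.scale/= [m x * _]mulrC.
Qed.

Let q1 (x y : R) : D y -> is_derive x 1 (fun s => q (s, y)) (c (x, y)).
Proof.
move=> Dy; have Dy' : D (h x + y - h x) by rewrite addrC addKr.
have H0 : is_derive x 1 (fun s : R => h s + y) (m x).
  have H := is_deriveD (dh x) (is_derive_cst y x 1).
  by apply: (is_derive_eq H); rewrite addr0.
have N := D_near _ _ Dy'.
rewrite (_ : c (x, y) = d1 (lift (x, y)) * 1 + d2 (lift (x, y)) * m x); last by rewrite mulr1.
apply: (is_derive_chain2 u2 d1 d2 id (fun s => h s + y)).
- by apply: filterS N => -[z1 z2]; exact: u21.
- by apply: filterS N => -[z1 z2]; exact: u22.
- exact: cd1.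
- exact: cd2.
Qed.

Let cc (x y : R) : D y -> {for (x, y), continuous c}.
Proof.
move=> Dy; have Dy' : D (h x + y - h x) by rewrite addrC addKr.
apply: cvgD; first by apply: cl; exact: cd1.
by apply: cvgM; [apply: cl; exact: cd2|exact: cm1].
Qed.

Let theta2 (x y : R) : is_derive y 1 (fun t => theta (x, t)) (q (x, y)).
Proof.
have H1 : is_derive y 1 (prim (fun t => q (x, t))) (q (x, y)).
  by apply: (is_derive_prim (fun t => q (x, t))) => t; apply: continuous_sec2; exact: cq.
have H := is_deriveD H1 (is_derive_cst (prim (fun s => a (s, 0)) x) y 1).
by apply: (is_derive_eq H); rewrite addr0.
Qed.

Let reach (y : R) := forall t, Num.min 0 y < t < Num.max 0 y -> D t.

Let theta1 (x y : R) : reach y -> is_derive x 1 (fun s => theta (s, y)) (a (x, y)).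
Proof.
(* The other path, vertical over [0] and then parallel to the curve at height [y], puts the
   dependence on [x] into a single primitive. *)
move=> ry; have -> : (fun s => theta (s, y)) =
    (fun s => prim (fun s => a (s, y)) s + prim (fun t => q (0, t)) y).
  apply/funext => b.
  exact: (closed_form_circulation a q c D b y ca cq open_D a2 q1 cc ry).
have H1 : is_derive x 1 (prim (fun s => a (s, y))) (a (x, y)).
  by apply: (is_derive_prim (fun s => a (s, y))) => t; apply: continuous_sec1; exact: ca.
have H := is_deriveD H1 (is_derive_cst (prim (fun t => q (0, t)) y) x 1).
by apply: (is_derive_eq H); rewrite addr0.
Qed.

(* The circulation is computed in the coordinates [(x, y - h x)], which make
   the curve a line; [u1 + u2 m] and [u2] are then the components of the form. *)
Lemma potential_exists : exists Phi : R * R -> R, [/\ continuous Phi,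
  forall x y : R,
    (\forall y' \near (y - h x), forall t, Num.min 0 y' < t < Num.max 0 y' -> D t) ->
    is_derive x 1 (fun s => Phi (s, y)) (u1 (x, y)) /\
    is_derive y 1 (fun s => Phi (x, s)) (u2 (x, y)) &
  forall x : R, is_derive x 1 (fun s => Phi (s, h s)) (u1 (x, h x) + u2 (x, h x) * m x)].
Proof.
have hE (x y : R) : h x + (y - h x) = y by rewrite addrC subrK.
exists (fun z => theta (z.1, z.2 - h z.1)); split.
- move=> z; apply: (@continuous_comp _ _ _ (fun z : R * R => (z.1, z.2 - h z.1)) theta).
    apply: continuous_pair2; first exact: continuous_fst2.
    apply: cvgB; first exact: continuous_snd2.
    by apply: (@continuous_comp _ _ _ fst h); [exact: continuous_fst2|exact: ch].
  apply: cvgD; first exact: (continuous_prim2 q cq).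
  apply: (@continuous_comp _ _ _ fst (prim (fun s => a (s, 0)))); first exact: continuous_fst2.
  apply: (@is_derive_continuous _ _ _ (a ((z.1, z.2 - h z.1).1, 0))).
  by apply: (is_derive_prim (fun s => a (s, 0))) => t; apply: continuous_sec1; exact: ca.
- move=> x y N.
  have N1 : \forall z \near (x, y - h x), is_derive (z : R * R).1 1 (fun s =>
      theta (s, z.2)) (a z).
    have N0 : \forall z \near (x, y - h x), reach (z : R * R).2.
      exact: (@continuous_snd2 R (x, y - h x) _ N).
    by apply: filterS N0 => -[z1 z2] /=; exact: theta1.
  have N2 : \forall z \near (x, y - h x), is_derive (z : R * R).2 1 (fun s =>
      theta (z.1, s)) (q z).
    by apply: filterS N1 => -[z1 z2] _; exact: theta2.
  split.
    have H0 : is_derive x 1 (fun s : R => y - h s) (- m x).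
      have H := is_deriveB (is_derive_cst y x 1) (dh x).
      by apply: (is_derive_eq H); rewrite sub0r.
    have := is_derive_chain2 theta a q id (fun s => y - h s) x 1 (- m x) N1 N2
      (ca _) (cq _) (is_derive_id _ _) H0.
    rewrite /a /q /lift/= hE => H; apply: (is_derive_eq H); ring.
  have H0 : is_derive y 1 (fun s : R => s - h x) 1.
    have H := is_deriveB (is_derive_id y 1) (is_derive_cst (h x) y 1).
    by apply: (is_derive_eq H); rewrite subr0.
  have := is_derive_chain2 theta a q (fun=> x) (fun s => s - h x) y 0 1 N1 N2
      (ca _) (cq _) (is_derive_cst _ _ _) H0.
  rewrite /a /q /lift/= hE => H; apply: (is_derive_eq H); ring.
- move=> x; under eq_fun do rewrite subrr.
  (* On the curve itself the vertical segment is empty, so that the tangential derivative of the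
     potential is available there. *)
  have r0 : reach 0 by move=> t; rewrite minxx maxxx => /andP[/lt_trans H /H]; rewrite ltxx.
  by have := theta1 x 0 r0; rewrite /a /lift/= addr0.
Qed.
End below_or_above.
End potentials.

(** * Velocity of a vortex sheet on either side *)

Section sheet_component.
Context {R : realType}.
Variables (h m w : R -> R) (C L W : R).
Hypothesis sheet : vortex_sheet h m w C L W.
Variables K Ka Kb : R * R -> R.
Hypothesis pk : planar_kernel K Ka Kb.
Variables (sg B : R) (tr : R -> R -> R).
Hypothesis sg0 : sg != 0.
Hypothesis tr_continuous : forall (k eta : R * R -> R) (z : R * R),
  {for z, continuous k} -> {for z, continuous eta} ->
  {for z, continuous (fun z => tr (k z) (eta z))}.
Hypothesis trE : forall k eta, 0 < sg * eta -> tangent_integral K k eta = tr k eta.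
Hypothesis tr_le : forall k eta, `|k| <= L -> `|tr k eta| <= B.

Let dh := sheet_derive _ _ _ _ _ _ sheet.
Let m_le := sheet_slope_le _ _ _ _ _ _ sheet.
Let w_le := sheet_density_le _ _ _ _ _ _ sheet.
Let ch : continuous h.
Proof. by move=> x; exact: (is_derive_continuous _ _ _ (dh x)). Qed.
Let cm : continuous m.
Proof. exact: half_holder_continuous (sheet_slope_holder _ _ _ _ _ _ sheet). Qed.
Let cw : continuous w.
Proof. exact: half_holder_continuous (sheet_density_holder _ _ _ _ _ _ sheet). Qed.

#[local] Existing Instance at_infinity_filter.

(** Defined and continuous on the whole plane, although it is the Biot-Savart integral only on the
    side selected by [sg]: traces on the curve become plain values. *)
Definition sheet_component (z : R * R) : R :=
  near_layer h m w K z.1 (z.2 - h z.1) + far_layer h w K z.1 (z.2 - h z.1) +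
  tr (m z.1) (z.2 - h z.1) * w z.1.

Lemma continuous_height (z : R * R) : {for z, continuous (fun z : R * R => z.2 - h z.1)}.
Proof.
apply: cvgB; first exact: continuous_snd2.
by apply: (@continuous_comp _ _ _ fst h); [exact: continuous_fst2|exact: ch].
Qed.

Lemma continuous_sheet_component : continuous sheet_component.
Proof.
move=> z.
have cf (f : R * R -> R) : continuous f ->
    {for z, continuous (fun z : R * R => f (z.1, z.2 - h z.1))}.
  move=> cf; apply: (@continuous_comp _ _ _ (fun z : R * R => (z.1, z.2 - h z.1)) f);
      last exact: cf.
  by apply: continuous_pair2; [exact: continuous_fst2|exact: continuous_height].
apply: cvgD; first apply: cvgD.
- exact: (cf (fun z => near_layer h m w K z.1 z.2) (continuous_near_layer _ _ _ _ _ _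
    sheet _ _ _ pk)).
- exact: (cf (fun z => far_layer h w K z.1 z.2) (continuous_far_layer _ _ _ _ _ _ sheet _
    _ _ pk)).
apply: cvgM.
  apply: (tr_continuous (fun z => m z.1) (fun z => z.2 - h z.1)); last exact: continuous_height.
  by apply: (@continuous_comp _ _ _ fst m); [exact: continuous_fst2|exact: cm].
by apply: (@continuous_comp _ _ _ fst w); [exact: continuous_fst2|exact: cw].
Qed.

Lemma sheet_component_field (x y : R) : 0 < sg * (y - h x) ->
  sheet_component (x, y) = field h w K (x, y).
Proof.
move=> s0; have e0 : y - h x != 0.
  by apply: contraTneq s0 => ->; rewrite mulr0 ltxx.
rewrite /sheet_component/= -trE//.
have [_ ->] := field_layer _ _ _ _ _ _ sheet _ _ _ pk x y e0.
by have [_ ->] := layer_integral _ _ _ _ _ _ sheet _ _ _ pk x _ e0.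
Qed.

Lemma sheet_component_vanish (e : R) : 0 < e ->
  exists M, forall z, M < `|z| -> 0 <= sg * (z.2 - h z.1) -> `|sheet_component z| < e.
Proof.
move=> e0; have e3 : 0 < e / 4 by rewrite divr_gt0.
have /cvgrPdist_lt/(_ _ e3)[M1 H1] := near_layer_vanishing _ _ _ _ _ _ sheet _ _ _ pk.
have /cvgrPdist_lt/(_ _ e3)[M2 H2] := far_layer_vanishing _ _ _ _ _ _ sheet _ _ _ pk.
have [Bh hB] := sheet_bounded _ _ _ _ _ _ sheet.
have Bh0 : 0 <= Bh by exact: le_trans (hB 0).
have L0 : 0 <= L by exact: le_trans (m_le 0).
have W0 : 0 <= W by exact: le_trans (w_le 0).
have B0 : 0 <= B by apply: le_trans (tr_le 0 0 _); rewrite ?normr0.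
have B1 : 0 < B + 1 by lra.
have [M3 H3] := sheet_density_vanish _ _ _ _ _ _ sheet (e / 4 / (B + 1)) (divr_gt0 e3 B1).
have W1 : 0 <= 2 * W / (e / 4) by rewrite divr_ge0 ?(ltW e3)// mulr_ge0.
(* At heights beyond [M4] the tangent contribution [2 W / (|eta| - L)] is at most [e / 4]; the later
   addition of [Bh], a bound for the curve, converts heights above the curve into ordinates. *)
pose M4 := L + 2 * W / (e / 4).
pose M := Num.max (Num.max M1 M2) (Num.max M3 M4) + Bh.
exists M => -[x y]/= zM s0.
have MM : [/\ M1 + Bh <= M, M2 + Bh <= M, M3 + Bh <= M & M4 + Bh <= M].
  by rewrite !lerD2r !le_max !lexx !orbT.
have [N1 N2 N3 N4] := MM.
have ye : `|y| <= `|y - h x| + Bh.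
  by have := ler_normD (y - h x) (h x); rewrite subrK; have := hB x; lra.
have big (N : R) : N + Bh <= M -> N < `|(x, y - h x)|.
  move=> NM; rewrite prod_normE/= lt_max; case: (lt_norm2 _ _ zM) => /= H.
    by apply/orP; left; lra.
  by apply/orP; right; lra.
have /= := H1 (x, y - h x) (big _ N1); have /= := H2 (x, y - h x) (big _ N2).
rewrite !sub0r !normrN => n2 n1.
have n3 : `|tr (m x) (y - h x) * w x| <= e / 4.
  rewrite normrM; case: (lt_norm2 _ _ zM) => /= H.
    have w3 : `|w x| < e / 4 / (B + 1) by apply: H3; lra.
    apply: (@le_trans _ _ (B * (e / 4 / (B + 1)))).
      by apply: ler_pM => //; [exact: tr_le|exact: ltW].
    rewrite mulrA ler_pdivrMr//; nra.
  have Hy : M4 < `|y - h x| by lra.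
  have y0 : y - h x != 0 by rewrite -normr_gt0; apply: le_lt_trans Hy; rewrite addr_ge0.
  have s1 : 0 < sg * (y - h x) by rewrite lt_neqAle s0 andbT eq_sym mulf_neq0.
  have Hl : 2 * W / (e / 4) < `|y - h x| - L by rewrite ltrBrDl.
  have l0 : 0 < `|y - h x| - L by apply: le_lt_trans Hl.
  have := tangent_integral_le _ _ _ _ _ _ sheet _ _ _ pk x (y - h x).
  rewrite -subr_gt0 => /(_ l0); rewrite trE// => t_le.
  apply: (@le_trans _ _ (2 / (`|y - h x| - L) * W)); first exact: ler_pM.
  rewrite mulrAC ler_pdivrMr// [leRHS]mulrC -ler_pdivrMr//; exact: ltW.
rewrite /sheet_component/=.
have := ler_normD (near_layer h m w K x (y - h x) + far_layer h w K x (y - h x))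
  (tr (m x) (y - h x) * w x).
by have := ler_normD (near_layer h m w K x (y - h x)) (far_layer h w K x (y - h x)); lra.
Qed.
End sheet_component.

Section sheet_flow.
Context {R : realType}.
Notation mu := (@lebesgue_measure R).
Notation itg D f := (mu.-integrable D (EFin \o f)).

(* The Cauchy-Riemann equations for [u1 - i u2]: the field [(u1, u2)] is free of
   divergence and of curl. *)
Definition cauchy_riemann (u1 u2 A B : R * R -> R) (x y : R) : Prop :=
  [/\ is_derive x 1 (fun s => u1 (s, y)) (A (x, y)),
      is_derive y 1 (fun s => u1 (x, s)) (B (x, y)),
      is_derive x 1 (fun s => u2 (s, y)) (B (x, y)) &
      is_derive y 1 (fun s => u2 (x, s)) (- A (x, y))].

Lemma near_is_derive (f g : R -> R) (x d : R) : (\forall y \near x, f y = g y) ->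
  is_derive x 1 f d -> is_derive x 1 g d.
Proof.
by move=> N; exact: near_eq_is_derive.
Qed.

Lemma is_deriveZl (k : R) (f : R -> R) (x d : R) : is_derive x 1 f d ->
  is_derive x 1 (fun y => k * f y) (k * d).
Proof.
move=> Hf; have H := is_deriveM (is_derive_cst k x 1) Hf.
by apply: (is_derive_eq H); rewrite scaler0 addr0.
Qed.

Lemma phase_sign_neq0 (s : phase) : phase_sign s != 0 :> R.
Proof. by case: s; rewrite /phase_sign/= ?oppr_eq0 oner_neq0. Qed.

Definition sheet_flow1 (h m w : R -> R) (s : phase) (z : R * R) : R :=
  (2 * pi)^-1 * sheet_component h m w kernel1 (trace1 s) z.
Definition sheet_flow2 (h m w : R -> R) (s : phase) (z : R * R) : R :=
  (2 * pi)^-1 * sheet_component h m w kernel2 (trace2 s) z.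

Variables (h m w : R -> R) (C L W : R).
Hypothesis sheet : vortex_sheet h m w C L W.
Notation flow1 := (sheet_flow1 h m w).
Notation flow2 := (sheet_flow2 h m w).

Lemma continuous_sheet_flow (s : phase) : continuous (flow1 s) /\ continuous (flow2 s).
Proof.
split=> z; apply: cvgM; [exact: cvg_cst| |exact: cvg_cst|].
- apply: (continuous_sheet_component _ _ _ _ _ _ sheet _ _ _ planar_kernel1) => k eta z' ck ce.
  exact: (continuous_trace s k eta z' ck ce).1.
- apply: (continuous_sheet_component _ _ _ _ _ _ sheet _ _ _ planar_kernel2) => k eta z' ck ce.
  exact: (continuous_trace s k eta z' ck ce).2.
Qed.

Lemma sheet_flow_vanish (s : phase) (e : R) : 0 < e ->
  exists M, forall z, M < `|z| -> 0 <= phase_sign s * (z.2 - h z.1) ->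
    `|flow1 s z| < e /\ `|flow2 s z| < e.
Proof.
move=> e0; have p0 : 0 < 2 * pi :> R by rewrite mulr_gt0// pi_gt0.
have e1 : 0 < 2 * pi * e by rewrite mulr_gt0.
have [B HB] := trace_bounded L.
have [M1 H1] := sheet_component_vanish _ _ _ _ _ _ sheet _ _ _ planar_kernel1 _ B
  _ (phase_sign_neq0 s) (tangent_integral1 s) (fun k eta kL => (HB s k eta kL).1) _ e1.
have [M2 H2] := sheet_component_vanish _ _ _ _ _ _ sheet _ _ _ planar_kernel2 _ B
  _ (phase_sign_neq0 s) (tangent_integral2 s) (fun k eta kL => (HB s k eta kL).2) _ e1.
exists (Num.max M1 M2) => z; rewrite gt_max => /andP[/H1 + /H2 +] sz.
move=> /(_ sz) h1 /(_ sz) h2.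
by rewrite !normrM gtr0_norm ?invr_gt0// !ltr_pdivrMl.
Qed.

Let off (s : phase) (x y : R) : 0 < phase_sign s * (y - h x) -> y - h x != 0.
Proof. by move=> s0; apply: contraTneq s0 => ->; rewrite mulr0 ltxx. Qed.

Lemma side_near (s : phase) (x y : R) : 0 < phase_sign s * (y - h x) ->
  \forall z \near (x, y), 0 < phase_sign s * ((z : R * R).2 - h z.1).
Proof.
move=> H.
have c : {for (x, y), continuous (fun z : R * R => phase_sign s * (z.2 - h z.1))}.
  apply: cvgM; first exact: cvg_cst.
  exact: (continuous_height _ _ _ _ _ _ sheet (x, y)).
exact: (cvgr_gt _ c).
Qed.

(** The derivatives carry no phase: off the curve the flows of both sides are the same Biot-Savart
    integral. *)
Definition flow_A (z : R * R) : R := (2 * pi)^-1 * field h w kernel_e z.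
Definition flow_B (z : R * R) : R := (2 * pi)^-1 * field h w kernel_d z.

Let kernel_e_le (a b : R) : 0 < a ^+ 2 + b ^+ 2 -> `|kernel_e (a, b)| <= (a ^+ 2 + b ^+ 2)^-1.
Proof. by move=> /(planar_kernel_derive_bound _ _ _ planar_kernel1)[]. Qed.
Let kernel_d_le (a b : R) : 0 < a ^+ 2 + b ^+ 2 -> `|kernel_d (a, b)| <= (a ^+ 2 + b ^+ 2)^-1.
Proof. by move=> /(planar_kernel_derive_bound _ _ _ planar_kernel1)[]. Qed.
Let kernel_e_continuous (a b : R) : 0 < a ^+ 2 + b ^+ 2 -> {for (a, b), continuous kernel_e}.
Proof. by move=> /(planar_kernel_continuous _ _ _ planar_kernel1)[]. Qed.
Let kernel_d_continuous (a b : R) : 0 < a ^+ 2 + b ^+ 2 -> {for (a, b), continuous kernel_d}.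
Proof. by move=> /(planar_kernel_continuous _ _ _ planar_kernel1)[]. Qed.

Lemma continuous_flow_AB (x y : R) : y - h x != 0 ->
  {for (x, y), continuous flow_A} /\ {for (x, y), continuous flow_B}.
Proof.
move=> e0.
have [_ H1] := field_regular _ _ _ _ _ _ sheet kernel_e x y e0 kernel_e_continuous kernel_e_le.
have [_ H2] := field_regular _ _ _ _ _ _ sheet kernel_d x y e0 kernel_d_continuous kernel_d_le.
by split; apply: cvgM => //; exact: cvg_cst.
Qed.

Lemma sheet_flow_cauchy_riemann (s : phase) (x y : R) : 0 < phase_sign s * (y - h x) ->
  cauchy_riemann (flow1 s) (flow2 s) flow_A flow_B x y.
Proof.
move=> s0; have e0 := off _ _ _ s0.
have [d11 d12] := field_derive _ _ _ _ _ _ sheet _ _ _ planar_kernel1 x y e0.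
have [d21 d22] := field_derive _ _ _ _ _ _ sheet _ _ _ planar_kernel2 x y e0.
have N := side_near _ _ _ s0.
have N1 : \forall x' \near x, 0 < phase_sign s * (y - h x').
  have c : {for x, continuous (fun x' : R => (x', y))}.
    by apply: continuous_pair2; [exact: cvg_id|exact: cvg_cst].
  exact: c _ N.
have N2 : \forall y' \near y, 0 < phase_sign s * (y' - h x).
  have c : {for y, continuous (fun y' : R => (x, y'))}.
    by apply: continuous_pair2; [exact: cvg_cst|exact: cvg_id].
  exact: c _ N.
have E1 (x' y' : R) : 0 < phase_sign s * (y' - h x') ->
    (2 * pi)^-1 * field h w kernel1 (x', y') = flow1 s (x', y').
  move=> p; congr (_ * _); rewrite (sheet_component_field _ _ _ _ _ _ sheet _ _ _
      planar_kernel1 _ _ (tangent_integral1 s))//.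
have E2 (x' y' : R) : 0 < phase_sign s * (y' - h x') ->
    (2 * pi)^-1 * field h w kernel2 (x', y') = flow2 s (x', y').
  move=> p; congr (_ * _); rewrite (sheet_component_field _ _ _ _ _ _ sheet _ _ _
      planar_kernel2 _ _ (tangent_integral2 s))//.
split.
- by apply: near_is_derive (is_deriveZl _ _ _ _ d11); apply: filterS N1 => x'; exact: E1.
- by apply: near_is_derive (is_deriveZl _ _ _ _ d12); apply: filterS N2 => y'; exact: E1.
- by apply: near_is_derive (is_deriveZl _ _ _ _ d21); apply: filterS N1 => x'; exact: E2.
- have -> : - flow_A (x, y) = (2 * pi)^-1 * field h w (fun z => - kernel_e z) (x, y).
    rewrite /flow_A -mulrN; congr (_ * _); rewrite /field -mulN1r.
    have [i _] := field_regular _ _ _ _ _ _ sheet kernel_e x y e0 kernel_e_continuous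
        kernel_e_le.
    rewrite -RintegralZl//.
    by apply: eq_Rintegral => u _; rewrite mulN1r mulNr.
  by apply: near_is_derive (is_deriveZl _ _ _ _ d22); apply: filterS N2 => y'; exact: E2.
Qed.

Definition sheet_pv1 (x : R) : R := near_layer h m w kernel1 x 0 + far_layer h w kernel1 x 0.
Definition sheet_pv2 (x : R) : R := near_layer h m w kernel2 x 0 + far_layer h w kernel2 x 0.

(** At height [0] the tangent contributions to the two components are in the ratio [1 : m]. They are
    tangential, so they cancel in the normal component, while the tangential one keeps half of [w],
    with a sign depending on the side. *)
Lemma sheet_flow_normal (s : phase) (x : R) :
  flow2 s (x, h x) - m x * flow1 s (x, h x) = (2 * pi)^-1 * (sheet_pv2 x - m x * sheet_pv1 x).
Proof.
rewrite /sheet_flow1 /sheet_flow2 /sheet_component/= subrr trace1_0 trace2_0.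
by rewrite -/(sheet_pv1 x) -/(sheet_pv2 x); ring.
Qed.

Lemma sheet_flow_tangential (s : phase) (x : R) :
  flow1 s (x, h x) + m x * flow2 s (x, h x) =
  (2 * pi)^-1 * (sheet_pv1 x + m x * sheet_pv2 x) - phase_sign s * w x / 2.
Proof.
rewrite /sheet_flow1 /sheet_flow2 /sheet_component/= subrr trace1_0 trace2_0.
rewrite -/(sheet_pv1 x) -/(sheet_pv2 x).
have p0 := pi_gt0 R; move: (@pi R) p0 => p p0; field.
by rewrite !gt_eqF// ltr_wpDr ?sqr_ge0.
Qed.

(** The two integrands are the normal and tangential combinations of the kernel components. Only
    differences of [f] occur, so the curve may be shifted vertically, as needed for [f + V t]. *)
Lemma PV_integrands (f : R -> R) (x : R) :
  (forall y, f x - f y = h x - h y) -> derive1 f x = m x ->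
  [/\ PV_exists (normal_integrand f w x), PV_exists (tangential_integrand f w x),
      PV_integral (normal_integrand f w x) = sheet_pv2 x - m x * sheet_pv1 x &
      PV_integral (tangential_integrand f w x) = sheet_pv1 x + m x * sheet_pv2 x].
Proof.
move=> fh fm.
have [i1 l1] := PV_layer _ _ _ _ _ _ sheet _ _ _ planar_kernel1 x.
have [i2 l2] := PV_layer _ _ _ _ _ _ sheet _ _ _ planar_kernel2 x.
have mP := @measurable_PV_domain R.
have nE y : normal_integrand f w x y =
    layer h w kernel2 x 0 y - m x * layer h w kernel1 x 0 y.
  by rewrite /normal_integrand /layer /kernel1 /kernel2/= fm fh !add0r; ring.
have tE y : tangential_integrand f w x y =
    layer h w kernel1 x 0 y + m x * layer h w kernel2 x 0 y.
  by rewrite /tangential_integrand /layer /kernel1 /kernel2/= fm fh !add0r; ring.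
have ni d : 0 < d -> itg (PV_domain d) (fun y =>
    layer h w kernel2 x 0 y - m x * layer h w kernel1 x 0 y).
  by move=> d0; apply: itgB; [|exact: i2|apply: itgZ; [|exact: i1]].
have ti d : 0 < d -> itg (PV_domain d) (fun y =>
    layer h w kernel1 x 0 y + m x * layer h w kernel2 x 0 y).
  by move=> d0; apply: itgD; [|exact: i1|apply: itgZ; [|exact: i2]].
have nl : \int[mu]_(y in PV_domain d) normal_integrand f w x y @[d --> 0^'+] -->
    sheet_pv2 x - m x * sheet_pv1 x.
  apply: cvg_trans (cvgB l2 (cvgM (cvg_cst (m x)) l1)); apply: near_eq_cvg.
  near=> d; have d0 : 0 < d by near: d; exact: nbhs_right_gt.
  under [RHS]eq_Rintegral do rewrite nE.
  rewrite RintegralB//; [|exact: mP|exact: i2|by apply: itgZ; [|exact: i1]].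
  by rewrite RintegralZl//; [exact: mP|exact: i1].
have tl : \int[mu]_(y in PV_domain d) tangential_integrand f w x y @[d --> 0^'+] -->
    sheet_pv1 x + m x * sheet_pv2 x.
  apply: cvg_trans (cvgD l1 (cvgM (cvg_cst (m x)) l2)); apply: near_eq_cvg.
  near=> d; have d0 : 0 < d by near: d; exact: nbhs_right_gt.
  under [RHS]eq_Rintegral do rewrite tE.
  rewrite RintegralD//; [|exact: mP|exact: i1|by apply: itgZ; [|exact: i2]].
  by rewrite RintegralZl//; [exact: mP|exact: i2].
split.
- split; last by apply/cvg_ex; eexists; exact: nl.
  by move=> d /ni; apply: eq_itg => // y _; rewrite nE.
- split; last by apply/cvg_ex; eexists; exact: tl.
  by move=> d /ti; apply: eq_itg => // y _; rewrite tE.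
- exact: cvg_lim nl.
- exact: cvg_lim tl.
Unshelve. all: by end_near. Qed.
End sheet_flow.

(** * Liouville's theorem across a curve *)

Section two_sided_liouville.
Context {R : realType}.

Lemma neq0_near (y : R) : y != 0 -> \forall y' \near y, y' != 0.
Proof. exact: open_neq. Qed.

(* The field is only assumed to be continuous across the curve [y = h x]. *)
Lemma two_sided_liouville (h m : R -> R) (U1 U2 : R * R -> R) :
  (forall x : R, is_derive x 1 h (m x)) -> continuous m ->
  continuous U1 -> continuous U2 ->
  (forall x y, y - h x != 0 -> exists A B,
    [/\ \forall z \near (x, y), cauchy_riemann U1 U2 A B (z : R * R).1 z.2,
        {for (x, y), continuous A} & {for (x, y), continuous B}]) ->
  (forall e, 0 < e -> exists M, forall z, M < `|z| -> `|U1 z| < e /\ `|U2 z| < e) ->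
  forall z, U1 z = 0 /\ U2 z = 0.
Proof.
move=> dh cm c1 c2 loc vanish.
pose D (y : R) : Prop := y != 0.
(* The hypothesis gives derivatives separately around each point; the partial derivatives of [U1]
   make one global choice, continuous off the curve. *)
pose A z := 'D_e1 U1 z; pose B z := 'D_e2 U1 z.
have AB (A' B' : R * R -> R) x y : cauchy_riemann U1 U2 A' B' x y ->
    A (x, y) = A' (x, y) /\ B (x, y) = B' (x, y).
  move=> [/is_derive_e1[_ H1] /is_derive_e2[_ H2] _ _]; split.
    by rewrite /A H1.
  by rewrite /B H2.
have cr x y : D (y - h x) -> cauchy_riemann U1 U2 A B x y.
  move=> /loc[A' [B' [/nbhs_singleton/= H _ _]]].
  by have [EA EB] := AB _ _ _ _ H; rewrite /cauchy_riemann EA EB.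
have cA x y : D (y - h x) -> {for (x, y), continuous A}.
  move=> /loc[A' [B' [N H _]]].
  have /= E := (AB _ _ _ _ (nbhs_singleton N)).1.
  rewrite /prop_for /continuous_at E; apply: cvg_trans H; apply: near_eq_cvg.
  by apply: filterS N => -[x' y'] /AB[].
have cB x y : D (y - h x) -> {for (x, y), continuous B}.
  move=> /loc[A' [B' [N _ H]]].
  have /= E := (AB _ _ _ _ (nbhs_singleton N)).2.
  rewrite /prop_for /continuous_at E; apply: cvg_trans H; apply: near_eq_cvg.
  by apply: filterS N => -[x' y'] /AB[].
have oD (y : R) : D y -> \forall y' \near y, D y' by exact: neq0_near.
have reach (y : R) : \forall y' \near y, forall t, Num.min 0 y' < t < Num.max 0 y' -> D t.
  apply/nbhs_ballP; exists 1 => //= y' _ t; rewrite /D; apply: contraTneq => ->.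
  by rewrite gt_min lt_max !ltxx/= lt_asym.
have [Phi [_ dPhi _]] := @potential_exists _ h m U1 U2 B (fun z => - A z) D dh cm c1 c2 oD
  (fun x y Dy => let: And4 _ p _ _ := cr x y Dy in p)
  (fun x y Dy => let: And4 _ _ p _ := cr x y Dy in p)
  (fun x y Dy => let: And4 _ _ _ p := cr x y Dy in p)
  cB (fun x y Dy => cvgN (cA x y Dy)).
have c2' : continuous (fun z => - U2 z) by move=> z; apply: cvgN; exact: c2.
have d2 x y : D (y - h x) -> is_derive y 1 (fun s : R => - U2 (x, s)) (A (x, y)).
  move=> /cr[_ _ _ H]; have := is_deriveN H.
  by move=> H'; apply: (is_derive_eq H'); rewrite opprK.
(* The rotated field [(- U2, U1)] is closed because [(U1, U2)] is free of divergence. *)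
have [Psi [_ dPsi _]] := @potential_exists _ h m (fun z => - U2 z) U1 A B D dh cm c2' c1 oD
  d2
  (fun x y Dy => let: And4 p _ _ _ := cr x y Dy in p)
  (fun x y Dy => let: And4 _ p _ _ := cr x y Dy in p)
  cA cB.
have H1 z : U1 z = 0.
  apply: (liouville U1 U2 Phi Psi c1 c2) => [x y|x y|x y|x y|e /vanish[M HM]].
  - by have [] := dPhi x y (reach _).
  - by have [] := dPhi x y (reach _).
  - by have [] := dPsi x y (reach _).
  - by have [] := dPsi x y (reach _).
  - by exists M => z' /HM[].
have c1' : continuous (fun z => - U1 z) by move=> z; apply: cvgN; exact: c1.
(* The field [(U2, - U1)] is of the same kind, with primitives [- Psi] and [Phi]. *)
have H2 z : U2 z = 0.
  apply: (liouville U2 (fun z => - U1 z) (fun z => - Psi z) Phi c2 c1')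
      => [x y|x y|x y|x y|e /vanish[M HM]].
  - have [H _] := dPsi x y (reach _).
    by have H' := is_deriveN H; apply: (is_derive_eq H'); rewrite opprK.
  - by have [_ H] := dPsi x y (reach _); exact: is_deriveN H.
  - by rewrite opprK; have [] := dPhi x y (reach _).
  - by have [] := dPhi x y (reach _).
  - by exists M => z' /HM[].
by [].
Qed.
End two_sided_liouville.

(** * The flow at a fixed time *)

Section phases.
Context {R : realType}.
Variables (c : constants R) (f m : R -> R) (t : R).
Hypothesis df : forall x : R, is_derive x 1 f (m x).
Notation h := (fun x => f x + speed c * t).
Notation side s z := (phase_sign s * (z.2 - h z.1)).

Lemma fluid_domainE (s : phase) (z : R * R) :
  fluid_domain c f t s z <-> 0 < side s z.
Proof.
case: s; rewrite /fluid_domain/= /phase_sign ?mulN1r ?mul1r ?oppr_gt0 ?subr_gt0 ?subr_lt0//.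
Qed.

Let cf : continuous f.
Proof. by move=> x; exact: (is_derive_continuous _ _ _ (df x)). Qed.

Lemma continuous_side (s : phase) : continuous (fun z : R * R => side s z).
Proof.
move=> z; apply: cvgM; first exact: cvg_cst.
apply: cvgB; first exact: continuous_snd2.
apply: cvgD; last exact: cvg_cst.
by apply: (@continuous_comp _ _ _ fst f); [exact: continuous_fst2|exact: cf].
Qed.

Lemma open_fluid_domain (s : phase) : open (fluid_domain c f t s).
Proof.
have -> : fluid_domain c f t s = (fun z : R * R => side s z) @^-1` [set y | 0 < y].
  by apply/seteqP; split => z /fluid_domainE.
by apply: open_comp; [move=> z _; exact: continuous_side|exact: open_gt].
Qed.

Lemma closure_fluid_domain (s : phase) (z : R * R) :
  closure (fluid_domain c f t s) z <-> 0 <= side s z.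
Proof.
split.
  have cl : closed ((fun z : R * R => side s z) @^-1` [set y | 0 <= y]).
    by apply: closed_comp; [move=> z' _; exact: continuous_side|exact: closed_ge].
  move=> H; apply: cl; apply: closureS H => z' /fluid_domainE; exact: ltW.
move: z => [x y] /= H B /near_box[d d0 HB].
have s2 : phase_sign s * phase_sign s = 1 :> R.
  by case: s {H} => /=; rewrite /phase_sign ?mulrNN mulr1.
exists (x, y + phase_sign s * (d / 2)); split.
  apply/fluid_domainE => /=; rewrite addrAC mulrDr mulrA s2 mul1r.
  by rewrite ltr_wpDl// divr_gt0.
apply: HB; first by rewrite subrr normr0.
rewrite addrC addKr normrM [`|d / 2|]gtr0_norm ?divr_gt0//.
have -> : `|phase_sign s| = 1 :> R by case: s {H s2}; rewrite /phase_sign ?normrN normr1.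
by rewrite mul1r; lra.
Qed.
End phases.

Section smoothness.
Context {R : realType}.

Lemma Cn_open_succ (n : nat) (O : set (R * R)) (u A1 A2 : R * R -> R) : open O ->
  {within O, continuous u} ->
  (forall x y : R, O (x, y) -> is_derive x 1 (fun s => u (s, y)) (A1 (x, y)) /\
     is_derive y 1 (fun s => u (x, s)) (A2 (x, y))) ->
  Cn_open n O A1 -> Cn_open n O A2 -> Cn_open n.+1 O u.
Proof.
move=> oO cu du CA1 CA2; split=> // e [->|->]; split.
- move=> [x y] Oz; have [/is_derive_e1[H _] _] := du x y Oz; exact: H.
- apply: Cn_open_eq CA1 => // -[x y] Oz.
  by have [/is_derive_e1[_ H] _] := du x y Oz; rewrite H.
- move=> [x y] Oz; have [_ /is_derive_e2[H _]] := du x y Oz; exact: H.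
- apply: Cn_open_eq CA2 => // -[x y] Oz.
  by have [_ /is_derive_e2[_ H]] := du x y Oz; rewrite H.
Qed.

Lemma within_open (O : set (R * R)) (u : R * R -> R) : open O ->
  {within O, continuous u} <-> forall z, O z -> {for z, continuous u}.
Proof.
move=> oO; rewrite continuous_open_subspace//; split=> H z.
  by move=> Oz; apply: H; exact: mem_set.
by move=> /set_mem; exact: H.
Qed.

(** With [g] a continuous projection onto [A], data continuous on [A] extend continuously to the
    plane. *)
Lemma continuous_comp_within {Y : nbhsType} (A : set (R * R))
    (g : R * R -> R * R) (u : R * R -> Y) :
  {within A, continuous u} -> continuous g -> (forall z, A (g z)) ->
  continuous (u \o g).
Proof.
move=> cu cg Ag z N HN.
have H : within A (nbhs (g z)) (u @^-1` N).
  by have := cu (g z) N HN; rewrite /nbhs/= -nbhs_subspace_in.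
have : \forall z' \near z, A (g z') -> N (u (g z')) := cg z _ H.
by apply: filterS => z'; apply; exact: Ag.
Qed.
End smoothness.

(** * From the vortex sheet to a solution of Muskat's equations at a fixed time *)

Section sheet_to_flow.
Context {R : realType}.
Variables (c : constants R) (f m w : R -> R) (t C L W : R).
Hypothesis k0 : 0 < permeability c.
Hypothesis mu0 : forall s, 0 < viscosity c s.
Hypothesis df : forall x : R, is_derive x 1 f (m x).
Let h (x : R) : R := f x + speed c * t.
Hypothesis sheet : vortex_sheet h m w C L W.

Let k := permeability c.
Let V := speed c.
Let mu := viscosity c.
Let rho := density c.
Let g := gravity c.
Let sigma := surface_tension c.
Let Omega s := fluid_domain c f t s.

Definition sheet_velocity (s : phase) (z : R * R) : R * R :=
  (sheet_flow1 h m w s z, V + sheet_flow2 h m w s z).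

Let v1 s z := (sheet_velocity s z).1.
Let v2 s z := (sheet_velocity s z).2.
Let A := flow_A h w.
Let B := flow_B h w.

Let dh : forall x : R, is_derive x 1 h (m x).
Proof. exact: (sheet_derive _ _ _ _ _ _ sheet). Qed.
Let cm : continuous m.
Proof. exact: half_holder_continuous (sheet_slope_holder _ _ _ _ _ _ sheet). Qed.

Lemma derive1_interface (x : R) : derive1 f x = m x.
Proof. by rewrite derive1E; have [_ ->] := df x. Qed.

Lemma interface_sub (x y : R) : f x - f y = h x - h y.
Proof. by rewrite /h; ring. Qed.

Lemma fluid_side (s : phase) (x y : R) : Omega s (x, y) <-> 0 < phase_sign s * (y - h x).
Proof. exact: fluid_domainE. Qed.

Let off (s : phase) (x y : R) : 0 < phase_sign s * (y - h x) -> y - h x != 0.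
Proof. by move=> s0; apply: contraTneq s0 => ->; rewrite mulr0 ltxx. Qed.

Lemma continuous_sheet_velocity (s : phase) : continuous (v1 s) /\ continuous (v2 s).
Proof.
have [c1 c2] := continuous_sheet_flow _ _ _ _ _ _ sheet s.
by split=> // z; apply: cvgD; [exact: cvg_cst|exact: c2].
Qed.

Lemma sheet_velocity_cauchy_riemann (s : phase) (x y : R) :
  0 < phase_sign s * (y - h x) -> cauchy_riemann (v1 s) (v2 s) A B x y.
Proof.
move=> /(sheet_flow_cauchy_riemann _ _ _ _ _ _ sheet)[p1 p2 p3 p4].
have D (u : R -> R) (a d : R) : is_derive a 1 u d -> is_derive a 1 (fun a : R => V + u a) d.
  move=> Hu; have H := is_deriveD (is_derive_cst V a 1) Hu.
  by apply: (is_derive_eq H); rewrite add0r.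
by split=> //; exact: D.
Qed.

Lemma sheet_velocity_vanish (s : phase) :
  cvg_at_infinity (closure (Omega s)) (sheet_velocity s) (0, V).
Proof.
move=> e e0; have [M HM] := sheet_flow_vanish _ _ _ _ _ _ sheet s e e0.
exists M => z Hz zM.
have [h1 h2] := HM z zM (proj1 (closure_fluid_domain c f m t df s z) Hz).
by rewrite prod_normE/= gt_max subr0 h1 addrC addKr h2.
Qed.

Lemma sheet_velocity_normal (s : phase) (x : R) :
  dotp (sheet_velocity s (interface_point c f t x)) (- derive1 f x, 1) - V =
  (2 * pi)^-1 * PV_integral (normal_integrand f w x).
Proof.
have [_ _ -> _] := PV_integrands _ _ _ _ _ _ sheet f x (interface_sub x) (derive1_interface x).
rewrite -(sheet_flow_normal h m w s) derive1_interface /dotp/= -/(h x).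
by rewrite /sheet_velocity/=; ring.
Qed.

Lemma sheet_velocity_tangential (s : phase) (x : R) :
  v1 s (x, h x) + v2 s (x, h x) * m x =
  (2 * pi)^-1 * PV_integral (tangential_integrand f w x) - phase_sign s * w x / 2 + m x * V.
Proof.
have [_ _ _ ->] := PV_integrands _ _ _ _ _ _ sheet f x (interface_sub x) (derive1_interface x).
by rewrite -(sheet_flow_tangential h m w s) /v1 /v2/=; ring.
Qed.

Lemma sheet_velocity_jump (x : R) : velocity_jump c f (fun s _ => sheet_velocity s) t x = w x.
Proof.
rewrite /velocity_jump /dotp/= derive1_interface -/(h x).
have := sheet_velocity_tangential minus x; have := sheet_velocity_tangential plus x.
rewrite /v1 /v2 /phase_sign/= => e1 e2.
by move: e1 e2; lra.
Qed.

Let open_Omega s : open (Omega s).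
Proof. exact: (open_fluid_domain c f m t df s). Qed.

Let continuous_AB (s : phase) (z : R * R) : Omega s z ->
  {for z, continuous A} /\ {for z, continuous B}.
Proof.
by case: z => x y /fluid_side/off; exact: continuous_flow_AB _ _ _ _ _ _ sheet x y.
Qed.

Let Cn0 (O : set (R * R)) (u : R * R -> R) : open O ->
  (forall z, O z -> {for z, continuous u}) -> Cn_open 0 O u.
Proof. by move=> oO cu; split=> //; apply/within_open. Qed.

Let dZ (a : R) (u : R -> R) (x d : R) : is_derive x 1 u d ->
    is_derive x 1 (fun y => a * u y) (a * d).
Proof. exact: is_deriveZl. Qed.

Let affine_smooth (s : phase) (a b1 b2 : R) (u u1 u2 : R * R -> R) : continuous u ->
  (forall x y, Omega s (x, y) -> is_derive x 1 (fun s => u (s, y)) (u1 (x, y)) /\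
     is_derive y 1 (fun s => u (x, s)) (u2 (x, y))) ->
  (forall z, Omega s z -> {for z, continuous u1}) ->
  (forall z, Omega s z -> {for z, continuous u2}) ->
  Cn_open 1 (Omega s) (fun z => a * u z + b1).
Proof.
move=> cu du c1 c2; apply: (Cn_open_succ _ _ _ (fun z => a * u1 z) (fun z => a * u2 z)).
- exact: open_Omega.
- apply: continuous_subspaceT => z; apply: cvgD; last exact: cvg_cst.
  by apply: cvgM; [exact: cvg_cst|exact: cu].
- move=> x y /du[H1 H2]; split.
    have H := is_deriveD (dZ a _ _ _ H1) (is_derive_cst b1 x 1).
    by apply: (is_derive_eq H); rewrite addr0.
  have H := is_deriveD (dZ a _ _ _ H2) (is_derive_cst b1 y 1).
  by apply: (is_derive_eq H); rewrite addr0.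
- by apply: (Cn0 _ _ (open_Omega s)) => z Oz; apply: cvgM; [exact: cvg_cst|exact: c1].
- by apply: (Cn0 _ _ (open_Omega s)) => z Oz; apply: cvgM; [exact: cvg_cst|exact: c2].
Qed.

Lemma sheet_velocity_smooth (s : phase) (a b : R) :
  Cn_open 1 (Omega s) (fun z => a * v1 s z + b) /\
  Cn_open 1 (Omega s) (fun z => a * v2 s z + b).
Proof.
have [c1 c2] := continuous_sheet_velocity s.
have cN z : Omega s z -> {for z, continuous (fun z => - A z)}.
  by move=> Oz; apply: cvgN; have [] := continuous_AB s z Oz.
split; [apply: (affine_smooth _ _ _ 0 _ A B)|apply: (affine_smooth _ _ _ 0 _ B (fun z =>
    - A z))] => //.
- by move=> x y /fluid_side/sheet_velocity_cauchy_riemann[].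
- by move=> z /continuous_AB[].
- by move=> z /continuous_AB[].
- by move=> x y /fluid_side/sheet_velocity_cauchy_riemann[].
- by move=> z /continuous_AB[].
Qed.

(** Darcy's law solved for the pressure: its gradient is [a0 s] times the velocity minus
    [(0, rho s * g)]. *)
Let a0 s := - (mu s / k).
Let pressure_solution (p : phase -> R * R -> R) : Prop :=
  [/\ forall s, continuous (p s),
      forall s (x y : R), Omega s (x, y) ->
        is_derive x 1 (fun x => p s (x, y)) (a0 s * v1 s (x, y)) /\
        is_derive y 1 (fun y => p s (x, y)) (a0 s * v2 s (x, y) - rho s * g) &
      forall x, p plus (x, h x) - p minus (x, h x) = sigma * curvature f x].

Hypothesis young_laplace : forall x : R,
  is_derive x 1
    (fun x => sigma * curvature f x
       - (g * (rho minus - rho plus) + (mu minus - mu plus) / k * V) * f x)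
    ((mu minus + mu plus) / (2 * k) * w x
     + (mu minus - mu plus) / (2 * pi * k) * PV_integral (tangential_integrand f w x)).

Let open_side (s : phase) (y : R) : 0 < phase_sign s * y ->
  \forall y' \near y, 0 < phase_sign s * y'.
Proof.
move=> y0; have c0 : {for y, continuous (fun y : R => phase_sign s * y)}.
  by apply: cvgM; [exact: cvg_cst|exact: cvg_id].
exact: (cvgr_gt _ c0).
Qed.

Let side_reach (s : phase) (y : R) : 0 < phase_sign s * y ->
  \forall y' \near y, forall t, Num.min 0 y' < t < Num.max 0 y' -> 0 < phase_sign s * t.
Proof.
move=> y0; apply: filterS (open_side s y y0) => y' y'0 r.
case: s {y0} y'0; rewrite /phase_sign ?mulN1r ?mul1r ?oppr_gt0 => y'0.
  by rewrite min_r ?max_l ?(ltW y'0)// => /andP[].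
by rewrite min_l ?max_r ?(ltW y'0)// => /andP[].
Qed.

Let velocity_potential (s : phase) : exists Phi : R * R -> R, [/\ continuous Phi,
  forall x y : R, 0 < phase_sign s * (y - h x) ->
    is_derive x 1 (fun s => Phi (s, y)) (v1 s (x, y)) /\
    is_derive y 1 (fun s => Phi (x, s)) (v2 s (x, y)) &
  forall x : R, is_derive x 1 (fun s => Phi (s, h s)) (v1 s (x, h x) + v2 s (x, h x) * m x)].
Proof.
have [c1 c2] := continuous_sheet_velocity s.
have cAB x y : 0 < phase_sign s * (y - h x) ->
    {for (x, y), continuous A} /\ {for (x, y), continuous B}.
  by move=> /off; exact: continuous_flow_AB _ _ _ _ _ _ sheet x y.
have CR := sheet_velocity_cauchy_riemann s.
have [Phi [cPhi dPhi tPhi]] := @potential_exists _ h m (v1 s) (v2 s) B (fun z => - A z)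
  (fun y => 0 < phase_sign s * y) dh cm c1 c2 (open_side s)
  (fun x y Dy => let: And4 _ p _ _ := CR x y Dy in p)
  (fun x y Dy => let: And4 _ _ p _ := CR x y Dy in p)
  (fun x y Dy => let: And4 _ _ _ p := CR x y Dy in p)
  (fun x y Dy => (cAB x y Dy).2) (fun x y Dy => cvgN (cAB x y Dy).1).
exists Phi; split=> // x y Dy; apply: dPhi; exact: side_reach.
Qed.

(** In each fluid [q] combines the velocity potential with the hydrostatic pressure. Along the
    interface the derivative of its jump is computed from the tangential traces, and the second
    evolution equation says that it equals the derivative of [sigma * curvature]. The discrepancy is
    thus a constant, removed from the upper pressure. *)
Lemma pressure_exists : exists p, pressure_solution p.
Proof.
have /choice[Phi HPhi] := velocity_potential.
pose q s z := a0 s * Phi s z - rho s * g * z.2.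
pose jump x := q plus (x, h x) - q minus (x, h x) - sigma * curvature f x.
have djump (x : R) : is_derive x 1 jump 0.
  have dq s : is_derive x 1 (fun x => q s (x, h x))
      (a0 s * (v1 s (x, h x) + v2 s (x, h x) * m x) - rho s * g * m x).
    have [_ _ tP] := HPhi s.
    exact: is_deriveB (dZ (a0 s) _ _ _ (tP x)) (dZ (rho s * g) _ _ _ (dh x)).
  have dk := is_deriveD (young_laplace x)
    (dZ (g * (rho minus - rho plus) + (mu minus - mu plus) / k * V) _ _ _ (df x)).
  rewrite [X in is_derive _ _ X _](_ : _ = fun x => sigma * curvature f x) in dk; last first.
    by apply/funext => y; exact: subrK.
  have H := is_deriveB (is_deriveB (dq plus) (dq minus)) dk.
  apply: (is_derive_eq H); rewrite !sheet_velocity_tangential /a0 /phase_sign.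
  set P := PV_integral _; have p0 := pi_gt0 R; move: (@pi R) p0 => p p0.
  have k1 : k != 0 by rewrite gt_eqF.
  by field; rewrite k1 gt_eqF.
have jump_cst x : jump x = jump 0.
  apply: (zero_derive_constant jump).
  by apply: continuous_subspaceT => y; apply: is_derive_continuous (djump y).
exists (fun s z => q s z - if s is plus then jump 0 else 0); split.
- move=> s z; have [cP _ _] := HPhi s.
  apply: cvgB; last exact: cvg_cst.
  apply: cvgB; apply: cvgM; [exact: cvg_cst|exact: cP|exact: cvg_cst|exact: continuous_snd2].
- move=> s x y /fluid_side Oz; have [_ /(_ x y Oz)[d1 d2] _] := HPhi s; split.
    have H := is_deriveB (is_deriveB (dZ (a0 s) _ _ _ d1) (is_derive_cst (rho s * g * y) x 1))
      (is_derive_cst (if s is plus then jump 0 else 0) x 1).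
    by apply: (is_derive_eq H); rewrite !subr0.
  have H := is_deriveB (is_deriveB (dZ (a0 s) _ _ _ d2) (dZ (rho s * g) _ _ _
      (is_derive_id y 1)))
      (is_derive_cst (if s is plus then jump 0 else 0) y 1).
  by apply: (is_derive_eq H); rewrite subr0 mulr1.
- move=> x; rewrite -(jump_cst x) /jump.
  by move: (q plus _) (q minus _) (sigma * curvature f x) => a b d; ring.
Qed.

Lemma sheet_flow_solution : exists p : phase -> R * R -> R,
  [/\ forall s z, fluid_domain c f t s z ->
        divergence (sheet_velocity s) z = 0 /\
        sheet_velocity s z = - (k / mu s) *: (gradient (p s) z + (0, rho s * g)),
      forall x, p plus (interface_point c f t x) - p minus (interface_point c f t x) =
        sigma * curvature f x &
      fluid_regularity c f t (fun s _ => sheet_velocity s) (fun s _ => p s)].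
Proof.
have [p [cp dp jp]] := pressure_exists.
have k1 : k != 0 by rewrite gt_eqF.
have mu1 s : mu s != 0 by rewrite gt_eqF// mu0.
exists p; split=> //.
- move=> s [x y] Oz; have [d1 d2] := dp s x y Oz.
  have /fluid_side/sheet_velocity_cauchy_riemann[r1 _ _ r4] := Oz.
  split.
    rewrite /divergence; have /is_derive_e1[_ ->] := r1; have /is_derive_e2[_ ->] := r4.
    by rewrite subrr.
  rewrite /gradient; have /is_derive_e1[_ ->] := d1; have /is_derive_e2[_ ->] := d2.
  apply/eqP; rewrite xpair_eqE; apply/andP; split; apply/eqP.
    by rewrite /= -[LHS]/(v1 s (x, y)) /GRing.scale/= /a0; field; rewrite k1 mu1.
  by rewrite /= -[LHS]/(v2 s (x, y)) /GRing.scale/= /a0; field; rewrite k1 mu1.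
move=> s; have [c1 c2] := continuous_sheet_velocity s.
have [s1 s2] := sheet_velocity_smooth s 1 0.
have [q1 _] := sheet_velocity_smooth s (a0 s) 0.
have [_ q2] := sheet_velocity_smooth s (a0 s) (- (rho s * g)).
have E (u : R * R -> R) (a b : R) (u' : R * R -> R) : (forall z, a * u z + b = u' z) ->
    Cn_open 1 (Omega s) (fun z => a * u z + b) -> Cn_open 1 (Omega s) u'.
  by move=> uE; apply: Cn_open_eq => // z _; exact: uE.
split.
- apply: continuous_subspaceT => z.
  by apply: (continuous_pair2 (v1 s) (v2 s)); [exact: c1|exact: c2].
- by split; [apply: E s1 => z|apply: E s2 => z]; rewrite mul1r addr0.
- split; first by apply: continuous_subspaceT; exact: cp.
  move=> e [->|->]; split.
  + by move=> [x y] /dp[/is_derive_e1[H _] _]; exact: H.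
  + exists (fun z => a0 s * v1 s z).
      by apply: continuous_subspaceT => z; apply: cvgM; [exact: cvg_cst|exact: c1].
    by move=> [x y] /dp[/is_derive_e1[_ H] _]; rewrite H.
  + by move=> [x y] /dp[_ /is_derive_e2[H _]]; exact: H.
  + exists (fun z => a0 s * v2 s z - rho s * g).
      apply: continuous_subspaceT => z; apply: cvgB; last exact: cvg_cst.
      by apply: cvgM; [exact: cvg_cst|exact: c2].
    by move=> [x y] /dp[_ /is_derive_e2[_ H]]; rewrite H.
- apply: (Cn_open_succ _ _ _ (fun z => a0 s * v1 s z) (fun z => a0 s * v2 s z - rho s * g)).
  + exact: open_Omega.
  + by apply: continuous_subspaceT; exact: cp.
  + by move=> x y /dp.
  + by apply: E q1 => z; rewrite addr0.
  + exact: q2.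
Qed.
End sheet_to_flow.

(** * From a solution of Muskat's equations to the vortex sheet *)

Section flow_to_sheet.
Context {R : realType}.
Variables (c : constants R) (f m w : R -> R) (t C L W : R).
Hypothesis k0 : 0 < permeability c.
Hypothesis mu0 : forall s, 0 < viscosity c s.
Hypothesis df : forall x : R, is_derive x 1 f (m x).
Let h (x : R) : R := f x + speed c * t.
Hypothesis sheet : vortex_sheet h m w C L W.

Let k := permeability c.
Let V := speed c.
Let mu := viscosity c.
Let rho := density c.
Let g := gravity c.
Let sigma := surface_tension c.
Let Omega s := fluid_domain c f t s.
Let Gamma := interface_point c f t.

Variables (v : phase -> R -> R * R -> R * R) (p : phase -> R -> R * R -> R).
Hypothesis reg : fluid_regularity c f t v p.
Hypothesis darcy : forall s z, Omega s z -> divergence (v s t) z = 0 /\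
  v s t z = - (k / mu s) *: (gradient (p s t) z + (0, rho s * g)).
Hypothesis normal : forall x, dotp (v plus t (Gamma x)) (unit_normal f x) =
  dotp (v minus t (Gamma x)) (unit_normal f x).
Hypothesis decay : forall s, cvg_at_infinity (closure (Omega s)) (v s t) (0, V).
Hypothesis jump : forall x, w x = velocity_jump c f v t x.

Let dh : forall x : R, is_derive x 1 h (m x).
Proof. exact: (sheet_derive _ _ _ _ _ _ sheet). Qed.
Let ch : continuous h.
Proof. by move=> x; exact: (is_derive_continuous _ _ _ (dh x)). Qed.
Let cm : continuous m.
Proof. exact: half_holder_continuous (sheet_slope_holder _ _ _ _ _ _ sheet). Qed.
Let open_Omega s : open (Omega s).
Proof. exact: (open_fluid_domain c f m t df s). Qed.

Let closureE (s : phase) (z : R * R) : closure (Omega s) z <-> 0 <= phase_sign s * (z.2 -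
    h z.1).
Proof. exact: closure_fluid_domain. Qed.

(** The vertical projection onto the closed fluid domain, used to extend velocities and pressures
    known only up to the interface. *)
Definition clamp (s : phase) (z : R * R) : R * R :=
  (z.1, if s is plus then Num.max (h z.1) z.2 else Num.min (h z.1) z.2).

Let continuous_hfst : continuous (fun z : R * R => h z.1).
Proof. by move=> z; apply: (@continuous_comp _ _ _ fst h);
    [exact: continuous_fst2|exact: ch]. Qed.

Lemma continuous_clamp (s : phase) : continuous (clamp s).
Proof.
move=> z; apply: (continuous_pair2 fst); first exact: continuous_fst2.
case: s.
  exact: (@continuous_min _ _ (fun z : R * R =>
      h z.1) snd z (continuous_hfst z) (continuous_snd2 z)).
exact: (@continuous_max _ _ (fun z : R * R =>
    h z.1) snd z (continuous_hfst z) (continuous_snd2 z)).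
Qed.

Lemma clamp_closure (s : phase) (z : R * R) : closure (Omega s) (clamp s z).
Proof.
apply/closureE; case: s => /=; rewrite /phase_sign ?mulN1r ?mul1r.
  by rewrite oppr_ge0 subr_le0 ge_min lexx.
by rewrite subr_ge0 le_max lexx.
Qed.

Lemma clamp_id (s : phase) (z : R * R) : 0 <= phase_sign s * (z.2 - h z.1) -> clamp s z = z.
Proof.
case: z => x y; case: s; rewrite /clamp/= /phase_sign ?mulN1r ?mul1r.
  by rewrite oppr_ge0 subr_le0 => H; rewrite min_r.
by rewrite subr_ge0 => H; rewrite max_r.
Qed.

Definition other (s : phase) : phase := if s is plus then minus else plus.

Lemma clamp_other (s : phase) (z : R * R) : 0 <= phase_sign s * (z.2 - h z.1) ->
  clamp (other s) z = (z.1, h z.1).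
Proof.
case: z => x y; case: s; rewrite /clamp/= /phase_sign ?mulN1r ?mul1r.
  by rewrite oppr_ge0 subr_le0 => H; rewrite max_l.
by rewrite subr_ge0 => H; rewrite min_l.
Qed.

Let fluid_side (s : phase) (x y : R) : Omega s (x, y) <-> 0 < phase_sign s * (y - h x).
Proof. exact: fluid_domainE. Qed.

#[local] Opaque sheet_velocity.
Let b s := sheet_velocity c f m w t s.
Let E1 s z := (v s t z).1 - (b s z).1.
Let E2 s z := (v s t z).2 - (b s z).2.

Let continuous_vclamp (s : phase) :
  continuous (fun z => (v s t (clamp s z)).1) /\ continuous (fun z => (v s t (clamp s z)).2).
Proof.
have [cv _ _ _] := reg s.
have H := continuous_comp_within _ (clamp s) (v s t) cv (continuous_clamp s) (clamp_closure s).
split=> z.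
  by apply: (@continuous_comp _ _ _ (v s t \o clamp s) fst); [exact: H|exact: continuous_fst2].
by apply: (@continuous_comp _ _ _ (v s t \o clamp s) snd); [exact: H|exact: continuous_snd2].
Qed.

Let continuous_E (s : phase) :
  continuous (fun z => E1 s (clamp s z)) /\ continuous (fun z => E2 s (clamp s z)).
Proof.
have [c1 c2] := continuous_vclamp s.
have [b1 b2] := continuous_sheet_velocity _ _ _ _ _ _ _ _ sheet s.
split=> z; apply: cvgB.
- exact: c1.
- by apply: (@continuous_comp _ _ _ (clamp s) (fun z => (b s z).1));
    [exact: continuous_clamp|exact: b1].
- exact: c2.
- by apply: (@continuous_comp _ _ _ (clamp s) (fun z => (b s z).2));
    [exact: continuous_clamp|exact: b2].
Qed.

(* Both velocities have the jump [w (1, m) / (1 + m ^ 2)] across the curve. *)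
Let match_E (s : phase) (x : R) : E1 s (x, h x) = E1 plus (x, h x) /\
  E2 s (x, h x) = E2 plus (x, h x).
Proof.
case: s => //.
have d1 := derive1_interface f m df x.
have q0 : 0 < 1 + m x ^+ 2 by rewrite ltr_wpDr ?sqr_ge0.
have s0 : Num.sqrt (1 + m x ^+ 2) != 0 by rewrite gt_eqF// sqrtr_gt0.
have n1 := normal x; have j1 := jump x.
have bn1 := sheet_velocity_normal c f m w t C L W df sheet plus x.
have bn2 := sheet_velocity_normal c f m w t C L W df sheet minus x.
have bj := sheet_velocity_jump c f m w t C L W df sheet x.
move: n1 j1 bn1 bn2 bj; rewrite /unit_normal /velocity_jump /dotp /Gamma /interface_point.
rewrite -/(h x) d1 /= /GRing.scale/= => n1 j1 bn1 bn2 bj.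
have n2 : (v plus t (x, h x)).2 - m x * (v plus t (x, h x)).1 =
    (v minus t (x, h x)).2 - m x * (v minus t (x, h x)).1.
  apply: (mulfI (x := (Num.sqrt (1 + m x ^+ 2))^-1)); first by rewrite invr_eq0.
  by move: n1; move: (_ ^-1) => r n1; lra.
rewrite /E1 /E2 /b.
set v1 := (v plus t (x, h x)).1 in n2 j1 *; set v2 := (v plus t (x, h x)).2 in n2 j1 *.
set v3 := (v minus t (x, h x)).1 in n2 j1 *; set v4 := (v minus t (x, h x)).2 in n2 j1 *.
move: bn1 bn2 bj; set b1 := (sheet_velocity _ _ _ _ _ plus _).1.
set b2 := (sheet_velocity _ _ _ _ _ plus _).2.
set b3 := (sheet_velocity _ _ _ _ _ minus _).1.
set b4 := (sheet_velocity _ _ _ _ _ minus _).2 => bn1 bn2 bj.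
set d := v3 - b3 - (v1 - b1); set d' := v4 - b4 - (v2 - b2).
(* The first relation makes [(d, d')] tangential, the second makes it normal. *)
have dd : d' = m x * d by rewrite /d /d'; lra.
have dd' : d + m x * d' = 0 by rewrite /d /d'; lra.
have d0 : d = 0.
  apply: (mulfI (x := 1 + m x ^+ 2)); first by rewrite gt_eqF.
  by rewrite mulr0 -[RHS]dd' dd; ring.
by split; apply/eqP; rewrite -subr_eq0; apply/eqP; [exact: d0|rewrite -/d' dd d0 mulr0].
Qed.

(** The gluing of the two differences of velocities: on either side the clamp of the other fluid
    lands on the curve, where its term cancels the common trace. Continuity across the curve is then
    inherited from the three terms. *)
Let U1 z := E1 plus (clamp plus z) + E1 minus (clamp minus z) - E1 plus (z.1, h z.1).
Let U2 z := E2 plus (clamp plus z) + E2 minus (clamp minus z) - E2 plus (z.1, h z.1).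

Let UE (s : phase) (z : R * R) : 0 <= phase_sign s * (z.2 - h z.1) ->
  U1 z = E1 s z /\ U2 z = E2 s z.
Proof.
move=> sz; have I := clamp_id s z sz; have O := clamp_other s z sz.
have [m1 m2] := match_E minus z.1.
by case: s sz I O => sz I O; rewrite /U1 /U2 I O ?m1 ?m2; split; ring.
Qed.

Let continuous_curve (u : R * R -> R) : continuous (fun z : R * R => u (clamp plus z)) ->
  continuous (fun z : R * R => u (z.1, h z.1)).
Proof.
move=> cu z.
have E (z' : R * R) : u (z'.1, h z'.1) = u (clamp plus (z'.1, h z'.1)).
  by rewrite clamp_id//= subrr mulr0.
rewrite (_ : (fun z : R * R => u (z.1, h z.1)) = (fun z : R * R =>
    u (clamp plus (z.1, h z.1)))); last first.
  by apply/funext => z'; exact: E.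
apply: (@continuous_comp _ _ _ (fun z : R * R => (z.1, h z.1)) (fun z => u (clamp plus z))).
  by apply: continuous_pair2; [exact: continuous_fst2|exact: continuous_hfst].
exact: cu.
Qed.

Let continuous_U : continuous U1 /\ continuous U2.
Proof.
have [p1 p2] := continuous_E plus; have [q1 q2] := continuous_E minus.
split=> z; apply: cvgB.
- by apply: cvgD; [exact: p1|exact: q1].
- exact: (continuous_curve (E1 plus) p1).
- by apply: cvgD; [exact: p2|exact: q2].
- exact: (continuous_curve (E2 plus) p2).
Qed.

Let vanish_U (e : R) : 0 < e -> exists M, forall z, M < `|z| -> `|U1 z| < e /\ `|U2 z| < e.
Proof.
move=> e0; have e2 : 0 < e / 2 by rewrite divr_gt0.
have H s : exists M, forall z, M < `|z| -> 0 <= phase_sign s * (z.2 - h z.1) ->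
    `|U1 z| < e /\ `|U2 z| < e.
  have [M HM] := decay s _ e2.
  have [N HN] := sheet_velocity_vanish c f m w t C L W df sheet s _ e2.
  exists (Num.max M N) => z; rewrite gt_max => /andP[Mz Nz] sz.
  have cz := proj2 (closureE s z) sz.
  have := HM z cz Mz; have := HN z cz Nz; have [-> ->] := UE s z sz.
  rewrite !prod_normE/= !gt_max !subr0 => /andP[n1 n2] /andP[n3 n4]; split.
    by apply: (le_lt_trans (ler_normB _ _)); rewrite [ltRHS]splitr ltrD.
  rewrite /E2 (_ : _ - _ = ((v s t z).2 - V) - ((b s z).2 - V)); last by ring.
  by apply: (le_lt_trans (ler_normB _ _)); rewrite [ltRHS]splitr ltrD.
have [M HM] := H plus; have [N HN] := H minus.
exists (Num.max M N) => z; rewrite gt_max => /andP[/HM Mz /HN Nz].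
have [zh|zh] := leP (h z.1) z.2.
  by apply: Mz; rewrite /phase_sign mul1r subr_ge0.
by apply: Nz; rewrite /phase_sign mulN1r oppr_ge0 subr_le0 ltW.
Qed.

Let side_of (x y : R) : y - h x != 0 -> exists s, 0 < phase_sign s * (y - h x).
Proof.
by rewrite neq_lt => /orP[H|H]; [exists minus|exists plus];
  rewrite /phase_sign ?mulN1r ?mul1r ?oppr_gt0.
Qed.

Let Cn_derive (n : nat) (O : set (R * R)) (u : R * R -> R) (x y : R) :
  Cn_open n.+1 O u -> O (x, y) ->
  is_derive x 1 (fun s => u (s, y)) ('D_e1 u (x, y)) /\
  is_derive y 1 (fun s => u (x, s)) ('D_e2 u (x, y)).
Proof.
move=> [_ H] Oz; have [H1 _] := H e1 (or_introl erefl); have [H2 _] := H e2 (or_intror erefl).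
by split; [apply/is_derive_e1|apply/is_derive_e2]; apply: DeriveDef => //;
    [exact: H1|exact: H2].
Qed.

Let Omega_near (s : phase) (x y : R) : 0 < phase_sign s * (y - h x) ->
  \forall z \near (x, y), Omega s z.
Proof. by move=> H; apply: (open_nbhs_nbhs); split; [exact: open_Omega|exact/fluid_side]. Qed.

Let near1 (x y : R) (A : set (R * R)) : (\forall z \near (x, y), A z) ->
    \forall x' \near x, A (x', y).
Proof.
move=> N; have cc : {for x, continuous (fun x' : R => (x', y))}.
  by apply: continuous_pair2; [exact: cvg_id|exact: cvg_cst].
exact: cc _ N.
Qed.

Let near2 (x y : R) (A : set (R * R)) : (\forall z \near (x, y), A z) ->
    \forall y' \near y, A (x, y').
Proof.
move=> N; have cc : {for y, continuous (fun y' : R => (x, y'))}.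
  by apply: continuous_pair2; [exact: cvg_cst|exact: cvg_id].
exact: cc _ N.
Qed.

(* The velocity is curl free because it is, up to a constant, a gradient. *)
Let velocity_cauchy_riemann (s : phase) (x y : R) : 0 < phase_sign s * (y - h x) ->
  cauchy_riemann (fun z => (v s t z).1) (fun z => (v s t z).2)
    (fun z => 'D_e1 (fun z => (v s t z).1) z) (fun z => 'D_e2 (fun z => (v s t z).1) z) x y.
Proof.
move=> sxy; have Oz := proj2 (fluid_side s x y) sxy.
have [_ [C1 C2] _ Cp] := reg s.
have [d11 d12] := Cn_derive _ _ _ x y C1 Oz.
have [d21 d22] := Cn_derive _ _ _ x y C2 Oz.
have N := Omega_near s x y sxy.
have [_ Hp] := Cp; have [_ Cp1] := Hp e1 (or_introl erefl).
have [_ Cp2] := Hp e2 (or_intror erefl).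
have c12 : {for (x, y), continuous ('D_e2 ('D_e1 (p s t)))}.
  have [_ H] := Cp1; have [_ [H' _]] := H e2 (or_intror erefl).
  exact: (proj1 (within_open _ _ (open_Omega s)) H').
have c21 : {for (x, y), continuous ('D_e1 ('D_e2 (p s t)))}.
  have [_ H] := Cp2; have [_ [H' _]] := H e1 (or_introl erefl).
  exact: (proj1 (within_open _ _ (open_Omega s)) H').
have S : 'D_e2 ('D_e1 (p s t)) (x, y) = 'D_e1 ('D_e2 (p s t)) (x, y).
  have M := mixed_partials (p s t) ('D_e1 (p s t)) ('D_e2 (p s t))
    ('D_e2 ('D_e1 (p s t))) ('D_e1 ('D_e2 (p s t))) x y.
  apply: (M _ c12 c21); apply: filterS N => -[x' y'] Oz'.
  have [p1 p2] := Cn_derive _ _ _ x' y' Cp Oz'.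
  have [_ p12] := Cn_derive 0 _ _ x' y' Cp1 Oz'.
  have [p21 _] := Cn_derive 0 _ _ x' y' Cp2 Oz'.
  exact: And4 p1 p2 p12 p21.
have v1E z : Omega s z -> - (k / mu s) * 'D_e1 (p s t) z = (v s t z).1.
  by move=> /darcy[_ ->]; rewrite /= addr0.
have v2E z : Omega s z -> - (k / mu s) * 'D_e2 (p s t) z + - (k / mu s) * (rho s * g) =
    (v s t z).2.
  by move=> /darcy[_ ->]; rewrite /= /GRing.scale/= mulrDr.
have [_ q12] := Cn_derive 0 _ _ x y Cp1 Oz.
have [q21 _] := Cn_derive 0 _ _ x y Cp2 Oz.
have H12 : is_derive y 1 (fun y =>
    (v s t (x, y)).1) (- (k / mu s) * 'D_e2 ('D_e1 (p s t)) (x, y)).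
  apply: near_is_derive (is_deriveZl _ _ _ _ q12).
  by apply: filterS (near2 _ _ _ N) => y'; exact: v1E.
have H21 : is_derive x 1 (fun x =>
    (v s t (x, y)).2) (- (k / mu s) * 'D_e1 ('D_e2 (p s t)) (x, y)).
  have H := is_deriveD (is_deriveZl (- (k / mu s)) _ _ _ q21)
    (is_derive_cst (- (k / mu s) * (rho s * g)) x 1).
  rewrite addr0 in H; apply: near_is_derive H.
  by apply: filterS (near1 _ _ _ N) => x'; exact: v2E.
have E12 : 'D_e2 (fun z => (v s t z).1) (x, y) = - (k / mu s) * 'D_e2 ('D_e1 (p s t)) (x, y).
  by have [_ <-] := H12; have [_ E] := d12; exact: esym E.
have r3 : is_derive x 1 (fun s' => (v s t (s', y)).2) ('D_e2 (fun z => (v s t z).1) (x, y)).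
  by rewrite E12 S; exact: H21.
have [dv _] := darcy s (x, y) Oz; rewrite /divergence in dv.
have r4 : is_derive y 1 (fun s' => (v s t (x, s')).2) (- 'D_e1 (fun z => (v s t z).1) (x, y)).
  by apply: (is_derive_eq d22); apply/eqP; rewrite -addr_eq0 addrC dv.
exact: And4 d11 d12 r3 r4.
Qed.

Let U_cauchy_riemann (x y : R) : y - h x != 0 -> exists A B,
  [/\ \forall z \near (x, y), cauchy_riemann U1 U2 A B (z : R * R).1 z.2,
      {for (x, y), continuous A} & {for (x, y), continuous B}].
Proof.
move=> e0; have [s sxy] := side_of x y e0.
have Oz := proj2 (fluid_side s x y) sxy.
have N := Omega_near s x y sxy.
have [cA cB] := continuous_flow_AB _ _ _ _ _ _ sheet x y e0.
have [_ [C1 _] _ _] := reg s.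
exists (fun z => 'D_e1 (fun z => (v s t z).1) z - flow_A h w z),
  (fun z => 'D_e2 (fun z => (v s t z).1) z - flow_B h w z); split.
- apply: filterS N => -[x' y'] Oz'.
  have sz' := proj1 (fluid_side s x' y') Oz'.
  have N' := Omega_near s x' y' sz'.
  have [a1 a2 a3 a4] := velocity_cauchy_riemann s x' y' sz'.
  have [b1 b2 b3 b4] := sheet_velocity_cauchy_riemann c f m w t C L W sheet s x' y' sz'.
  have I1 z : Omega s z -> E1 s z = U1 z.
    by case: z => x0 y0 /fluid_side/ltW sz; have [-> _] := UE s (x0, y0) sz.
  have I2 z : Omega s z -> E2 s z = U2 z.
    by case: z => x0 y0 /fluid_side/ltW sz; have [_ ->] := UE s (x0, y0) sz.
  split=> /=.
  + by apply: near_is_derive (is_deriveB a1 b1); apply: filterS (near1 _ _ _ N') => ?;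
      exact: I1.
  + by apply: near_is_derive (is_deriveB a2 b2); apply: filterS (near2 _ _ _ N') => ?;
      exact: I1.
  + by apply: near_is_derive (is_deriveB a3 b3); apply: filterS (near1 _ _ _ N') => ?;
      exact: I2.
  + rewrite opprD.
    by apply: near_is_derive (is_deriveB a4 b4); apply: filterS (near2 _ _ _ N') => ?;
        exact: I2.
- apply: cvgB; last exact: cA.
  have [_ H] := C1; have [_ [H' _]] := H e1 (or_introl erefl).
  exact: (proj1 (within_open _ _ (open_Omega s)) H').
- apply: cvgB; last exact: cB.
  have [_ H] := C1; have [_ [H' _]] := H e2 (or_intror erefl).
  exact: (proj1 (within_open _ _ (open_Omega s)) H').
Qed.

Lemma velocity_is_sheet_velocity (s : phase) (z : R * R) :
  0 <= phase_sign s * (z.2 - h z.1) -> v s t z = sheet_velocity c f m w t s z.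
Proof.
move=> sz; have [c1 c2] := continuous_U.
have := two_sided_liouville h m U1 U2 dh cm c1 c2 U_cauchy_riemann vanish_U z.
have [-> ->] := UE s z sz; rewrite /E1 /E2 => -[/eqP + /eqP].
rewrite !subr_eq0 => /eqP e1 /eqP e2.
by rewrite -/(b s z); case: (v s t z) (b s z) e1 e2 => ? ? [? ?] /= -> ->.
Qed.

Lemma velocity_normal_trace (s : phase) (x : R) :
  dotp (v s t (Gamma x)) (- derive1 f x, 1) - V =
  (2 * pi)^-1 * PV_integral (normal_integrand f w x).
Proof.
rewrite velocity_is_sheet_velocity ?subrr ?mulr0//.
exact: (sheet_velocity_normal _ _ _ _ _ _ _ _ df sheet).
Qed.

Let a0 s := - (mu s / k).
(** The derivative of the pressure along the curve translated to height [z.2], expressed by Darcy's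
    law through the velocity. In this form it is continuous down to height [0]. *)
Let slope s (z : R * R) : R := a0 s * ((v s t (clamp s (z.1, h z.1 + z.2))).1
  + (v s t (clamp s (z.1, h z.1 + z.2))).2 * m z.1) - rho s * g * m z.1.

Let continuous_slope s : continuous (slope s).
Proof.
have [c1 c2] := continuous_vclamp s; move=> z.
have lz : {for z, continuous (fun z : R * R => (z.1, h z.1 + z.2))}.
  apply: continuous_pair2; first exact: continuous_fst2.
  by apply: cvgD; [exact: continuous_hfst|exact: continuous_snd2].
have mz : {for z, continuous (fun z : R * R => m z.1)}.
  by apply: (@continuous_comp _ _ _ fst m); [exact: continuous_fst2|exact: cm].
apply: cvgB; apply: cvgM; [exact: cvg_cst| |exact: cvg_cst|exact: mz].
apply: cvgD.
  exact: (@continuous_comp _ _ _ _ (fun z => (v s t (clamp s z)).1) z lz (c1 _)).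
apply: cvgM; last exact: mz.
exact: (@continuous_comp _ _ _ _ (fun z => (v s t (clamp s z)).2) z lz (c2 _)).
Qed.

Let pressure_parallel (s : phase) (eta x : R) : 0 < phase_sign s * eta ->
  is_derive x 1 (fun x => p s t (x, h x + eta)) (slope s (x, eta)).
Proof.
move=> se; have sz x' : 0 < phase_sign s * (h x' + eta - h x') by rewrite addrC addKr.
have Oz := proj2 (fluid_side s x (h x + eta)) (sz x).
have [_ _ _ Cp] := reg s.
have N := Omega_near s x _ (sz x).
have [_ Hp] := Cp; have [_ [cp1 _]] := Hp e1 (or_introl erefl).
have [_ [cp2 _]] := Hp e2 (or_intror erefl).
have H0 : is_derive x 1 (fun s : R => h s + eta) (m x).
  have H := is_deriveD (dh x) (is_derive_cst eta x 1).
  by apply: (is_derive_eq H); rewrite addr0.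
have N1 : \forall z \near (x, h x + eta),
    is_derive (z : R * R).1 1 (fun x => p s t (x, z.2)) ('D_e1 (p s t) z).
  by apply: filterS N => -[x' y'] /(Cn_derive _ _ _ x' y' Cp)[].
have N2 : \forall z \near (x, h x + eta),
    is_derive (z : R * R).2 1 (fun y => p s t (z.1, y)) ('D_e2 (p s t) z).
  by apply: filterS N => -[x' y'] /(Cn_derive _ _ _ x' y' Cp)[].
have H := is_derive_chain2 (p s t) ('D_e1 (p s t)) ('D_e2 (p s t)) id (fun x =>
    h x + eta) x 1 (m x)
  N1 N2 (proj1 (within_open _ _ (open_Omega s)) cp1 _ Oz)
  (proj1 (within_open _ _ (open_Omega s)) cp2 _ Oz) (is_derive_id _ _) H0.
apply: (is_derive_eq H); rewrite /slope clamp_id ?(ltW (sz x))//.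
have [_ ->] := darcy s _ Oz; rewrite /gradient/= /GRing.scale/= /a0 addr0.
by field; rewrite !gt_eqF// ?mu0.
Qed.

Let pressure_trace (s : phase) (x : R) :
  is_derive x 1 (fun x => p s t (x, h x)) (slope s (x, 0)).
Proof.
have [_ _ [cp _] _] := reg s.
pose P := p s t \o clamp s.
have cP : continuous P by exact: (continuous_comp_within _ _ _ cp (continuous_clamp s)
    (clamp_closure s)).
have PE z : 0 <= phase_sign s * (z.2 - h z.1) -> P z = p s t z.
  by move=> sz; rewrite /P/= clamp_id.
pose G b eta := prim (fun x => slope s (x, eta)) b - (P (b, h b + eta) - P (0, h 0 + eta)).
have G0 b' eta : 0 < phase_sign s * eta -> G b' eta = 0.
  move=> se; have sz x' : 0 <= phase_sign s * (h x' + eta - h x') by rewrite addrC addKr ltW.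
  have cs : continuous (fun x => slope s (x, eta)).
    by move=> x'; apply: continuous_sec1; exact: continuous_slope.
  have ds (x' : R) : is_derive x' 1 (fun x => p s t (x, h x + eta)) (slope s (x', eta)).
    exact: pressure_parallel.
  rewrite /G; have -> := prim_derive (fun x => p s t (x, h x + eta)) _ b' cs ds.
  by rewrite !PE//= subrr.
have cG b' : {for 0, continuous (G b')}.
  have cl x' : {for 0, continuous (fun eta : R => P (x', h x' + eta))}.
    apply: (@continuous_comp _ _ _ (fun eta => (x', h x' + eta)) P); last exact: cP.
    apply: continuous_pair2; first exact: cvg_cst.
    by apply: cvgD; [exact: cvg_cst|exact: cvg_id].
  apply: cvgB; last by apply: cvgB; exact: cl.
  exact: (continuous_prim_param (slope s)).
have G00 b' : G b' 0 = 0.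
  apply/eqP; rewrite -normr_le0 leNgt; apply/negP => Gp.
  have cn : {for 0, continuous (fun eta => `|G b' eta|)}.
    by apply: (@continuous_comp _ _ _ (G b') (fun x : R => `|x|));
        [exact: cG|exact: norm_continuous].
  have : \forall eta \near (0 : R), 0 < `|G b' eta| by apply: (cvgr_gt _ cn).
  move=> /nbhs_ballP[d /= d0 Hd].
  have : 0 < `|G b' (phase_sign s * (d / 2))|.
    apply: Hd; rewrite /ball/= sub0r normrN.
    by case: (s); rewrite /phase_sign ?mulN1r ?mul1r ?normrN gtr0_norm ?divr_gt0//; lra.
  rewrite G0 ?normr0 ?ltxx//.
  by case: (s); rewrite /phase_sign ?mulN1r ?mul1r ?opprK divr_gt0.
have -> : (fun x => p s t (x, h x)) = (fun b => P (0, h 0) + prim (fun x => slope s (x, 0)) b).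
  apply/funext => b'; have := G00 b'; rewrite /G !addr0 [P (b', _)]PE/= ?subrr ?mulr0//.
  by move/eqP; rewrite subr_eq0 => /eqP ->; rewrite addrC subrK.
have H1 : is_derive x 1 (prim (fun x => slope s (x, 0))) (slope s (x, 0)).
  by apply: (is_derive_prim (fun x => slope s (x, 0))) => x'; apply: continuous_sec1;
      exact: continuous_slope.
have H := is_deriveD (is_derive_cst (P (0, h 0)) x 1) H1.
by apply: (is_derive_eq H); rewrite add0r.
Qed.

Hypothesis young_laplace : forall x,
  p plus t (Gamma x) - p minus t (Gamma x) = sigma * curvature f x.

(** By the Young-Laplace law the curvature term is a difference of pressure traces, which are
    differentiable; this argument serves with and without surface tension. *)
Lemma curvature_derive (x : R) :
  is_derive x 1
    (fun x => sigma * curvature f x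
       - (g * (rho minus - rho plus) + (mu minus - mu plus) / k * V) * f x)
    ((mu minus + mu plus) / (2 * k) * w x
     + (mu minus - mu plus) / (2 * pi * k) * PV_integral (tangential_integrand f w x)).
Proof.
have -> : (fun x => sigma * curvature f x
       - (g * (rho minus - rho plus) + (mu minus - mu plus) / k * V) * f x) =
    (fun x => p plus t (x, h x) - p minus t (x, h x)
       - (g * (rho minus - rho plus) + (mu minus - mu plus) / k * V) * f x).
  by apply/funext => x'; rewrite -young_laplace.
have H := is_deriveB (is_deriveB (pressure_trace plus x) (pressure_trace minus x))
  (is_deriveZl (g * (rho minus - rho plus) + (mu minus - mu plus) / k * V) _ _ _ (df x)).
apply: (is_derive_eq H); rewrite /slope/= addr0 !clamp_id ?subrr ?mulr0//.
rewrite !velocity_is_sheet_velocity ?subrr ?mulr0//.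
rewrite !(sheet_velocity_tangential c f m w t C L W df sheet) -/V.
rewrite /a0 /phase_sign.
set P := PV_integral _; have p0 := pi_gt0 R; move: (@pi R) p0 => q q0.
have k1 : k != 0 by rewrite gt_eqF.
by field; rewrite k1 gt_eqF.
Qed.
End flow_to_sheet.

(** * Equivalence of the two problems *)

Section equivalence.
Context {R : realType}.
Variable c : constants R.
Hypothesis k0 : 0 < permeability c.
Hypothesis mu0 : forall s, 0 < viscosity c s.

Lemma sobolevW (k n : nat) (h : R -> R) : (k <= n)%N -> sobolev n h -> sobolev k h.
Proof. by move=> kn [ch Lh H]; split=> // i ik; apply: H; exact: leq_trans kn. Qed.

Lemma half_holderW (C C' : R) (h : R -> R) : C <= C' -> half_holder C h -> half_holder C' h.
Proof.
by move=> CC' H x y; apply: (le_trans (H x y)); rewrite ler_wpM2r// sqrtr_ge0.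
Qed.

(** [b] is the displacement [V t] of the moving frame, which leaves the slope unchanged; [C1 + C2]
    is a Hoelder constant for slope and density together. *)
Lemma vortex_sheet_exists (f w : R -> R) (b : R) : sobolev 2 f -> sobolev 1 w ->
  exists m C L W, (forall x : R, is_derive x 1 f (m x)) /\
    vortex_sheet (fun x => f x + b) m w C L W.
Proof.
move=> Sf Sw; have [m [C1 [C10 dm hm tm [L mL]]]] := sobolev2_derivative f Sf.
have [C2 C20 hw] := sobolev1_half_holder w Sw.
have Sf1 := sobolevW 1 2 f isT Sf; have [C3 C30 hf] := sobolev1_half_holder f Sf1.
have [_ Lf _] := Sf; have [_ Lw _] := Sw.
have [Bf fB] := half_holder_L2_bounded _ _ hf (proj2 (L2_itg_sqr _ Lf)).
have [W wW] := half_holder_L2_bounded _ _ hw (proj2 (L2_itg_sqr _ Lw)).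
exists m, (C1 + C2), L, W; split=> //; split=> //.
- exact: addr_ge0.
- move=> x; have H := is_deriveD (dm x) (is_derive_cst b x 1).
  by apply: (is_derive_eq H); rewrite addr0.
- by apply: half_holderW hm; rewrite lerDl.
- move=> x y; rewrite (_ : f x + b - (f y + b) = f x - f y); last by ring.
  by apply: (le_trans (tm x y)); rewrite -!mulrA ler_wpM2r ?lerDl.
- exists (Bf + `|b|) => x; apply: (le_trans (ler_normD _ _)).
  by rewrite lerD2r.
- by apply: half_holderW hw; rewrite lerDr.
- exact: (proj2 (L2_itg_sqr _ Lw)).
- exact: half_holder_L2_vanishing C20 hw (proj2 (L2_itg_sqr _ Lw)).
Qed.

Lemma sobolev1_cvg0 (f : R -> R) : sobolev 1 f ->
  f x @[x --> +oo] --> 0 /\ f x @[x --> -oo] --> 0.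
Proof.
move=> Sf; have [C C0 hf] := sobolev1_half_holder f Sf; have [_ Lf _] := Sf.
have v := half_holder_L2_vanishing _ _ C0 hf (proj2 (L2_itg_sqr _ Lf)).
split; apply/cvgrPdist_lt => e /v[M HM]; near=> x; rewrite sub0r normrN; apply: HM.
  apply: (lt_le_trans _ (ler_norm x)); near: x.
  by apply: nbhs_pinfty_gt; exact: num_real.
rewrite -normrN; apply: (lt_le_trans _ (ler_norm (- x))); rewrite ltrNr.
by near: x; apply: nbhs_ninfty_lt; rewrite num_real.
Unshelve. all: by end_near. Qed.

Lemma dotp_unit_normal (f : R -> R) (x : R) (a : R * R) :
  dotp a (unit_normal f x) =
  (Num.sqrt (1 + derive1 f x ^+ 2))^-1 * dotp a (- derive1 f x, 1).
Proof. by rewrite /dotp /unit_normal/= /GRing.scale/=; ring. Qed.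

Variables (T : \bar R) (f0 : R -> R) (f w : R -> R -> R).

(** The flows found at the separate times are collected by [choice]. Their normal trace, in either
    fluid, is the right-hand side of the first evolution equation, so the kinematic condition asks
    for the very derivative already given. *)
Lemma Muskat_of_evolution :
  (forall t, equation_times c T t -> sobolev 2 (f t) /\ sobolev 1 (w t)) ->
  solves_evolution c T f0 f w ->
  exists v p, solves_Muskat c T f0 f v p /\
    forall t, equation_times c T t ->
      (forall x, w t x = velocity_jump c (f t) v t x) /\ fluid_regularity c (f t) t v p.
Proof.
move=> S [ic ev].
have sol t : exists vp : (phase -> R * R -> R * R) * (phase -> R * R -> R),
    equation_times c T t ->
    let v := fun s (_ : R) => vp.1 s in let p := fun s (_ : R) => vp.2 s in
    let Omega := fluid_domain c (f t) t in
    let Gamma := interface_point c (f t) t in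
    [/\ forall s z, Omega s z ->
          divergence (v s t) z = 0 /\
          v s t z = - (permeability c / viscosity c s) *:
            (gradient (p s t) z + (0, density c s * gravity c)),
        forall x, p plus t (Gamma x) - p minus t (Gamma x) =
          surface_tension c * curvature (f t) x,
        forall s, cvg_at_infinity (closure (Omega s)) (v s t) (0, speed c),
        forall s x, dotp (v s t (Gamma x)) (- derive1 (f t) x, 1) - speed c =
          (2 * pi)^-1 * PV_integral (normal_integrand (f t) (w t) x) &
        (forall x, w t x = velocity_jump c (f t) v t x) /\ fluid_regularity c (f t) t v p].
  have [Jt|nJ] := pselect (equation_times c T t); last first.
    (* At times without equations any value will do. *)
    by exists (fun _ _ => 0, fun _ _ => 0).
  have [Sf Sw] := S t Jt.
  have [m [C [L [W [df sheet]]]]] := vortex_sheet_exists _ _ (speed c * t) Sf Sw.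
  have [_ _ yl] := ev t Jt.
  have [p [H1 H2 H3]] := sheet_flow_solution _ _ _ _ _ _ _ _ k0 mu0 df sheet yl.
  exists (fun s => sheet_velocity c (f t) m (w t) t s, p) => _; split=> //=.
  - by move=> s; exact: sheet_velocity_vanish sheet s.
  - by move=> s x; exact: (sheet_velocity_normal _ _ _ _ _ _ _ _ df sheet).
  - by split=> // x; rewrite (sheet_velocity_jump _ _ _ _ _ _ _ _ df sheet).
have [F HF] := choice sol.
exists (fun s t => (F t).1 s), (fun s t => (F t).2 s); split; last first.
  by move=> t /HF[_ _ _ _ ?].
split=> // t Jt /=; have /= [H1 H2 H3 H4 _] := HF t Jt; have [_ ev2 _] := ev t Jt.
have [Sf _] := S t Jt; split=> //.
- move=> x; split; last exact: H2.
  (* The normal velocities of both fluids agree because each is given by the same principal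
     value. *)
  rewrite !dotp_unit_normal; congr (_ * _).
  by have := H4 plus x; rewrite -(H4 minus x) => /addIr.
- exact/sobolev1_cvg0/(sobolevW 1 2).
- move=> s; move: ev2; congr (L2_is_derive _ _ _ _).
  by apply/funext => x; rewrite H4.
Qed.

Lemma evolution_of_Muskat (v : phase -> R -> R * R -> R * R) (p : phase -> R -> R * R -> R) :
  (forall t, equation_times c T t -> [/\ sobolev 2 (f t),
     forall x, w t x = velocity_jump c (f t) v t x, sobolev 1 (w t) &
     fluid_regularity c (f t) t v p]) ->
  solves_Muskat c T f0 f v p -> solves_evolution c T f0 f w.
Proof.
move=> S [ic mus]; split=> // t Jt; have [Sf jump Sw reg] := S t Jt.
have [m [C [L [W [df sheet]]]]] := vortex_sheet_exists _ _ (speed c * t) Sf Sw.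
have /= [darcy normal _ decay kin] := mus t Jt.
have n1 x := proj1 (normal x); have n2 x := proj2 (normal x).
split.
- move=> x; have [] := PV_integrands _ _ _ _ _ _ sheet (f t) x.
  + by move=> y; ring.
  + by rewrite (derive1_interface _ m).
  + by [].
- have := kin plus; congr (L2_is_derive _ _ _ _); apply/funext => x.
  exact: (velocity_normal_trace _ _ _ _ _ _ _ _ df sheet _ _ reg darcy n1 decay jump).
- exact: (curvature_derive _ _ _ _ _ _ _ _ k0 mu0 df sheet _ _ reg darcy n1 decay jump n2).
Qed.
End equivalence.

Theorem proposition2p2 (R : realType) (c : constants R)
    (permeability_gt0 : 0 < permeability c)
    (viscosity_gt0 : forall s, 0 < viscosity c s)
    (density_gt0 : forall s, 0 < density c s)
    (gravity_ge0 : 0 <= gravity c)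
    (T : \bar R) (T_gt0 : (0 < T)%E) (f0 : R -> R) :
  (surface_tension c = 0 ->
   forall f w : R -> R -> R,
     L2_C1 (times0 T) f ->
     ((exists v p,
         solves_Muskat c T f0 f v p /\
         forall t, times0 T t ->
           [/\ sobolev 2 (f t),
               forall x, w t x = velocity_jump c (f t) v t x,
               sobolev 1 (w t) &
               fluid_regularity c (f t) t v p])
      <->
      (solves_evolution c T f0 f w /\
       forall t, times0 T t -> sobolev 2 (f t) /\ sobolev 1 (w t))))
  /\
  (0 < surface_tension c ->
   forall f w : R -> R -> R,
     L2_C1 (times T) f -> L2_continuous (times0 T) f ->
     ((exists v p,
         solves_Muskat c T f0 f v p /\
         forall t, times T t ->
           [/\ sobolev 4 (f t),
               forall x, w t x = velocity_jump c (f t) v t x,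
               sobolev 1 (w t) &
               fluid_regularity c (f t) t v p])
      <->
      (solves_evolution c T f0 f w /\
       forall t, times T t -> sobolev 4 (f t) /\ sobolev 1 (w t)))).
Proof.
have E0 : surface_tension c = 0 -> equation_times c T = times0 T.
  by move=> s0; rewrite /equation_times s0 ltxx.
have E1 : 0 < surface_tension c -> equation_times c T = times T.
  by move=> s0; rewrite /equation_times s0.
split=> [/E0 E f w _|/E1 E f w _ _]; split=> [[v [p [sol H]]]|[ev H]].
- split; last by move=> t /H[].
  by apply: (evolution_of_Muskat _ permeability_gt0 viscosity_gt0 _ _ _ _ v p) sol; rewrite E.
- have [|v [p [sol reg]]] :=
    Muskat_of_evolution _ permeability_gt0 viscosity_gt0 _ _ _ _ _ ev; first by rewrite E.
  exists v, p; split=> // t Jt; have [Sf Sw] := H t Jt.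
  by have [|jump fr] := reg t; [rewrite E|split].
- split; last by move=> t /H[].
  apply: (evolution_of_Muskat _ permeability_gt0 viscosity_gt0 _ _ _ _ v p) sol.
  (* The correspondence is applied to H^2 interfaces; the H^4 regularity is common to both sides of
     the equivalence. *)
  by rewrite E => t /H[Sf ? ? ?]; split=> //; exact: sobolevW Sf.
- have [|v [p [sol reg]]] :=
    Muskat_of_evolution _ permeability_gt0 viscosity_gt0 _ _ _ _ _ ev.
    by rewrite E => t /H[Sf ?]; split=> //; exact: sobolevW Sf.
  exists v, p; split=> // t Jt; have [Sf Sw] := H t Jt.
  by have [|jump fr] := reg t; [rewrite E|split].
Qed.
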